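(* Let $(X_n)_{n\in\mathbb{N}}$ be a stationary absolutely regular sequence of random variables with values in a separable normed linear space $S$ and marginal distribution $F$, and let $h:S\times S\to\mathbb{R}$ be a symmetric, measurable, nondegenerate kernel. Let $l=l(n)$ be a block length with $l(n)\to\infty$ as $n\to\infty$. Assume that for some $\delta>0$ and some $M<\infty$ the following hold: (1) $\iint |h(x_1,x_2)|^{12+\delta}\,dF(x_1)\,dF(x_2)\le M$; (2) $E|h(X_1,X_{1+j})|^{4+\frac{2}{3}\delta}\le M$ for all $j\in\mathbb{N}$; (3) $\beta(n)=O\left(n^{-\frac{3(6+\delta')}{\delta'}}\right)$ for some $0<\delta'<\delta$. Then for $k=1$ and $k=2$, as $n\to\infty$, $$E\left(\mathrm{Var}^{\star}\left(\sqrt{ml}\,U_n^{k*}(h)\right)-\mathrm{Var}\left(\sqrt{n}\,U_n(h)\right)\right)^2=O\left(\frac1l+\frac ln\right).$$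
   Context: The $U$-statistic with kernel $h$ is $U_n(h)=\frac{2}{n(n-1)}\sum_{1\le i<j\le n}h(X_i,X_j)$. The kernel $h$ is called degenerate if $E h(X_1,x)=0$ for all $x$, and nondegenerate otherwise. Mixing: let $\mathcal{F}_a^b$ be the $\sigma$-field generated by $X_a,\dots,X_b$. The absolute regularity coefficients are $\beta(n)=\sup_{k\in\mathbb{N}}E\left(\sup\{|P(B\mid\mathcal{F}_1^k)-P(B)|:B\in\mathcal{F}_{k+n}^{\infty}\}\right)$; the sequence is absolutely regular if $\beta(n)\to0$. Bootstrap versions of the $U$-statistic: let $l=l(n)$ be an integer block length ($2\le l\le n$) and $m=\lfloor n/l\rfloor$. Define index sets $B_1'(i)=\{(a,b): i\le a,b\le i+l-1,\ a<b\}$ for $i=1,\dots,n$, and $B_2'(i)=\{(a,b): l(i-1)+1\le a,b\le il,\ a<b\}$ for $i=1,\dots,m$. Set $\overline{x}_k(i)=\frac{2}{l(l-1)}\sum_{(a,b)\in B_k'(i)}h(X_a,X_b)$ for $k=1$, $i=1,\dots,n$ and for $k=2$, $i=1,\dots,m$, where for $k=1$ only, an observation with index $a>n$ is replaced by the observation with index $a-n$ (circular extension of the sample). Let $T_1(1),T_1(2),\dots$ be i.i.d. uniform on $\{1,\dots,n\}$ and $T_2(1),T_2(2),\dots$ be i.i.d. uniform on $\{1,\dots,m\}$, independent of $(X_n)$. Put $u_j^{k*}=\overline{x}_k(T_k(j))$ and $U_n^{k*}(h)=\frac1m\sum_{j=1}^m u_j^{k*}$ for $k=1,2$ ($k=1$: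 circular blocks, $k=2$: nonoverlapping blocks). $\mathrm{Var}^{\star}$ denotes conditional variance given $X_1,\dots,X_n$. *)

(* Defs.v *)
From HB Require Import structures.
From mathcomp Require Import all_boot all_order all_algebra.
From mathcomp Require Import all_classical all_reals all_analysis.
From mathcomp Require Import measurable_realfun.

Set Implicit Arguments.
Unset Strict Implicit.
Unset Printing Implicit Defensive.
Import Order.TTheory GRing.Theory Num.Theory.
Import numFieldNormedType.Exports.

Local Open Scope classical_set_scope.
Local Open Scope ring_scope.

(* Sequences (X_1, X_2, ...) are functions on nat used at indices >= 1 only:
   X 0 occurs in no definition below. *)

Definition separable (S : topologicalType) :=
  exists D : set S, countable D /\ dense D.

Definition borel (S : ptopologicalType) := g_sigma_algebraType (@open S).

(* u = O(v) for an extended real sequence u; in particular u n is finite for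
   all large n, which would be lost by applying [fine] to u. *)
Definition is_O_infty (R : realType) (u : nat -> \bar R) (v : nat -> R) :=
  exists C : R, \forall n \near \oo, (`|u n| <= (C * `|v n|)%:E)%E.

Section Conditioning.
Context (d : measure_display) (Omega : measurableType d) (R : realType)
  (P : probability Omega R).
Implicit Types (G H : set (set Omega)) (Y : Omega -> R).

Definition sigma_of (d' : measure_display) (T : measurableType d')
    (D : set nat) (X : nat -> Omega -> T) : set (set Omega) :=
  <<s \bigcup_(i in D) g_sigma_algebra_preimage (X i) >>.

(* Below, G is a sub-sigma-field of Omega. *)
Definition is_cexp G Y (f : Omega -> R) :=
  [/\ @measurable_fun _ _ (g_sigma_algebraType G) R setT f,
      P.-integrable setT (EFin \o f) &
      forall A, G A -> (\int[P]_(w in A) (f w)%:E = \int[P]_(w in A) (Y w)%:E)%E].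

(* A version of E(Y | G), which exists as soon as Y is integrable. *)
Definition cexp G Y : Omega -> R := xget (cst 0) [set f | is_cexp G Y f].

Definition cprob G (B : set Omega) : Omega -> R := cexp G \1_B.

Definition cvar G Y : Omega -> R :=
  cexp G (fun w => (Y w - cexp G Y w) ^+ 2).

Definition is_fam_ess_sup (Phi : set (Omega -> R)) (Y : Omega -> \bar R) :=
  [/\ measurable_fun setT Y,
      forall f, Phi f -> {ae P, forall w, ((f w)%:E <= Y w)%E} &
      forall Z : Omega -> \bar R, measurable_fun setT Z ->
        (forall f, Phi f -> {ae P, forall w, ((f w)%:E <= Z w)%E}) ->
        {ae P, forall w, (Y w <= Z w)%E}].

(* The supremum of an uncountable family of almost surely defined functions
   is its essential supremum (the least measurable majorant almost surely). *)
Definition fam_ess_sup (Phi : set (Omega -> R)) : Omega -> \bar R :=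
  xget (cst +oo%E) [set Y | is_fam_ess_sup Phi Y].

Definition cprob_dev G (B : set Omega) (w : Omega) : R :=
  `|cprob G B w - fine (P B)|.

Definition beta_coef (d' : measure_display) (T : measurableType d')
    (X : nat -> Omega -> T) (n : nat) : \bar R :=
  ereal_sup [set (\int[P]_w fam_ess_sup
      [set cprob_dev (sigma_of [set i | (1 <= i <= k)%N] X) B
        | B in sigma_of [set i | (k + n <= i)%N] X] w)%E
    | k in [set k | (1 <= k)%N]].

Definition absolutely_regular (d' : measure_display) (T : measurableType d')
    (X : nat -> Omega -> T) :=
  beta_coef X n @[n --> \oo] --> 0%E.

Definition stationary (d' : measure_display) (T : measurableType d')
    (X : nat -> Omega -> T) :=
  forall (n k : nat) (A : set (n.-tuple T)), measurable A ->
    P [set w | A [tuple X i.+1 w | i < n]] =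
    P [set w | A [tuple X (k + i.+1)%N w | i < n]].

Definition independent_fields G H :=
  forall A B, G A -> H B -> P (A `&` B) = (P A * P B)%E.

Definition mutually_independent (d' : measure_display) (T : measurableType d')
    (D : set nat) (X : nat -> Omega -> T) :=
  forall (J : seq nat) (A : nat -> set T), uniq J ->
    (forall j, j \in J -> D j /\ measurable (A j)) ->
    P (\bigcap_(j in [set` J]) (X j @^-1` A j)) =
    (\prod_(j <- J) P (X j @^-1` A j))%E.

End Conditioning.

Section UStatistics.
Context (R : realType) (S Omega : Type).
Implicit Types (X : nat -> Omega -> S) (h : S -> S -> R).

Definition U_stat X h (n : nat) (w : Omega) : R :=
  2 / (n * (n - 1))%:R *
  \sum_(1 <= i < n.+1) \sum_(1 <= j < n.+1 | (i < j)%N) h (X i w) (X j w).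

Inductive block_scheme := circular | nonoverlapping.

Definition num_blocks (k : block_scheme) (n l : nat) : nat :=
  match k with circular => n | nonoverlapping => n %/ l end.

Definition block_start (k : block_scheme) (l i : nat) : nat :=
  match k with circular => i | nonoverlapping => (l * (i - 1) + 1)%N end.

Definition sample_index (k : block_scheme) (n a : nat) : nat :=
  match k with
  | circular => if (n < a)%N then (a - n)%N else a
  | nonoverlapping => a
  end.

Definition block_U (k : block_scheme) X h (n l i : nat) (w : Omega) : R :=
  let s := block_start k l i in
  2 / (l * (l - 1))%:R *
  \sum_(s <= a < s + l) \sum_(s <= b < s + l | (a < b)%N)
    h (X (sample_index k n a) w) (X (sample_index k n b) w).

(* T j w is the index of the j-th block drawn. *)
Definition boot_U (k : block_scheme) X h (n l : nat) (T : nat -> Omega -> nat)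
    (w : Omega) : R :=
  (n %/ l)%:R^-1 * \sum_(1 <= j < (n %/ l).+1) block_U k X h n l (T j w) w.

End UStatistics.

Section Resampling.
Context (d : measure_display) (Omega : measurableType d) (R : realType)
  (P : probability Omega R).

(* T 1, T 2, ... are i.i.d. uniform on {1, ..., N} and jointly independent of
   the whole sequence X 1, X 2, ... *)
Definition resampling (d' : measure_display) (V : measurableType d')
    (X : nat -> Omega -> V) (N : nat) (T : nat -> Omega -> nat) :=
  [/\ forall j i, (1 <= j)%N -> (1 <= i <= N)%N ->
        P (T j @^-1` [set i]) = (N%:R^-1)%:E,
      mutually_independent P [set j | (1 <= j)%N] T &
      independent_fields P (sigma_of [set j | (1 <= j)%N] T)
                           (sigma_of [set i | (1 <= i)%N] X)].

Definition degenerate (S : Type) (X1 : Omega -> S) (h : S -> S -> R) :=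
  forall x : S, ('E_P[fun w => h (X1 w) x] = 0)%E.

End Resampling.

(* Main.v *)
Require Import Defs.
From HB Require Import structures.
From mathcomp Require Import all_boot all_order all_algebra.
From mathcomp Require Import all_classical all_reals all_analysis.
From mathcomp Require Import measurable_realfun.
From mathcomp Require Import ring lra zify.

Set Implicit Arguments.
Unset Strict Implicit.
Unset Printing Implicit Defensive.
Import Order.TTheory GRing.Theory Num.Theory.
Import numFieldNormedType.Exports.

Local Open Scope classical_set_scope.
Local Open Scope ring_scope.

(** Given the sample, the draws are independent and uniform, so that the
    conditional variance of the resampled statistic is, almost surely, l times
    the empirical variance of the N block statistics (cvar_resampled,
    scheme_cvarE). What remains is a statement on averages over blocks of the
    stationary sequence.

    Let U_i be the statistic of block i minus the mean of the kernel, and split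
    it into a linear part A_i and a degenerate part B_i by the Hoeffding
    decomposition (hoeffding_decomposition). The error is
      mean (l U_i^2 - E l U_i^2) + (mean (E l U_i^2) - Var) - l (mean U_i)^2,
    and the three terms are bounded as follows (block_variance_error).

    - The l U_i^2 have bounded second moments, and two blocks which are r blocks
      apart have a covariance of order (L/r)^2, where L is l for circular blocks
      and 1 for nonoverlapping ones. An average of N of them therefore has
      variance O(L/N), which is O(l/n) (sqr_mean_dev_moment2).
    - For a contiguous block, E l A_i^2 is within O(1/l) of the long-run variance
      because the autocovariances decay like k^-3 (cov_sum_rate). The cross
      term l E A_i B_i is of order l^(-1/2), because E A_i^2 is O(1/l) while
      E B_i^2 is O(1/l^2) (block_second_moment). The square of this bias is
      O(1/l). At most l circular blocks wrap around; they change the average by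
      O(l/n).
    - The mean of the A_i is the linear part of the whole sample, and the mean
      of the l B_i^2 is again an average over blocks, of expectation O(1/l).

    All that is used of the dependence is one inequality. The coefficient of
    absolute regularity bounds the total variation distance between the joint
    law of the past and the future and the product of their laws
    (near_indep_beta, rectangles_dev): the supremum inside the expectation gives
    a density that serves all events at once. With a truncation, a function of a
    past and of a future at distance g whose q-th moments are bounded under both
    laws has nearly the same expectation under both, up to O(g^-3) (decouple).

    The moments of the A_i and B_i are moments of sums of degenerate kernels
    (kernel_sum_moment). Such a power expands over tuples of 2r indices. If the
    leftmost or the rightmost index is isolated by a gap g, decoupling gives an
    expectation of order g^-3, since integrating out the isolated point yields
    0. Using only these two extreme points, the sum over tuples from N indices is
    O(N^(2r-2)): two degrees of freedom are lost (sum_isolated_extremes). This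
    is enough with r = 2 for the kernel h1(x) h1(y), and with r = 2 and r = 4
    for the degenerate kernel h2. *)

(** * Expectations *)

(** The tangent of the convex function $t^p$ at $a$ lies below its graph;
    this is Young's inequality for the conjugate exponents $p$ and $p/(p-1)$. *)
Lemma powR_tangent (R : realType) (p t a : R) : 1 < p -> 0 <= t -> 0 <= a ->
  p * (t * a `^ (p - 1)) <= t `^ p + (p - 1) * a `^ p.
Proof.
move=> p1 t0 a0; have p0 : 0 < p by lra.
have p10 : 0 < p - 1 by lra.
have q0 : 0 < p / (p - 1) by rewrite divr_gt0.
have pq : p^-1 + (p / (p - 1))^-1 = 1 by field; apply/andP; split; lra.
have := conjugate_powR t0 (powR_ge0 a (p - 1)) p0 q0 pq.
rewrite -powRrM (_ : (p - 1) * (p / (p - 1)) = p); last by field; lra.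
move=> H; have {}H := ler_wpM2l (ltW p0) H; apply: le_trans H _.
rewrite mulrDr [X in X + _](_ : _ = t `^ p); last by field; lra.
by rewrite [X in _ + X](_ : _ = (p - 1) * a `^ p)//; field; apply/andP; split; lra.
Qed.

Section Expectation.
Context (d : measure_display) (T : measurableType d) (R : realType)
  (P : probability T R).
Implicit Types f g : T -> R.

Definition L1 f := P.-integrable setT (EFin \o f).

Definition Ex f : R := Rintegral P setT f.

Lemma L1_meas f : L1 f -> measurable_fun setT f.
Proof. by move=> /(measurable_int P) /measurable_EFinP. Qed.

Lemma ExE f : L1 f -> (\int[P]_w (f w)%:E = (Ex f)%:E)%E.
Proof. by move=> Lf; rewrite /Ex /Rintegral fineK// (integrable_fin_num _ Lf). Qed.

Lemma L1_of_lty f : measurable_fun setT f ->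
  (\int[P]_w `|f w|%:E < +oo)%E -> L1 f.
Proof. by move=> mf fM; apply/integrableP; split => //; exact/measurable_EFinP. Qed.

Lemma L1_dom f g : measurable_fun setT f -> (forall w, `|f w| <= g w) ->
  L1 g -> L1 f.
Proof.
move=> mf fg Lg; apply: le_integrable Lg => //; first exact/measurable_EFinP.
by move=> x _ /=; rewrite lee_fin (le_trans (fg x))// ler_norm.
Qed.

Lemma L1_cst (c : R) : L1 (fun=> c).
Proof. exact: finite_measure_integrable_cst. Qed.

Lemma L1_bounded f (c : R) : measurable_fun setT f ->
  (forall w, `|f w| <= c) -> L1 f.
Proof. by move=> mf fc; apply: L1_dom mf fc (L1_cst c). Qed.

Lemma L1_ext f g : (forall w, f w = g w) -> L1 f -> L1 g.
Proof. by move=> /funext ->. Qed.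

Lemma L1D f g : L1 f -> L1 g -> L1 (fun w => f w + g w).
Proof. by move=> Lf Lg; have := integrableD measurableT Lf Lg. Qed.

Lemma L1B f g : L1 f -> L1 g -> L1 (fun w => f w - g w).
Proof. by move=> Lf Lg; have := integrableB measurableT Lf Lg. Qed.

Lemma L1Z (c : R) f : L1 f -> L1 (fun w => c * f w).
Proof. by move=> Lf; have := integrableZl measurableT c Lf. Qed.

Lemma L1_norm f : L1 f -> L1 (fun w => `|f w|).
Proof. by move=> Lf; exact: integrable_norm. Qed.

Lemma L1_sum (I : Type) (s : seq I) (Q : pred I) (F : I -> T -> R) :
  (forall i, Q i -> L1 (F i)) -> L1 (fun w => \sum_(i <- s | Q i) F i w).
Proof.
move=> LF; elim: s => [|i s IH].
  by apply: L1_ext (L1_cst 0) => w; rewrite big_nil.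
case: (boolP (Q i)) => Qi.
  by apply: L1_ext (L1D (LF _ Qi) IH) => w; rewrite big_cons Qi.
by apply: L1_ext IH => w; rewrite big_cons (negbTE Qi).
Qed.

Lemma Ex_ext f g : (forall w, f w = g w) -> Ex f = Ex g.
Proof. by move=> /funext ->. Qed.

Lemma Ex_cst (c : R) : Ex (fun=> c) = c.
Proof. by rewrite /Ex Rintegral_cst// (_ : fine _ = 1) ?mulr1//= probability_setT. Qed.

Lemma ExD f g : L1 f -> L1 g -> Ex (fun w => f w + g w) = Ex f + Ex g.
Proof. by move=> Lf Lg; rewrite /Ex RintegralD. Qed.

Lemma ExB f g : L1 f -> L1 g -> Ex (fun w => f w - g w) = Ex f - Ex g.
Proof. by move=> Lf Lg; rewrite /Ex RintegralB. Qed.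

Lemma ExZ (c : R) f : L1 f -> Ex (fun w => c * f w) = c * Ex f.
Proof. by move=> Lf; rewrite /Ex RintegralZl. Qed.

Lemma Ex_sum (I : Type) (s : seq I) (Q : pred I) (F : I -> T -> R) :
  (forall i, Q i -> L1 (F i)) ->
  Ex (fun w => \sum_(i <- s | Q i) F i w) = \sum_(i <- s | Q i) Ex (F i).
Proof.
move=> LF; elim: s => [|i s IH].
  by rewrite big_nil -[RHS](Ex_cst 0); apply: Ex_ext => w; rewrite big_nil.
rewrite big_cons; case: (boolP (Q i)) => Qi.
  rewrite -IH -ExD ?LF//; last exact: L1_sum.
  by apply: Ex_ext => w; rewrite big_cons Qi.
by rewrite -IH; apply: Ex_ext => w; rewrite big_cons (negbTE Qi).
Qed.

Lemma le_Ex f g : L1 f -> L1 g -> (forall w, f w <= g w) -> Ex f <= Ex g.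
Proof. by move=> Lf Lg fg; apply: le_Rintegral. Qed.

Lemma Ex_ge0 f : (forall w, 0 <= f w) -> 0 <= Ex f.
Proof. by move=> f0; apply: Rintegral_ge0. Qed.

Lemma norm_Ex f : L1 f -> `|Ex f| <= Ex (fun w => `|f w|).
Proof. by move=> Lf; apply: le_normr_Rintegral. Qed.

Lemma sqr_Ex_le f : L1 f -> L1 (fun w => f w ^+ 2) ->
  Ex f ^+ 2 <= Ex (fun w => f w ^+ 2).
Proof.
move=> Lf Lf2; set e := Ex f.
have : 0 <= Ex (fun w => (f w ^+ 2 + (- 2 * e) * f w) + e ^+ 2).
  by apply: Ex_ge0 => w; rewrite [X in 0 <= X](_ : _ = (f w - e) ^+ 2) ?sqr_ge0//; ring.
rewrite (ExD (L1D Lf2 (L1Z _ Lf)) (L1_cst _)) (ExD Lf2 (L1Z _ Lf)) (ExZ _ Lf) Ex_cst -/e.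
by move: (Ex _) => y h1; nra.
Qed.

Lemma ae_eq_Ex f g : measurable_fun setT f -> measurable_fun setT g ->
  {ae P, forall w, f w = g w} -> Ex f = Ex g.
Proof.
move=> mf mg fg; rewrite /Ex /Rintegral; congr fine.
apply: ae_eq_integral => //; try exact/measurable_EFinP.
by apply: filterS fg => w /= -> _.
Qed.

(** The expectation of the tangent inequality for |f| at the mean of |f|. *)
Lemma jensen_powR (p : R) f : 1 < p -> L1 f ->
  L1 (fun w => `|f w| `^ p) ->
  `|Ex f| `^ p <= Ex (fun w => `|f w| `^ p).
Proof.
move=> p1 Lf Lfp; set a := Ex (fun w => `|f w|).
have a0 : 0 <= a by apply: Ex_ge0.
apply: (@le_trans _ _ (a `^ p)).
  by apply: ge0_ler_powR; rewrite ?nnegrE//; [lra|exact: norm_Ex].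
have : Ex (fun w => p * a `^ (p - 1) * `|f w|) <=
       Ex (fun w => `|f w| `^ p + (p - 1) * a `^ p).
  apply: le_Ex.
  - by apply: L1Z; exact: L1_norm.
  - by apply: L1D => //; exact: L1_cst.
  - by move=> w; rewrite -mulrA (mulrC (a `^ _)); exact: powR_tangent.
rewrite ExZ; last exact: L1_norm.
rewrite ExD//; last exact: L1_cst.
rewrite Ex_cst -/a -mulrA (mulrC _ a) mulr_powRB1//; last lra.
by move=> H; lra.
Qed.

End Expectation.

Lemma powR_le1D (R : realType) (x a b : R) : 0 <= x -> 0 <= a <= b ->
  x `^ a <= 1 + x `^ b.
Proof.
move=> x0 /andP[a0 ab]; have [x1|x1] := leP x 1.
  apply: (@le_trans _ _ 1); last by rewrite lerDl powR_ge0.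
  have <- : 1 `^ a = 1 :> R by rewrite powR1.
  by apply: ge0_ler_powR; rewrite ?nnegrE.
by apply: (@le_trans _ _ (x `^ b)); [apply: ler_powR; rewrite // ltW|rewrite lerDr].
Qed.

(** The tangent inequality again, averaged over I. *)
Lemma powR_mean (R : realType) (p : R) (I : finType) (F : I -> R) : 1 < p ->
  `|(#|I|%:R)^-1 * \sum_i F i| `^ p <= (#|I|%:R)^-1 * \sum_i `|F i| `^ p.
Proof.
move=> p1; have [I0|I0] := posnP #|I|.
  by rewrite I0 invr0 !mul0r normr0 powR0//; lra.
set N : R := #|I|%:R; have N0 : 0 < N by rewrite ltr0n.
set a := N^-1 * \sum_i `|F i|.
have a0 : 0 <= a by rewrite mulr_ge0 ?invr_ge0 ?sumr_ge0// ltW.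
apply: (@le_trans _ _ (a `^ p)).
  apply: ge0_ler_powR; rewrite ?nnegrE//; first lra.
  by rewrite normrM gtr0_norm ?invr_gt0// ler_wpM2l ?invr_ge0 ?ler_norm_sum// ltW.
have : \sum_i (p * (`|F i| * a `^ (p - 1))) <=
       \sum_i (`|F i| `^ p + (p - 1) * a `^ p).
  by apply: ler_sum => i _; exact: powR_tangent.
rewrite -mulr_sumr -mulr_suml big_split/= sumr_const -mulr_natl -/N.
have -> : \sum_i `|F i| = N * a by rewrite /a mulVKf// gt_eqF.
rewrite -mulrA mulr_powRB1//; last lra.
move=> H; rewrite -(ler_pM2l N0) mulVKf ?gt_eqF//.
have -> : N * a `^ p = p * (N * a `^ p) - N * ((p - 1) * a `^ p) by ring.
lra.
Qed.

(** * Conditional expectation given a sub-sigma-field *)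

Section AsFiniteMeasure.
Context (d : measure_display) (T : measurableType d) (R : realType)
  (mu : {measure set T -> \bar R}).

(** A copy of mu that carries the finiteness of mu as an instance. *)
Definition as_finite_measure of fin_num_fun mu : set T -> \bar R := mu.

Variable mufin : fin_num_fun mu.

HB.instance Definition _ := Measure.copy (as_finite_measure mufin) mu.

HB.instance Definition _ :=
  Measure_isFinite.Build _ _ _ (as_finite_measure mufin) mufin.

End AsFiniteMeasure.

Section SubField.
Context (d : measure_display) (Omega : measurableType d) (R : realType)
  (P : probability Omega R).
Variable G : set (set Omega).
Hypotheses (sG : sigma_algebra setT G) (mG : G `<=` measurable).

Lemma subfieldE A : @measurable _ (g_sigma_algebraType G) A = G A.
Proof.
apply/propext; split; last exact: sub_sigma_algebra.
by apply: smallest_sub.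
Qed.

Lemma measurable_subfield_id :
  @measurable_fun _ _ Omega (g_sigma_algebraType G) setT (@id Omega).
Proof. by move=> _ A; rewrite setTI subfieldE; exact: mG. Qed.

Lemma measurable_fun_subfield d' (T : measurableType d') (f : Omega -> T) :
  @measurable_fun _ _ (g_sigma_algebraType G) T setT f -> measurable_fun setT f.
Proof.
move=> mf _ A mA; have := mf measurableT A mA.
by rewrite !setTI subfieldE; exact: mG.
Qed.

Definition subfield_id : {mfun Omega >-> g_sigma_algebraType G} :=
  MeasurableFun.Pack
    (MeasurableFun.Class (isMeasurableFun.Build _ _ _ _ _ measurable_subfield_id)).

(** The restriction of P to G. *)
Definition restrict_prob : probability (g_sigma_algebraType G) R :=
  distribution P subfield_id.

Lemma integral_restrict_prob (f : Omega -> \bar R) A : G A ->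
  @measurable_fun _ _ (g_sigma_algebraType G) (\bar R) setT f ->
  P.-integrable setT f ->
  (\int[restrict_prob]_(w in A) f w = \int[P]_(w in A) f w)%E.
Proof.
move=> GA mf If.
rewrite (@integral_pushforward _ _ _ (g_sigma_algebraType G) R subfield_id) //.
- by apply: integrableS If => //; apply: mG.
- by rewrite subfieldE.
Qed.

Lemma integrable_restrict_prob (f : Omega -> \bar R) :
  @measurable_fun _ _ (g_sigma_algebraType G) (\bar R) setT f ->
  (restrict_prob.-integrable setT f <-> P.-integrable setT f).
Proof.
move=> mf; split=> If; last first.
  by apply: (@integrable_pushforward _ _ _ (g_sigma_algebraType G) R subfield_id)
    => //; exact: measurable_subfield_id.
apply/integrableP; split; first exact: measurable_fun_subfield.
case/integrableP : If => _; rewrite ge0_integral_pushforward//.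
exact: measurableT_comp.
Qed.

(** Radon-Nikodym, applied on the coarser measurable space of G. *)
Lemma cexp_indic_exists B : measurable B -> exists f, is_cexp P G \1_B f.
Proof.
move=> mB.
have [nu0 nu0E] : exists nu0 : {measure set (g_sigma_algebraType G) -> \bar R},
    forall A, nu0 A = P (A `&` B).
  unshelve eexists (pushforward (mrestr P mB) subfield_id) => //.
have nufin : fin_num_fun nu0.
  move=> A mA; rewrite nu0E; apply: fin_num_measure; apply: measurableI => //.
  by apply: mG; rewrite -subfieldE.
pose nu : {finite_measure set (g_sigma_algebraType G) -> \bar R} :=
  as_finite_measure nufin.
have nuE A : nu A = P (A `&` B) by exact: nu0E.
have numu : nu `<< restrict_prob.
  move=> A nA C mC CA; have /eqP := nA C mC CA.
  rewrite nuE /restrict_prob /distribution /pushforward/= => PC0.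
  have mC' : measurable (C : set Omega) by apply: mG; rewrite -subfieldE.
  apply/eqP; rewrite -measure_le0 -(eqP PC0) le_measure ?inE//.
  exact: measurableI.
have [f [f0 ffin If fE]] := radon_nikodym_sigma_finite numu.
have mf := measurable_int _ If.
have fK : EFin \o (fine \o f) = f by apply/funext => x /=; rewrite fineK.
exists (fine \o f); split.
- by apply/measurable_EFinP; rewrite fK.
- by rewrite fK; apply/integrable_restrict_prob.
- move=> A GA; under eq_integral do rewrite -[(_)%:E]/((EFin \o (fine \o f)) _) fK.
  have IfP : P.-integrable setT f by apply/integrable_restrict_prob.
  rewrite -(integral_restrict_prob GA mf IfP) -fE ?subfieldE// integral_indic//; last exact: mG.
  by rewrite nuE setIC.
Qed.

(** Both versions integrate to the same charge on G, so that they agree almost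
    surely for the restriction of P to G; a null set of G is a null set. *)
Lemma is_cexp_ae_unique Y f g : is_cexp P G Y f -> is_cexp P G Y g ->
  {ae P, forall w, f w = g w}.
Proof.
move=> [mf If fE] [mg Ig gE].
have mEf : @measurable_fun _ _ (g_sigma_algebraType G) (\bar R) setT (EFin \o f).
  exact/measurable_EFinP.
have mEg : @measurable_fun _ _ (g_sigma_algebraType G) (\bar R) setT (EFin \o g).
  exact/measurable_EFinP.
have : ae_eq restrict_prob setT (EFin \o f) (EFin \o g).
  apply: integral_ae_eq => //; first exact/integrable_restrict_prob.
  move=> E _; rewrite subfieldE => GE.
  by rewrite !integral_restrict_prob// fE// gE.
move=> [N [mN N0 sN]]; exists N; split => //.
- by apply: mG; rewrite -subfieldE.
- move=> w /= fg; apply: sN => /= H; apply: fg.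
  by have [] := H I.
Qed.

End SubField.
(** * Nearly independent sub-sigma-fields *)

Lemma eq_indic (R : realType) (T T' : Type) (A : set T) (B : set T') w v :
  (A w <-> B v) -> \1_A w = \1_B v :> R.
Proof.
move=> AB; rewrite !indicE (_ : (w \in A) = (v \in B))//.
by apply/idP/idP => /set_mem H; apply/mem_set; tauto.
Qed.

(** Counting the integer levels below x recovers x up to one unit. *)
Lemma count_le_bounds (R : realType) (N : nat) (x : R) : 0 <= x <= N%:R ->
  x - 1 <= \sum_(1 <= j < N.+1) ((j%:R <= x)%R)%:R <= x.
Proof.
elim: N => [|N IH] /andP[x0 xN]; first by rewrite big_nil; apply/andP; split; lra.
rewrite big_nat_recr//=; have [xN'|xN'] := leP x N%:R.
  have -> : (N.+1%:R <= x) = false.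
    by apply/negbTE; rewrite -ltNge (le_lt_trans xN')// ltr_nat.
  by rewrite addr0; apply: IH; rewrite x0.
have -> : \sum_(1 <= j < N.+1) ((j%:R <= x)%R)%:R = N%:R :> R.
  rewrite (eq_big_nat _ _ (F2 := fun=> 1)) ?sumr_const_nat ?subn1// => j /andP[_ jN].
  by rewrite (le_trans _ (ltW xN'))// ler_nat.
have xN1 : x <= N%:R + 1 by rewrite -natr1 in xN.
rewrite -natr1; case: (leP (N%:R + 1) x) => /= h; apply/andP; split; lra.
Qed.

Lemma powR_tail (R : realType) (K x q : R) : 0 < K -> K <= x -> 1 <= q ->
  x <= K `^ (1 - q) * x `^ q.
Proof.
move=> K0 Kx q1; have x0 : 0 < x by apply: lt_le_trans Kx.
rewrite -(mulr_powRB1 (ltW x0)); last lra.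
rewrite -opprB powRN mulrCA -[X in X <= _]mulr1 ler_pM2l// mulrC.
rewrite ler_pdivlMr ?powR_gt0// mul1r.
by apply: ge0_ler_powR => //; rewrite ?nnegrE ?subr_ge0// ltW.
Qed.

Section NearIndependence.
Context (d : measure_display) (Omega : measurableType d) (R : realType)
  (P : probability Omega R).
Implicit Types F G : set (set Omega).

(** The defect of independence of F and G, localized on sets A of F by a single
    density Y. A supremum over B of each $|P(B|F)-P(B)|$ yields such a Y, and
    its additivity over the cells of a partition is what makes the bound on
    unions of rectangles below independent of the number of rectangles. *)
Definition near_indep F G (b : R) := exists Y : Omega -> \bar R,
  [/\ measurable_fun setT Y, forall w, (0 <= Y w)%E, (\int[P]_w Y w <= b%:E)%E &
    forall A B, F A -> G B ->
      (`|P (A `&` B) - P A * P B| <= \int[P]_(w in A) Y w)%E].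

(** Finite unions of rectangles, coded by a finite partition of the first
    factor so that the rectangles of one union are over disjoint bases. *)
Definition step_set F G (C : set (Omega * Omega)) :=
  exists (I : finType) (c : Omega -> I) (B : I -> set Omega),
  [/\ forall i, F (c @^-1` [set i]), forall i, G (B i) &
      C = [set z | B (c z.1) z.2]].

Definition rectangles F G : set (set (Omega * Omega)) :=
  [set C | exists A B, [/\ F A, G B & C = A `*` B]].

Section Fields.
Variables (F G : set (set Omega)) (b : R).
Hypotheses (sF : sigma_algebra setT F) (sG : sigma_algebra setT G)
  (mF : F `<=` measurable) (mG : G `<=` measurable).

Let F_meas A : @measurable _ (g_sigma_algebraType F) A = F A.
Proof. exact: subfieldE. Qed.

Let G_meas A : @measurable _ (g_sigma_algebraType G) A = G A.
Proof. exact: subfieldE. Qed.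

(** Two partitions of the first factor have a common refinement, coded by pairs. *)
Lemma step_set_setring : setring (step_set F G).
Proof.
split.
- exists unit, (fun=> tt), (fun=> set0); split => //.
  + move=> [] /=; rewrite -F_meas.
    by rewrite (_ : _ @^-1` _ = setT)//; apply/seteqP; split.
  + by move=> _; rewrite -G_meas.
- move=> C C' [I [c [B [Fc GB ->]]]] [I' [c' [B' [Fc' GB' ->]]]].
  exists (I * I')%type, (fun w => (c w, c' w)), (fun i => B i.1 `|` B' i.2).
  split => //.
  + move=> [i i'] /=; rewrite -F_meas.
    rewrite (_ : _ @^-1` _ = c @^-1` [set i] `&` c' @^-1` [set i']); last first.
      by apply/seteqP; split => w /= [] -> ->.
    by apply: measurableI; rewrite F_meas.
  + by move=> i; rewrite -G_meas; apply: measurableU; rewrite G_meas.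
- move=> C C' [I [c [B [Fc GB ->]]]] [I' [c' [B' [Fc' GB' ->]]]].
  exists (I * I')%type, (fun w => (c w, c' w)), (fun i => B i.1 `\` B' i.2).
  split => //.
  + move=> [i i'] /=; rewrite -F_meas.
    rewrite (_ : _ @^-1` _ = c @^-1` [set i] `&` c' @^-1` [set i']); last first.
      by apply/seteqP; split => w /= [] -> ->.
    by apply: measurableI; rewrite F_meas.
  + by move=> i; rewrite -G_meas; apply: measurableD; rewrite G_meas.
Qed.

Lemma rectangles_step_set : rectangles F G `<=` step_set F G.
Proof.
move=> C [A [B [FA GB ->]]].
exists bool, (fun w => w \in A), (fun i => if i then B else set0); split.
- case; rewrite -F_meas.
  + rewrite (_ : _ @^-1` _ = A) ?F_meas//.
    by apply/seteqP; split => w /= => [/set_mem|/mem_set].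
  + rewrite (_ : _ @^-1` _ = ~` A); last first.
      by apply/seteqP; split => w /= => [/negbT|Aw]; [|apply/negbTE];
        rewrite ?notin_setE// notin_setE.
    by apply: measurableC; rewrite F_meas.
- by case => //; rewrite -G_meas.
- apply/seteqP; split => z /= => [[Az Bz]|]; first by rewrite mem_set.
  by case: ifPn => // /set_mem.
Qed.

Lemma Ex_indic (d' : measure_display) (T : measurableType d')
  (Q : probability T R) (A : set T) : measurable A -> Ex Q \1_A = fine (Q A).
Proof. by move=> mA; rewrite /Ex /Rintegral integral_indic// setIT. Qed.

Lemma L1_indic (d' : measure_display) (T : measurableType d')
  (Q : probability T R) (A : set T) : measurable A -> L1 Q \1_A.
Proof.
move=> mA; apply: (@L1_bounded _ _ _ _ _ 1); first exact: measurable_indic.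
by move=> w; rewrite indicE; case: (_ \in _); rewrite /= ?normr1 ?normr0.
Qed.

Lemma measurable_diag : measurable_fun setT (fun w : Omega => (w, w)).
Proof. by apply: measurable_fun_pair. Qed.

Lemma measurable_step_set C : step_set F G C -> measurable C.
Proof.
move=> [I [c [B [Fc GB ->]]]].
rewrite (_ : [set z | B (c z.1) z.2] =
    \big[setU/set0]_(i : I) ((c @^-1` [set i]) `*` B i)).
  by apply: bigsetU_measurable => i _; apply: measurableX; [exact: mF|exact: mG].
rewrite -bigcup_seq/=; apply/seteqP; split => z /=.
  by move=> Bz; exists (c z.1) => //=; rewrite mem_index_enum.
by move=> [i _ /= [<-]].
Qed.

(** On each cell the defect is at most the integral of Y over the cell, and the
    cells are disjoint: the bounds add up to the integral of Y. *)
Lemma step_set_dev C : near_indep F G b -> step_set F G C ->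
  `|fine (P ((fun w => (w, w)) @^-1` C)) - fine ((P \x P)%E C)| <= b.
Proof.
move=> [Y [mY Y0 Yb HY]] sC; have mC := measurable_step_set sC.
case: sC => I [c [B [Fc GB EC]]].
have mc i : measurable (c @^-1` [set i]) by exact: mF.
have mB i : measurable (B i) by exact: mG.
have mI i : measurable (c @^-1` [set i] `&` B i) by exact: measurableI.
have mdC : measurable ((fun w : Omega => (w, w)) @^-1` C).
  by rewrite -[X in measurable X]setTI; exact: measurable_diag.
have E1 : fine (P ((fun w => (w, w)) @^-1` C)) =
    \sum_i fine (P (c @^-1` [set i] `&` B i)).
  rewrite -Ex_indic// (eq_bigr (fun i => Ex P \1_(c @^-1` [set i] `&` B i))).
    rewrite -Ex_sum; last by move=> i _; exact: L1_indic.
    apply: Ex_ext => w; rewrite (bigD1 (c w))//= big1 ?addr0.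
      by apply: eq_indic; rewrite EC /=; split => [|[]].
    move=> i ic; rewrite indicE memNset// => -[/= ci _].
    by rewrite ci eqxx in ic.
  by move=> i _; rewrite Ex_indic.
have E2 : fine ((P \x P)%E C) =
    \sum_i fine (P (c @^-1` [set i])) * fine (P (B i)).
  rewrite -Ex_indic//.
  rewrite (eq_bigr (fun i => Ex (P \x P)%E \1_((c @^-1` [set i]) `*` B i))).
    rewrite -Ex_sum; last by move=> i _; apply: L1_indic; exact: measurableX.
    apply: Ex_ext => z; rewrite (bigD1 (c z.1))//= big1 ?addr0.
      by apply: eq_indic; rewrite EC /=; split => [|[]].
    move=> i ic; rewrite indicE memNset// => -[/= ci _].
    by rewrite ci eqxx in ic.
  move=> i _; rewrite Ex_indic; last exact: measurableX.
  by rewrite -fineM ?fin_num_measure//; congr fine; exact/esym/product_measure1E.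
rewrite E1 E2 -sumrB; apply: (le_trans (ler_norm_sum _ _ _)).
rewrite -lee_fin -sumEFin.
pose D := \big[setU/set0]_(i <- index_enum I) (c @^-1` [set i]).
have cov : D = setT.
  rewrite /D -bigcup_seq; apply/seteqP; split => // w _.
  by exists (c w) => //=; rewrite mem_index_enum.
apply: (@le_trans _ _ (\int[P]_(w in D) Y w)%E); last by rewrite cov.
rewrite ge0_integral_bigsetU//; last 3 first.
- exact: index_enum_uniq.
- by apply/trivIsetP => i j _ _ /eqP ij; apply/seteqP; split => w //= [ci cj];
    by apply: ij; rewrite -ci.
- by rewrite -/D cov.
apply: lee_sum => i _; apply: le_trans (HY _ _ (Fc i) (GB i)).
rewrite -[P (_ `&` _)]fineK ?fin_num_measure// -[P (_ @^-1` _)]fineK ?fin_num_measure//.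
by rewrite -[P (B i)]fineK ?fin_num_measure// -EFinM -EFinB.
Qed.

Lemma norm_lim_le (u : nat -> R) (x e : R) : u @ \oo --> x ->
  (forall n, `|u n| <= e) -> `|x| <= e.
Proof.
move=> ux ue; have nx : `|u n| @[n --> \oo] --> `|x| by exact: cvg_norm.
by rewrite -(cvg_lim _ nx)//; apply: limr_le; [apply/cvg_ex; eexists; exact: nx|near=> n].
Unshelve. all: by end_near. Qed.

(** The bound is stable under monotone limits and holds on the ring of step sets,
    hence on the generated sigma-field by the monotone class theorem. It says
    that b bounds the total variation distance between the law of (w, w) and
    the product law. *)
Lemma rectangles_dev C : near_indep F G b -> <<s rectangles F G >> C ->
  measurable C /\
  `|fine (P ((fun w => (w, w)) @^-1` C)) - fine ((P \x P)%E C)| <= b.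
Proof.
move=> HFG.
pose D C := fine (P ((fun w => (w, w)) @^-1` C)) - fine ((P \x P)%E C).
pose H : set (set (Omega * Omega)) := [set C | measurable C /\ `|D C| <= b].
have mdiag A : measurable A -> measurable ((fun w : Omega => (w, w)) @^-1` A).
  by move=> mA; rewrite -[X in measurable X]setTI; exact: measurable_diag.
have fcv (d' : measure_display) (T : measurableType d') (Q : probability T R)
    (u : nat -> set T) A : measurable A ->
    Q \o u @ \oo --> Q A -> fine (Q (u n)) @[n --> \oo] --> fine (Q A).
  by move=> mA uA; apply: fine_cvg; rewrite fineK// fin_num_measure.
have monoH : monotone H.
  split=> U mU HU.
    have mUU : measurable (\bigcup_n U n).
      by apply: bigcup_measurable => n _; case: (HU n).
    split => //; apply: (@norm_lim_le (fun n => D (U n))) => [|n]; last by case: (HU n).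
    apply: cvgB; apply: fcv; rewrite ?preimage_bigcup//.
    - by rewrite -preimage_bigcup; exact: mdiag.
    - apply: nondecreasing_cvg_mu.
      + by move=> n; apply: mdiag; case: (HU n).
      + by rewrite -preimage_bigcup; exact: mdiag.
      + by move=> m n mn; apply/subsetPset; apply: preimage_subset; exact/subsetPset/mU.
    - by apply: nondecreasing_cvg_mu => // n; case: (HU n).
  have mUU : measurable (\bigcap_n U n).
    by apply: bigcap_measurable => // n _; case: (HU n).
  split => //; apply: (@norm_lim_le (fun n => D (U n))) => [|n]; last by case: (HU n).
  apply: cvgB; apply: fcv; rewrite ?preimage_bigcap//.
  - by rewrite -preimage_bigcap; exact: mdiag.
  - apply: nonincreasing_cvg_mu.
    + by rewrite (le_lt_trans (probability_le1 _ _)) ?ltry//; apply: mdiag; case: (HU 0%N).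
    + by move=> n; apply: mdiag; case: (HU n).
    + by rewrite -preimage_bigcap; exact: mdiag.
    + by move=> m n mn; apply/subsetPset; apply: preimage_subset; exact/subsetPset/mU.
  - apply: nonincreasing_cvg_mu => //.
    + by rewrite (le_lt_trans (probability_le1 _ _)) ?ltry//; case: (HU 0%N).
    + by move=> n; case: (HU n).
have stepH : step_set F G `<=` H.
  by move=> A sA; split; [exact: measurable_step_set|exact: step_set_dev].
have ringH := monotone_setring_sub_g_sigma_ring monoH step_set_setring stepH.
suff sub : <<s rectangles F G >> `<=` <<sr step_set F G >> by move=> /sub /ringH.
have stepT : step_set F G setT.
  apply: rectangles_step_set; exists setT, setT.
  by rewrite -F_meas -G_meas setXTT.
apply: smallest_sub; last exact: subset_trans rectangles_step_set (@sub_g_sigma_ring _ _).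
have [r0 rD rU] := smallest_sigma_ring (step_set F G).
by split => // A rA; apply: rD => //; exact: sub_g_sigma_ring.
Qed.

Section Functional.
Hypothesis HFG : near_indep F G b.
Variable phi : Omega * Omega -> R.
Hypothesis mphi :
  @measurable_fun _ _ (g_sigma_algebraType (rectangles F G)) R setT phi.

Lemma rectangles_measurable_fun : measurable_fun setT phi.
Proof.
by move=> _ A mA; apply: (rectangles_dev HFG _).1; exact: mphi.
Qed.

Lemma rectangles_measurable_diag : measurable_fun setT (fun w => phi (w, w)).
Proof.
exact: measurableT_comp rectangles_measurable_fun measurable_diag.
Qed.

(** A [0,1]-valued function is within 1/N of an average of N indicators of its
    upper level sets. *)
Lemma unit_dev : (forall z, 0 <= phi z <= 1) ->
  `|Ex P (fun w => phi (w, w)) - Ex (P \x P)%E phi| <= b.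
Proof.
move=> phi01; have mphi' := rectangles_measurable_fun.
have mdiag' := rectangles_measurable_diag.
apply/ler_addgt0Pr => e e0.
pose N := (Num.truncn (2 / e)).+1.
have N0 : 0 < N%:R :> R by rewrite ltr0n.
have Ne : 2 / N%:R < e.
  by rewrite ltr_pdivrMr// mulrC -ltr_pdivrMr// truncnS_gt.
pose A j := [set z | j%:R <= N%:R * phi z].
have mA j : <<s rectangles F G >> (A j).
  have : @measurable_fun _ _ (g_sigma_algebraType (rectangles F G)) R setT
    (fun z => N%:R * phi z) by apply: measurable_funM.
  move=> /(_ measurableT _ (measurable_itv `[j%:R, +oo[)); rewrite setTI.
  rewrite (_ : _ @^-1` _ = A j)//.
  by apply/seteqP; split => z; rewrite /A/= in_itv/= ?andbT.
have mA' j : measurable (A j) by exact: (rectangles_dev HFG (mA j)).1.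
have mAd j : measurable ((fun w => (w, w)) @^-1` A j).
  by rewrite -[X in measurable X]setTI; exact: measurable_diag.
pose S z : R := N%:R^-1 * \sum_(1 <= j < N.+1) \1_(A j) z.
have Sphi z : phi z - N%:R^-1 <= S z <= phi z.
  have /(count_le_bounds) : 0 <= N%:R * phi z <= N%:R.
    by have /andP[? ?] := phi01 z; apply/andP; split;
      [rewrite mulr_ge0// ltW|rewrite ger_pMr].
  rewrite (_ : \sum_(1 <= j < N.+1) _ = \sum_(1 <= j < N.+1) \1_(A j) z :> R); last first.
    apply: eq_bigr => j _; rewrite indicE.
    rewrite (_ : (z \in A j) = (j%:R <= N%:R * phi z))//.
    by apply/idP/idP; rewrite in_setE.
  have -> : \sum_(1 <= j < N.+1) \1_(A j) z = N%:R * S z by rewrite /S mulVKf// gt_eqF.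
  have -> : N%:R * phi z - 1 = N%:R * (phi z - N%:R^-1).
    by rewrite mulrBr mulfV ?gt_eqF.
  by rewrite !ler_pM2l.
have LA j : L1 (P \x P)%E \1_(A j) by exact: L1_indic.
have EA : (fun j w => \1_(A j) (w, w)) =
          (fun j => \1_((fun w => (w, w)) @^-1` A j)) :> (nat -> Omega -> R).
  by apply/funext => j; apply/funext => w; exact: eq_indic.
have LAd j : L1 P (fun w => \1_(A j) (w, w)).
  by rewrite -[X in L1 _ X]/((fun j w => \1_(A j) (w, w)) j) EA; exact: L1_indic.
have L1S : L1 (P \x P)%E S by apply: L1Z; apply: L1_sum.
have L1Sd : L1 P (fun w => S (w, w)).
  by apply: L1Z; apply: L1_sum.
have phi1 z : `|phi z| <= 1 by have /andP[? ?] := phi01 z; rewrite ger0_norm.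
have L1p : L1 (P \x P)%E phi by exact: L1_bounded phi1.
have L1pd : L1 P (fun w => phi (w, w)) by apply: L1_bounded (fun w => phi1 _).
have DS : `|Ex P (fun w => S (w, w)) - Ex (P \x P)%E S| <= b.
  rewrite /S !ExZ; [|by apply: L1_sum|by apply: L1_sum].
  rewrite !Ex_sum//.
  rewrite -mulrBr -sumrB normrM gtr0_norm ?invr_gt0// ler_pdivrMl//.
  apply: (le_trans (ler_norm_sum _ _ _)).
  have -> : N%:R * b = \sum_(1 <= j < N.+1) b.
    by rewrite sumr_const_nat subn1 mulr_natl.
  apply: ler_sum => j _; have := (rectangles_dev HFG (mA j)).2.
  rewrite -Ex_indic// -Ex_indic//.
have B1 : Ex P (fun w => phi (w, w)) - N%:R^-1 <= Ex P (fun w => S (w, w)) <=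
          Ex P (fun w => phi (w, w)).
  apply/andP; split; last by apply: le_Ex => // w; have /andP[] := Sphi (w, w).
  rewrite -[X in _ - X](Ex_cst P) -ExB//; last exact: L1_cst.
  by apply: le_Ex => //[|w]; [apply: L1B => //; exact: L1_cst|have /andP[] := Sphi (w, w)].
have B2 : Ex (P \x P)%E phi - N%:R^-1 <= Ex (P \x P)%E S <= Ex (P \x P)%E phi.
  apply/andP; split; last by apply: le_Ex => // w; have /andP[] := Sphi w.
  rewrite -[X in _ - X](Ex_cst (P \x P)%E) -ExB//; last exact: L1_cst.
  by apply: le_Ex => //[|w]; [apply: L1B => //; exact: L1_cst|have /andP[] := Sphi w].
have : 2 / N%:R = N%:R^-1 + N%:R^-1 :> R by rewrite mulrDl mul1r.
move: B1 B2 DS; rewrite !ler_norml => /andP[h1 h2] /andP[h3 h4] /andP[h5 h6] h7.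
clear - Ne h1 h2 h3 h4 h5 h6 h7; set x := Ex P _ in h1 h2 *; set y := Ex _ _ in h3 h4 *.
by apply/andP; split; lra.
Qed.

End Functional.

Section Functional.
Hypothesis HFG : near_indep F G b.
Variable phi : Omega * Omega -> R.
Hypothesis mphi :
  @measurable_fun _ _ (g_sigma_algebraType (rectangles F G)) R setT phi.

Lemma bounded_dev K : 0 < K -> (forall z, `|phi z| <= K) ->
  `|Ex P (fun w => phi (w, w)) - Ex (P \x P)%E phi| <= 2 * K * b.
Proof.
move=> K0 phiK.
have mphi' := rectangles_measurable_fun HFG mphi.
have mdiag' := rectangles_measurable_diag HFG mphi.
have L1p : L1 (P \x P)%E phi by exact: L1_bounded phiK.
have L1pd : L1 P (fun w => phi (w, w)) by apply: L1_bounded (fun w => phiK _).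
pose psi z := (2 * K)^-1 * (phi z + K).
have mpsi : @measurable_fun _ _ (g_sigma_algebraType (rectangles F G)) R setT psi.
  by apply: measurable_funM => //; apply: measurable_funD.
have psi01 z : 0 <= psi z <= 1.
  have := phiK z; rewrite ler_norml /psi => /andP[? ?].
  rewrite mulr_ge0 ?invr_ge0//=; [|lra..].
  by rewrite ler_pdivrMl; lra.
have := unit_dev HFG mpsi psi01.
rewrite /psi !ExZ; last 2 first.
- by apply: L1D => //; exact: L1_cst.
- by apply: L1D => //; exact: L1_cst.
rewrite !ExD ?Ex_cst//; try exact: L1_cst.
rewrite [X in `|X|](_ : _ =
  (2 * K)^-1 * (Ex P (fun w => phi (w, w)) - Ex (P \x P)%E phi)); last by ring.
by rewrite normrM gtr0_norm ?invr_gt0 ?mulr_gt0// ler_pdivrMl ?mulr_gt0.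
Qed.

End Functional.

(** Truncation at level K trades the defect b of independence against the
    moments of order q. *)
Lemma moment_dev (phi : Omega * Omega -> R) (K q m : R) : near_indep F G b ->
  @measurable_fun _ _ (g_sigma_algebraType (rectangles F G)) R setT phi ->
  0 < K -> 1 <= q ->
  L1 P (fun w => `|phi (w, w)| `^ q) -> L1 (P \x P)%E (fun z => `|phi z| `^ q) ->
  Ex P (fun w => `|phi (w, w)| `^ q) <= m ->
  Ex (P \x P)%E (fun z => `|phi z| `^ q) <= m ->
  `|Ex P (fun w => phi (w, w)) - Ex (P \x P)%E phi| <=
    2 * K * b + 2 * m * K `^ (1 - q).
Proof.
move=> HFG mphi K0 q1 L1d L1p md mp.
have mphi' := rectangles_measurable_fun HFG mphi.
have mdiag' := rectangles_measurable_diag HFG mphi.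
pose psi z := Num.max (- K) (Num.min K (phi z)).
have mpsi : @measurable_fun _ _ (g_sigma_algebraType (rectangles F G)) R setT psi.
  by apply: measurable_maxr => //; apply: measurable_minr.
have psiK z : `|psi z| <= K.
  by rewrite /psi ler_norml; apply/andP; split;
    rewrite ?le_max ?lexx// ge_max ge_min lexx andbT; lra.
have tail z : `|phi z - psi z| <= K `^ (1 - q) * `|phi z| `^ q.
  have t0 : 0 <= K `^ (1 - q) * `|phi z| `^ q by rewrite mulr_ge0 ?powR_ge0.
  rewrite /psi; have [zK|Kz] := leP (phi z) K.
    have [zK'|Kz] := leP (- K) (phi z).
      by rewrite subrr normr0.
    have zn : `|phi z| = - phi z by rewrite ltr0_norm; lra.
    rewrite [X in X <= _](_ : _ = - phi z - K).
      by have := @powR_tail R K `|phi z| q K0; rewrite zn => /(_ _ q1) H;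
        have := H (ltac:(lra)); lra.
    by rewrite opprK ltr0_norm; lra.
  have zn : `|phi z| = phi z by rewrite gtr0_norm; lra.
  have -> : Num.max (- K) K = K by apply/max_idPr; lra.
  rewrite gtr0_norm ?subr_gt0// zn.
  by have := @powR_tail R K (phi z) q K0 (ltW Kz) q1; lra.
have Lt (d' : measure_display) (T : measurableType d') (Q : probability T R)
    (f g : T -> R) : measurable_fun setT f -> L1 Q g -> L1 Q (fun w => `|f w| `^ q) ->
    (forall w, `|f w - g w| <= K `^ (1 - q) * `|f w| `^ q) ->
    L1 Q f /\ `|Ex Q f - Ex Q g| <= K `^ (1 - q) * Ex Q (fun w => `|f w| `^ q).
  move=> mf Lg Lfq fg.
  have Lfg : L1 Q (fun w => f w - g w).
    apply: L1_dom fg _; last exact: L1Z.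
    by apply: measurable_funB => //; exact: L1_meas Lg.
  have Lf : L1 Q f by apply: L1_ext (L1D Lfg Lg) => w; rewrite subrK.
  split => //; rewrite -ExB// -ExZ//; apply: le_trans (norm_Ex Lfg) _.
  by apply: le_Ex => //; [exact: L1_norm|exact: L1Z].
have Lpsi : L1 (P \x P)%E psi.
  by apply: L1_bounded psiK; exact: rectangles_measurable_fun mpsi.
have Lpsid : L1 P (fun w => psi (w, w)).
  by apply: L1_bounded (fun w => psiK _); exact: rectangles_measurable_diag mpsi.
have [Lp Dp] := Lt _ _ (P \x P)%E phi psi mphi' Lpsi L1p tail.
have [Ld Dd] := Lt _ _ P (fun w => phi (w, w)) (fun w => psi (w, w))
  mdiag' Lpsid L1d (fun w => tail _).
have Db := bounded_dev HFG mpsi K0 psiK.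
have k0 : 0 <= K `^ (1 - q) by exact: powR_ge0.
have {}md := ler_wpM2l k0 md; have {}mp := ler_wpM2l k0 mp.
have -> : Ex P (fun w => phi (w, w)) - Ex (P \x P)%E phi =
  (Ex P (fun w => phi (w, w)) - Ex P (fun w => psi (w, w))) +
  (Ex P (fun w => psi (w, w)) - Ex (P \x P)%E psi) +
  (Ex (P \x P)%E psi - Ex (P \x P)%E phi) by ring.
move: Dd Dp; rewrite [X in _ -> X <= _ -> _]distrC => Dd Dp.
apply: le_trans (ler_normD _ _) _.
apply: le_trans (lerD (ler_normD _ _) (lexx _)) _.
clear - Db Dd Dp md mp; lra.
Qed.

End Fields.
End NearIndependence.
(** * Absolute regularity as near independence *)

Section SigmaOf.
Context (d d' : measure_display) (Omega : measurableType d)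
  (T : measurableType d') (X : nat -> Omega -> T).

Lemma sigma_of_sigma_algebra D : sigma_algebra setT (sigma_of D X).
Proof. exact: smallest_sigma_algebra. Qed.

Lemma sigma_of_measurable D : (forall i, measurable_fun setT (X i)) ->
  sigma_of D X `<=` measurable.
Proof.
move=> mX; apply: smallest_sub; first exact: sigma_algebra_measurable.
by move=> A [i _ [B mB <-]]; exact: mX.
Qed.

Lemma sigma_ofS D D' : D `<=` D' -> sigma_of D X `<=` sigma_of D' X.
Proof.
move=> DD'; apply: smallest_sub; first exact: smallest_sigma_algebra.
by move=> A [i Di XA]; apply: sub_sigma_algebra; exists i => //; exact: DD'.
Qed.

Lemma sigma_of_preimage D i A : D i -> measurable A ->
  sigma_of D X (X i @^-1` A).
Proof.
move=> Di mA; apply: sub_sigma_algebra; exists i => //.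
by exists A => //; rewrite setTI.
Qed.

Lemma measurable_sigma_of D i : D i ->
  @measurable_fun _ _ (g_sigma_algebraType (sigma_of D X)) T setT (X i).
Proof.
by move=> Di _ A mA; rewrite setTI; apply: sub_sigma_algebra; exact: sigma_of_preimage.
Qed.

End SigmaOf.

Section Regularity.
Context (d d' : measure_display) (Omega : measurableType d)
  (T : measurableType d') (R : realType) (P : probability Omega R)
  (X : nat -> {RV P >-> T}).

Definition past k := sigma_of [set i | (1 <= i <= k)%N] X.
Definition future k := sigma_of [set i | (k <= i)%N] X.

Let mX i : measurable_fun setT (X i). Proof. by []. Qed.

(** The essential supremum over B of $|P(B|F)-P(B)|$ serves as the density Y. It
    exists when the coefficient is finite, since its default value is +oo. *)
Lemma near_indep_beta k g b : (1 <= k)%N -> (beta_coef P X g <= b%:E)%E ->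
  near_indep P (past k) (future (k + g)) b.
Proof.
move=> k1 betab.
set G := future (k + g).
have sF : sigma_algebra setT (past k) by exact: sigma_of_sigma_algebra.
have mF : past k `<=` measurable by exact: sigma_of_measurable.
have mG : G `<=` measurable by exact: sigma_of_measurable.
pose Phi := [set cprob_dev P (past k) B | B in G].
have Yb : (\int[P]_w fam_ess_sup P Phi w <= b%:E)%E.
  by apply: le_trans betab; apply: ereal_sup_ubound; exists k.
have [mY domY _] : is_fam_ess_sup P Phi (fam_ess_sup P Phi).
  rewrite /fam_ess_sup; case: xgetP => [Y _ //|none].
  move: Yb; rewrite /fam_ess_sup xgetPN// integral_cst//.
  have noty : ~ (+oo * P [set: Omega] <= b%:E)%E.
    by rewrite probability_setT mule1 leNgt ltry.
  by move/noty.
set Y := fam_ess_sup P Phi in mY domY Yb *.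
have dev_ge0 B w : 0 <= cprob_dev P (past k) B w by rewrite /cprob_dev.
have GT : G setT by have [G0 GC _] := @sigma_of_sigma_algebra _ _ _ _ X [set i | (k + g <= i)%N];
  rewrite -[setT]setD0; exact: GC.
have Yae : {ae P, forall w, maxe (Y w) 0%E = Y w}.
  apply: filterS (domY _ (ex_intro2 _ _ _ GT erefl)) => w Yw.
  by apply/max_idPl; apply: le_trans Yw; rewrite lee_fin.
have mY0 : measurable_fun setT (fun w => maxe (Y w) 0%E) by exact: measurable_maxe.
exists (fun w => maxe (Y w) 0%E); split => //.
- by move=> w; rewrite le_max lexx orbT.
- apply: le_trans Yb; rewrite le_eqVlt; apply/orP; left; apply/eqP.
  by apply: ae_eq_integral => //; apply: filterS Yae => w Yw _.
move=> A B FA GB.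
have mA := mF _ FA; have mB := mG _ GB.
have [mf If fE] : is_cexp P (past k) \1_B (cprob P (past k) B).
  have [f fP] := cexp_indic_exists P sF mF mB.
  by rewrite /cprob /cexp; case: xgetP => [f' _ //|/(_ f)].
have mf' : measurable_fun setT (cprob P (past k) B).
  exact: measurable_fun_subfield mf.
have IfA : P.-integrable A (EFin \o cprob P (past k) B) by exact: integrableS If.
have IcA : P.-integrable A (EFin \o cst (fine (P B))).
  exact: finite_measure_integrable_cst.
have -> : (P (A `&` B) - P A * P B =
    \int[P]_(w in A) (cprob P (past k) B w - fine (P B))%:E)%E.
  rewrite integralB_EFin// fE// integral_indic// integral_cst// setIC.
  by rewrite fineK ?fin_num_measure// muleC.
have mdev : measurable_fun A (fun w => (cprob P (past k) B w - fine (P B))%:E).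
  apply: measurable_funTS; apply/measurable_EFinP; exact: measurable_funB.
apply: le_trans (le_abse_integral _ _ mdev) _ => //.
apply: ae_ge0_le_integral => //.
- by apply: measurableT_comp.
- by move=> w _; rewrite le_max lexx orbT.
- exact: measurable_funTS.
apply: filterS2 Yae (domY _ (ex_intro2 _ _ _ GB erefl)) => w -> H _.
exact: H.
Qed.

End Regularity.
(** * Summing over index tuples with isolated extreme points *)

Section Counting.
Context (R : realType).

(** A summable weight whose square is the rate $(1+g)^{-3}$, so that the gap
    bound at the left end and the one at the right end can be used jointly. *)
Definition gap_weight (g : nat) : R := (g.+1%:R * Num.sqrt g.+1%:R)^-1.

Lemma gap_weight_ge0 g : 0 <= gap_weight g.
Proof. by rewrite invr_ge0 mulr_ge0// sqrtr_ge0. Qed.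

Lemma gap_weight_sqr g : gap_weight g ^+ 2 = (g.+1%:R ^+ 3)^-1.
Proof.
rewrite /gap_weight exprVn exprMn sqr_sqrtr//.
by rewrite -exprSr.
Qed.

(** Telescoping comparison with $2/\sqrt{m}$. *)
Lemma sum_gap_weight n : \sum_(d < n) gap_weight d <= 3.
Proof.
have H m : \sum_(d < m.+1) gap_weight d <= 3 - 2 / Num.sqrt m.+1%:R.
  elim: m => [|m IH].
    by rewrite big_ord_recl big_ord0 /gap_weight sqrtr1 !mulr1 invr1; lra.
  rewrite big_ord_recr/=.
  set a := Num.sqrt m.+1%:R in IH *; set b := Num.sqrt m.+2%:R.
  have a0 : 0 < a by rewrite sqrtr_gt0.
  have b0 : 0 < b by rewrite sqrtr_gt0.
  have ab : a <= b by rewrite ler_sqrt// ler_nat.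
  have Eb : m.+2%:R = b ^+ 2 :> R by rewrite sqr_sqrtr.
  have Ea : b ^+ 2 = a ^+ 2 + 1 by rewrite !sqr_sqrtr// natr1.
  apply: le_trans (lerD IH (lexx _)) _.
  rewrite /gap_weight -/b Eb.
  suff : (b ^+ 2 * b)^-1 <= 2 / a - 2 / b by lra.
  rewrite -(ler_pM2l (_ : 0 < a * b ^+ 2 * b)); last by rewrite !mulr_gt0// exprn_gt0.
  have -> : a * b ^+ 2 * b * (b ^+ 2 * b)^-1 = a by field; rewrite gt_eqF.
  have -> : a * b ^+ 2 * b * (2 / a - 2 / b) = 2 * b ^+ 2 * (b - a).
    by field; rewrite !gt_eqF.
  have h1 : (b - a) * (b + a) = 1 by rewrite -subr_sqr Ea; ring.
  rewrite -(ler_pM2r (_ : 0 < b + a)); last by rewrite addr_gt0.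
  by rewrite -(mulrA (2 * b ^+ 2)) h1; nra.
case: n => [|n]; first by rewrite big_ord0.
by apply: le_trans (H n) _; rewrite gerBl divr_ge0// sqrtr_ge0.
Qed.

Definition dist_nat (m n : nat) : nat := ((m - n) + (n - m))%N.

(** Each distance to x is attained by at most two indices. *)
Lemma sum_dist_le (J : finType) (idx : J -> nat) (x : nat) (f : nat -> R) (B : R) :
  injective idx -> (forall n, 0 <= f n) -> (forall n, \sum_(d < n) f d <= B) ->
  \sum_j f (dist_nat x (idx j)) <= 2 * B.
Proof.
move=> inj f0 fB.
pose M := (\max_j idx j).+1.
have ltM j : (idx j < M)%N by rewrite ltnS; exact: leq_bigmax.
have half (dd : nat -> nat) (A : pred J) :
    (forall j, A j -> (dd (idx j) < M + x)%N) ->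
    {in A &, injective (fun j => dd (idx j))} ->
    (forall j, A j -> dist_nat x (idx j) = dd (idx j)) ->
    \sum_(j | A j) f (dist_nat x (idx j)) <= B.
  move=> lt_dd inj_dd Edd.
  have MX0 : (0 < M + x)%N by rewrite /M addSn.
  pose e j : 'I_(M + x).-1.+1 := inord (dd (idx j)).
  have eE j : A j -> e j = dd (idx j) :> nat.
    by move=> Aj; rewrite inordK// prednK// lt_dd.
  rewrite (eq_bigr (fun j => f (e j))); last by move=> j Aj; rewrite eE// Edd.
  apply: le_trans (fB (M + x).-1.+1).
  rewrite -(big_imset (h := e) (A := mem A) (fun i : 'I_(M + x).-1.+1 => f i))/=.
    rewrite [leRHS](bigID (fun i => i \in e @: A))/= lerDl.
    exact: sumr_ge0.
  by move=> j j' Aj Aj' /(congr1 val)/=; rewrite !eE//; exact: inj_dd.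
rewrite (bigID (fun j => (idx j <= x)%N))/= mulr_natl mulr2n.
apply: lerD.
- apply: (half (fun n => (x - n)%N)).
  + by move=> j _; rewrite addSn ltnS (leq_trans (leq_subr _ _))// leq_addl.
  + move=> j j' /= jx j'x; rewrite !unfold_in in jx j'x; move=> E; apply: inj.
    by rewrite -(subKn jx) E subKn.
  + by move=> j jx; rewrite /dist_nat (eqP jx) addn0.
- apply: (half (fun n => (n - x)%N)).
  + by move=> j _; rewrite (leq_ltn_trans (leq_subr _ _))// (leq_trans (ltM _))// leq_addr.
  + move=> j j' /= jx j'x; rewrite !unfold_in -!ltnNge in jx j'x; move=> E; apply: inj.
    by rewrite -(subnK (ltnW jx)) E subnK// ltnW.
  + by move=> j; rewrite -ltnNge => jx; rewrite /dist_nat (eqP (ltnW jx)) add0n.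
Qed.

Lemma sum_gap_weight_dist (J : finType) (idx : J -> nat) (x : nat) :
  injective idx -> \sum_j gap_weight (dist_nat x (idx j)) <= 6.
Proof.
move=> inj; rewrite (_ : 6 = 2 * 3); last by ring.
by apply: sum_dist_le => // n; [exact: gap_weight_ge0|exact: sum_gap_weight].
Qed.

Section Resampling.
Variables (T J : finType).
Implicit Types (a : {ffun T -> J}) (G : {ffun T -> J} -> R).

Definition upd a (t : T) (j : J) : {ffun T -> J} :=
  [ffun s => if s == t then j else a s].

(** Averaging over tuples is unchanged if one coordinate is first averaged out:
    (a, j) |-> (upd a t j, a t) is an involution. *)
Lemma sum_upd G t : \sum_a \sum_j G (upd a t j) = #|J|%:R * \sum_a G a.
Proof.
rewrite pair_big/=.
pose e (p : {ffun T -> J} * J) := (upd p.1 t p.2, p.1 t).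
have eK : involutive e.
  move=> [a j]; rewrite /e/=; congr (_, _); last by rewrite ffunE eqxx.
  by apply/ffunP => s; rewrite !ffunE; case: eqP => // ->.
rewrite (reindex_inj (inv_inj eK))/=.
rewrite (eq_bigr (fun p => G p.1)); last first.
  move=> [a j] _ /=; congr G; apply/ffunP => s; rewrite !ffunE.
  by case: eqP => // ->.
rewrite -(pair_big xpredT xpredT (fun a _ => G a))/= mulr_sumr.
by apply: eq_bigr => a _; rewrite sumr_const mulr_natl.
Qed.

Variables (u : J -> J -> R) (W : R).
Hypotheses (u0 : forall i j, 0 <= u i j) (uW : forall i, \sum_j u i j <= W).

(** Summing over the value at t1 and then over the value at t2 costs W each time
    instead of #|J|. *)
Lemma sum_two_links (t1 s1 t2 s2 : T) : s1 != t1 -> s2 != t2 -> t1 != t2 ->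
  s2 != t1 ->
  #|J|%:R ^+ 2 * \sum_(a : {ffun T -> J}) u (a s1) (a t1) * u (a s2) (a t2) <=
  W ^+ 2 * #|J|%:R ^+ #|T|.
Proof.
move=> st1 st2 tt st.
have E1 : #|J|%:R * \sum_(a : {ffun T -> J}) u (a s1) (a t1) * u (a s2) (a t2) <=
          W * \sum_(a : {ffun T -> J}) u (a s2) (a t2).
  rewrite -(sum_upd (fun a : {ffun T -> J} => u (a s1) (a t1) * u (a s2) (a t2)) t1) mulr_sumr.
  apply: ler_sum => a _.
  rewrite (eq_bigr (fun j => u (a s1) j * u (a s2) (a t2))).
    by rewrite -mulr_suml ler_wpM2r.
  by move=> j _; rewrite !ffunE eqxx (negbTE st1) (negbTE st) eq_sym (negbTE tt).
have E2 : #|J|%:R * \sum_(a : {ffun T -> J}) u (a s2) (a t2) <= W * #|J|%:R ^+ #|T|.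
  rewrite -(sum_upd (fun a : {ffun T -> J} => u (a s2) (a t2)) t2).
  apply: (@le_trans _ _ (\sum_(a : {ffun T -> J}) W)).
    apply: ler_sum => a _; apply: le_trans (uW (a s2)).
    by apply: ler_sum => j _; rewrite !ffunE eqxx (negbTE st2).
  by rewrite sumr_const card_ffun -natrX mulr_natr.
have [W0|W0] := leP 0 W; last first.
  have [j0|J0] := pickP (fun _ : J => true).
    have := uW j0; rewrite leNgt => /negP; case; apply: lt_le_trans W0 _.
    by apply: sumr_ge0.
  by rewrite (eq_card0 J0) expr2 !mul0r mulr_ge0 ?sqr_ge0 ?exprn_ge0.
rewrite expr2 -mulrA; apply: le_trans (ler_wpM2l _ E1) _ => //.
by rewrite mulrCA expr2 -mulrA ler_wpM2l.
Qed.

End Resampling.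

Section IsolatedExtremes.
Variables (T J : finType) (idx : J -> nat).
Hypotheses (T4 : (4 <= #|T|)%N) (idx_inj : injective idx).
Variables (c : {ffun T -> J} -> R) (C : R).
Hypotheses (C0 : 0 <= C) (cC : forall a, c a <= C)
  (c_left : forall (a : {ffun T -> J}) t g, (0 < g)%N ->
     (forall s, s != t -> (idx (a t) + g <= idx (a s))%N) ->
     c a <= C / g%:R ^+ 3)
  (c_right : forall (a : {ffun T -> J}) t g, (0 < g)%N ->
     (forall s, s != t -> (idx (a s) + g <= idx (a t))%N) ->
     c a <= C / g%:R ^+ 3).

Let u i j := gap_weight (dist_nat (idx i) (idx j)).

Let rate_gap (x : R) g : x <= C -> ((0 < g)%N -> x <= C / g%:R ^+ 3) ->
  x <= 8 * C * gap_weight g ^+ 2.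
Proof.
rewrite gap_weight_sqr => xC; case: g => [_|g /(_ isT) xg].
  by rewrite expr1n invr1 mulr1 (le_trans xC)// ler_peMl// ler1n.
apply: le_trans xg _; rewrite (mulrC 8) -mulrA ler_wpM2l//.
rewrite -lef_pV2 ?posrE ?mulr_gt0 ?invr_gt0 ?exprn_gt0//.
rewrite invfM !invrK ler_pdivrMl// -natr1.
set x' : R := g.+1%:R; have x1 : 1 <= x' by rewrite ler1n.
have -> : 8 * x' ^+ 3 = (2 * x') ^+ 3 by rewrite exprMn; congr (_ * _); ring.
by apply: lerXn2r; rewrite ?nnegrE; lra.
Qed.

(** Only the leftmost and the rightmost point of a tuple matter: their two
    neighbours pin them down up to summable weights, which saves two of the
    #|T| degrees of freedom. In the constant, 8 comes from
    $(1+g)^3\le(2g)^3$, $36=6^2$ from the two sums of weights and the fourth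
    power from the choice of the extreme points and of their neighbours. *)
Lemma sum_isolated_extremes :
  #|J|%:R ^+ 2 * \sum_a c a <= 288 * #|T|%:R ^+ 4 * C * #|J|%:R ^+ #|T|.
Proof.
pose v (p : T * T * (T * T)) :=
  [&& p.1.2 != p.1.1, p.2.2 != p.2.1, p.1.1 != p.2.1 & p.2.2 != p.1.1].
pose b (p : T * T * (T * T)) (a : {ffun T -> J}) : R :=
  u (a p.1.2) (a p.1.1) * u (a p.2.2) (a p.2.1).
have b0 p a : 0 <= b p a by rewrite mulr_ge0// gap_weight_ge0.
have main a : c a <= 8 * C * \sum_(p | v p) b p a.
  have [t0 _] : exists t0 : T, t0 \in T by apply/card_gt0P; apply: leq_trans T4.
  pose f t := idx (a t).
  have pick_ne (s : seq T) : (size s < 4)%N -> exists t, t \notin s.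
    move=> s4; apply/existsP; rewrite -[X in is_true X]negbK negb_exists.
    apply/negP => /forallP H; move: T4; rewrite leqNgt => /negP; apply.
    apply: leq_ltn_trans s4; apply: leq_trans (card_size s).
    by apply: subset_leq_card; apply/fintype.subsetP => t _; have := H t; rewrite negbK.
  pose t1 := [arg min_(t < t0 | true) f t].
  have t1P s : (f t1 <= f s)%N by rewrite /t1; case: arg_minnP => // t _ ->.
  have [s1' s1'P] := pick_ne [:: t1] isT.
  pose s1 := [arg min_(t < s1' | t \notin [:: t1]) f t].
  have [s1n s1P] : s1 \notin [:: t1] /\ forall s, s \notin [:: t1] -> (f s1 <= f s)%N.
    by rewrite /s1; case: arg_minnP => // t; split.
  have [t2' t2'P] := pick_ne [:: t1; s1] isT.
  pose t2 := [arg max_(t > t2' | t \notin [:: t1; s1]) f t].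
  have [t2n t2P] : t2 \notin [:: t1; s1] /\
      forall s, s \notin [:: t1; s1] -> (f s <= f t2)%N.
    by rewrite /t2; case: arg_maxnP => // t; split.
  have [s2' s2'P] := pick_ne [:: t1; s1; t2] isT.
  pose s2 := [arg max_(t > s2' | t \notin [:: t1; s1; t2]) f t].
  have [s2n s2P] : s2 \notin [:: t1; s1; t2] /\
      forall s, s \notin [:: t1; s1; t2] -> (f s <= f s2)%N.
    by rewrite /s2; case: arg_maxnP => // t; split.
  move: s1n t2n s2n; rewrite !inE !negb_or => s1n /andP[t2n t2n'] /and3P[s2n s2n' s2n''].
  have s1le s : s != t1 -> (f s1 <= f s)%N by move=> st; apply: s1P; rewrite inE.
  have s2ge s : s != t2 -> (f s <= f s2)%N.
    move=> st; have [->|st1] := eqVneq s t1; first exact: t1P.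
    have [->|ss1] := eqVneq s s1; first exact: s1le.
    by apply: s2P; rewrite !inE !negb_or st1 ss1.
  have t2ge : (f s2 <= f t2)%N by apply: t2P; rewrite !inE negb_or s2n.
  pose gL := (f s1 - f t1)%N; pose gR := (f t2 - f s2)%N.
  have cL : c a <= 8 * C * gap_weight gL ^+ 2.
    apply: rate_gap => // g0; apply: (@c_left a t1) => // s st.
    by rewrite subnKC ?s1le// t1P.
  have cR : c a <= 8 * C * gap_weight gR ^+ 2.
    apply: rate_gap => // g0; apply: (@c_right a t2) => // s st.
    by rewrite -[idx (a t2)]/(f t2) -(subnKC t2ge); apply: leq_add => //; exact: s2ge.
  have vp : v ((t1, s1), (t2, s2)).
    by rewrite /v/= s1n s2n'' s2n eq_sym t2n.
  rewrite (bigD1 _ vp)/= mulrDr.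
  apply: (@le_trans _ _ (8 * C * b ((t1, s1), (t2, s2)) a)); last first.
    rewrite lerDl mulr_ge0 ?mulr_ge0//.
    by apply: sumr_ge0.
  rewrite /b/= /u /dist_nat -/(f t1) -/(f s1) -/(f t2) -/(f s2).
  rewrite (eqP (t1P s1)) addn0 (eqP t2ge) add0n -/gL -/gR.
  have := gap_weight_ge0 gL; have := gap_weight_ge0 gR.
  move: (gap_weight gL) (gap_weight gR) cL cR => x y cL cR y0 x0.
  have C8 : 0 <= 8 * C by rewrite mulr_ge0.
  have [xy|yx] := leP x y.
    by apply: le_trans cL _; rewrite ler_wpM2l// expr2 ler_wpM2l.
  by apply: le_trans cR _; rewrite ler_wpM2l// expr2 ler_wpM2r// ltW.
apply: (@le_trans _ _ (#|J|%:R ^+ 2 * \sum_a 8 * C * \sum_(p | v p) b p a)).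
  by rewrite ler_wpM2l ?exprn_ge0//; apply: ler_sum => a _; exact: main.
rewrite -mulr_sumr exchange_big/= mulrCA mulr_sumr.
apply: (@le_trans _ _ (8 * C * \sum_(p | v p) (6 ^+ 2 * #|J|%:R ^+ #|T|))).
  rewrite ler_wpM2l ?mulr_ge0//; apply: ler_sum => p /and4P[? ? ? ?].
  apply: sum_two_links => //; first by move=> i j; exact: gap_weight_ge0.
  by move=> i; exact: sum_gap_weight_dist.
rewrite sumr_const -mulr_natr.
have : #|v|%:R <= #|T|%:R ^+ 4 :> R.
  rewrite -natrX ler_nat; apply: leq_trans (max_card _) _.
  by rewrite !card_prod !expnS expn0 muln1 !mulnA.
move=> vT; have k0 : 0 <= 8 * C * (6 ^+ 2 * #|J|%:R ^+ #|T|).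
  by rewrite !mulr_ge0// exprn_ge0.
have := ler_wpM2l k0 vT; lra.
Qed.

End IsolatedExtremes.
End Counting.
(** * Moments *)

Section Moments.
Context (d : measure_display) (T : measurableType d) (R : realType)
  (Q : probability T R).
Implicit Types (f g : T -> R) (p m : R).

Definition mom f p m :=
  [/\ measurable_fun setT f, L1 Q (fun w => `|f w| `^ p) &
      Ex Q (fun w => `|f w| `^ p) <= m].

Lemma mom_ge0 f p m : mom f p m -> 0 <= m.
Proof.
by case=> _ _; apply: le_trans; apply: Ex_ge0 => w; exact: powR_ge0.
Qed.

Lemma measurable_abs_powR f p : measurable_fun setT f ->
  measurable_fun setT (fun w => `|f w| `^ p).
Proof.
move=> mf; apply: (measurableT_comp (measurable_powR p)).
by apply: measurableT_comp.
Qed.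

Lemma mom_integral f p m : measurable_fun setT f ->
  (\int[Q]_w (`|f w| `^ p)%:E <= m%:E)%E -> mom f p m.
Proof.
move=> mf fm; have mfp := measurable_abs_powR p mf.
have L : L1 Q (fun w => `|f w| `^ p).
  apply: L1_of_lty => //; apply: le_lt_trans (ltry m).
  apply: le_trans fm; rewrite le_eqVlt; apply/orP; left; apply/eqP.
  by apply: eq_integral => w _; rewrite ger0_norm// powR_ge0.
by split => //; rewrite -lee_fin -ExE.
Qed.

Lemma mom_le f p m m' : m <= m' -> mom f p m -> mom f p m'.
Proof. by move=> mm [? ? H]; split => //; exact: le_trans mm. Qed.

Lemma mom_dom f g p m : 0 <= p -> measurable_fun setT f ->
  (forall w, `|f w| <= `|g w|) -> mom g p m -> mom f p m.
Proof.
move=> p0 mf fg [mg Lg Eg].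
have fgp w : `|f w| `^ p <= `|g w| `^ p.
  by apply: ge0_ler_powR; rewrite ?nnegrE.
have Lf : L1 Q (fun w => `|f w| `^ p).
  apply: (@L1_dom _ _ _ _ _ (fun w => `|g w| `^ p)) => //.
    exact: measurable_abs_powR.
  by move=> w; rewrite ger0_norm ?powR_ge0.
split; [exact: mf|exact: Lf|apply: le_trans Eg].
exact: (le_Ex Lf Lg fgp).
Qed.

Lemma mom_weaken f p p' m : 0 <= p' <= p -> mom f p m -> mom f p' (1 + m).
Proof.
move=> pp [mf Lf Ef].
have L1f : L1 Q (fun w => 1 + `|f w| `^ p) by apply: L1D => //; exact: L1_cst.
have fpp w : `|f w| `^ p' <= 1 + `|f w| `^ p by exact: powR_le1D.
have Lf' : L1 Q (fun w => `|f w| `^ p').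
  apply: (L1_dom _ _ L1f); first exact: measurable_abs_powR.
  by move=> w; rewrite ger0_norm ?powR_ge0.
split; [exact: mf|exact: Lf'|].
apply: le_trans (le_Ex Lf' L1f fpp) _.
by rewrite ExD ?Ex_cst ?lerD2l//; exact: L1_cst.
Qed.

Lemma mom_exprn f p m n : n%:R <= p -> mom f p m ->
  L1 Q (fun w => f w ^+ n) /\ Ex Q (fun w => `|f w| ^+ n) <= 1 + m.
Proof.
move=> np fM; have [mf Lf Ef] := mom_weaken (p' := n%:R) (introT andP (conj (ler0n _ _) np)) fM.
have E w : `|f w| `^ n%:R = `|f w| ^+ n by rewrite powR_mulrn.
split; last by rewrite -(@Ex_ext _ _ _ Q (fun w => `|f w| `^ n%:R)).
apply: (L1_dom _ _ Lf); first exact: measurable_funX.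
by move=> w; rewrite E normrX.
Qed.

Lemma mom_L1 f p m : 1 <= p -> mom f p m -> L1 Q f /\ `|Ex Q f| <= 1 + m.
Proof.
move=> p1 fM; have [Lf Ef] := mom_exprn (n := 1) p1 fM.
have {}Lf : L1 Q f by [].
by split => //; apply: le_trans (norm_Ex Lf) _.
Qed.

Lemma momZ (c : R) f p m : mom f p m -> mom (fun w => c * f w) p (`|c| `^ p * m).
Proof.
move=> [mf Lf Ef].
have E w : `|c| `^ p * `|f w| `^ p = `|c * f w| `^ p by rewrite normrM powRM.
split; first exact: measurable_funM.
- by apply: L1_ext (L1Z (`|c| `^ p) Lf).
- rewrite -(@Ex_ext _ _ _ Q (fun w => `|c| `^ p * `|f w| `^ p))// ExZ//.
  by rewrite ler_wpM2l// powR_ge0.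
Qed.

Lemma mom_mean (I : finType) (F : I -> T -> R) p m : 0 <= m -> 1 < p ->
  (forall i, mom (F i) p m) ->
  mom (fun w => (#|I|%:R)^-1 * \sum_i F i w) p m.
Proof.
move=> m0 p1 FM.
have LF i : L1 Q (fun w => `|F i w| `^ p) by case: (FM i).
have L : L1 Q (fun w => (#|I|%:R)^-1 * \sum_i `|F i w| `^ p).
  by apply: L1Z; apply: L1_sum.
have mS : measurable_fun setT (fun w => (#|I|%:R)^-1 * \sum_i F i w).
  by apply: measurable_funM => //; apply: measurable_sum => i; case: (FM i).
have Fp w : `|(#|I|%:R)^-1 * \sum_i F i w| `^ p <= (#|I|%:R)^-1 * \sum_i `|F i w| `^ p.
  exact: powR_mean.
have L' : L1 Q (fun w => `|(#|I|%:R)^-1 * \sum_i F i w| `^ p).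
  apply: (L1_dom _ _ L); first exact: measurable_abs_powR.
  by move=> w; rewrite ger0_norm ?powR_ge0.
split; [exact: mS|exact: L'|apply: le_trans (le_Ex L' L Fp) _].
rewrite ExZ; last exact: L1_sum.
rewrite Ex_sum//; have [I0|I0] := posnP #|I|; first by rewrite I0 invr0 mul0r.
rewrite ler_pdivrMl ?ltr0n//.
apply: (@le_trans _ _ (\sum_(i : I) m)).
  by apply: ler_sum => i _; case: (FM i).
by rewrite sumr_const mulr_natl.
Qed.

Lemma momD f g p m m' : 1 < p -> mom f p m -> mom g p m' ->
  mom (fun w => f w + g w) p (2 `^ p * (m + m')).
Proof.
move=> p1 fM gM; have m0 := mom_ge0 fM; have m0' := mom_ge0 gM.
have := @mom_mean bool (fun b => if b then f else g) p (m + m') (addr_ge0 m0 m0') p1.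
have H : forall i : bool, mom (if i then f else g) p (m + m').
  by case; [apply: mom_le fM; rewrite lerDl|apply: mom_le gM; rewrite lerDr].
move=> /(_ H) /(momZ 2); rewrite (ger0_norm (ler0n R 2)).
rewrite (_ : (fun w => f w + g w) =
  fun w => 2 * (#|{: bool}|%:R^-1 * \sum_i (if i then f else g) w))//.
by apply/funext => w; rewrite card_bool big_bool/=; field.
Qed.

Lemma mom_cst (c p : R) : mom (fun=> c) p (`|c| `^ p).
Proof. by split; [|exact: L1_cst|rewrite Ex_cst]. Qed.

End Moments.

(** The product is at most a power of its largest factor. *)
Lemma prod_powR_le (R : realType) (I : finType) (x : I -> R) (q : R) :
  (0 < #|I|)%N -> 0 <= q ->
  `|\prod_i x i| `^ q <= \sum_i `|x i| `^ (#|I|%:R * q).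
Proof.
move=> I0 q0; have [i0 _] : exists i, i \in I by apply/card_gt0P.
have [j _ jP] := @arg_maxP _ R I i0 xpredT (fun i => `|x i|) isT.
rewrite (bigD1 j)//=; apply: (@le_trans _ _ (`|x j| `^ (#|I|%:R * q))); last first.
  by rewrite [leRHS](bigD1 j)//= lerDl sumr_ge0// => i _; exact: powR_ge0.
rewrite powRrM; apply: ge0_ler_powR; rewrite ?nnegrE ?powR_ge0//.
rewrite powR_mulrn// -(bigD1 (P := xpredT) (op := *%R) (F := x) j)//= normr_prod.
rewrite -[leRHS]/(`|x j| ^+ #|I|) -prodr_const [leRHS](eq_bigl xpredT)//.
by apply: ler_prod => i _; rewrite normr_ge0/=; exact: jP.
Qed.

Lemma mom_prod (d : measure_display) (T : measurableType d) (R : realType)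
  (Q : probability T R) (I : finType) (F : I -> T -> R) (q m : R) :
  (0 < #|I|)%N -> 0 <= q -> (forall i, mom Q (F i) (#|I|%:R * q) m) ->
  mom Q (fun w => \prod_i F i w) q (#|I|%:R * m).
Proof.
move=> I0 q0 FM.
have LF i : L1 Q (fun w => `|F i w| `^ (#|I|%:R * q)) by case: (FM i).
have mP : measurable_fun setT (fun w => \prod_i F i w).
  by apply: measurable_prod => i _; case: (FM i).
have L := @L1_sum _ _ _ Q I (index_enum I) xpredT _ (fun i _ => LF i).
have L' : L1 Q (fun w => `|\prod_i F i w| `^ q).
  apply: (L1_dom _ _ L); first exact: measurable_abs_powR.
  by move=> w; rewrite ger0_norm ?powR_ge0//; exact: prod_powR_le.
split; [exact: mP|exact: L'|].
apply: le_trans (le_Ex L' L (fun w => prod_powR_le _ I0 q0)) _.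
rewrite Ex_sum//; apply: (@le_trans _ _ (\sum_(i : I) m)).
  by apply: ler_sum => i _; case: (FM i).
by rewrite sumr_const mulr_natl.
Qed.

Lemma momM (d : measure_display) (T : measurableType d) (R : realType)
  (Q : probability T R) (f g : T -> R) (q m : R) : 0 <= q ->
  mom Q f (2 * q) m -> mom Q g (2 * q) m ->
  mom Q (fun w => f w * g w) q (2 * m).
Proof.
move=> q0 fM gM.
have := @mom_prod _ T R Q bool (fun b => if b then f else g) q m.
rewrite card_bool => /(_ isT q0).
have H : forall i : bool, mom Q (if i then f else g) (2 * q) m by case.
by move=> /(_ H); congr mom; apply/funext => w; rewrite big_bool.
Qed.

(** * Covariance bounds under a polynomial mixing rate *)

Section SwapFactors.
Context (d : measure_display) (Omega : measurableType d) (R : realType)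
  (P : probability Omega R).

Lemma L1_swap (f : Omega * Omega -> R) : L1 (P \x P)%E f ->
  L1 (P \x P)%E (fun z => f (z.2, z.1)).
Proof.
move=> Lf; have mf := L1_meas Lf.
have ms : measurable_fun setT (fun z : Omega * Omega => f (z.2, z.1)).
  by apply: measurableT_comp mf _; exact: measurable_swap.
rewrite /L1; apply/integrable12ltyP; first exact/measurable_EFinP.
exact: (integrable21ltyP P P (measurable_int _ Lf)).1 Lf.
Qed.

Lemma Ex_swap (f : Omega * Omega -> R) : L1 (P \x P)%E f ->
  Ex (P \x P)%E (fun z => f (z.2, z.1)) = Ex (P \x P)%E f.
Proof.
move=> Lf; rewrite /Ex /Rintegral; congr fine.
by rewrite -(integral12_prod_meas1 (L1_swap Lf)) -(integral21_prod_meas1 Lf).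
Qed.

Lemma mom_swap (f : Omega * Omega -> R) p m : mom (P \x P)%E f p m ->
  mom (P \x P)%E (fun z => f (z.2, z.1)) p m.
Proof.
move=> [mf Lf Ef]; split.
- by apply: measurableT_comp mf _; exact: measurable_swap.
- exact: (L1_swap Lf).
- by rewrite (Ex_swap Lf).
Qed.

End SwapFactors.

Section RectanglesMeasurable.
Context (d : measure_display) (Omega : measurableType d).
Variables F G : set (set Omega).
Hypotheses (sF : sigma_algebra setT F) (sG : sigma_algebra setT G).

Lemma measurable_rectangles_fst d' (V : measurableType d') (f : Omega -> V) :
  @measurable_fun _ _ (g_sigma_algebraType F) V setT f ->
  @measurable_fun _ _ (g_sigma_algebraType (rectangles F G)) V setT (fun z => f z.1).
Proof.
move=> mf _ A mA; rewrite setTI; apply: sub_sigma_algebra.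
exists (f @^-1` A), setT; split.
- by rewrite -[F _](subfieldE sF) -[X in _.-measurable X]setTI; exact: mf.
- by rewrite -[G _](subfieldE sG).
- by apply/seteqP; split => z //= [].
Qed.

Lemma measurable_rectangles_snd d' (V : measurableType d') (f : Omega -> V) :
  @measurable_fun _ _ (g_sigma_algebraType G) V setT f ->
  @measurable_fun _ _ (g_sigma_algebraType (rectangles F G)) V setT (fun z => f z.2).
Proof.
move=> mf _ A mA; rewrite setTI; apply: sub_sigma_algebra.
exists setT, (f @^-1` A); split.
- by rewrite -[F _](subfieldE sF).
- by rewrite -[G _](subfieldE sG) -[X in _.-measurable X]setTI; exact: mf.
- by apply/seteqP; split => z //= [].
Qed.

End RectanglesMeasurable.

Section Decoupling.
Context (d d' : measure_display) (Omega : measurableType d)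
  (V : measurableType d') (R : realType) (P : probability Omega R)
  (X : nat -> {RV P >-> V}).
Variables (q s C0 : R) (g0 : nat).
Hypotheses (q1 : 1 < q) (qs : (q - 1) * s = 3) (C00 : 0 <= C0)
  (rate : forall g, (g0 <= g)%N -> (0 < g)%N ->
    (beta_coef P X g <= (C0 * g%:R `^ (- (3 + s)))%:E)%E).

Definition decouple_const : R := 2 * C0 + 2 * (g0%:R ^+ 3) + 2.

Lemma decouple_const_ge1 : 1 <= decouple_const.
Proof. rewrite /decouple_const; have := exprn_ge0 3 (ler0n R g0).
by move: (g0%:R ^+ 3) (C00) => x h; lra. Qed.

(** At distance g the truncation level is $g^s$: the mixing rate then leaves
    $g^{-3}$ from the bounded part and $(q-1)s=3$ leaves $g^{-3}$ from the
    tail. *)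
Lemma decouple (k g : nat) (phi : Omega * Omega -> R) (m : R) :
  (0 < k)%N -> (0 < g)%N ->
  @measurable_fun _ _
    (g_sigma_algebraType (rectangles (past X k) (future X (k + g)))) R setT phi ->
  mom P (fun w => phi (w, w)) q m -> mom (P \x P)%E phi q m ->
  `|Ex P (fun w => phi (w, w)) - Ex (P \x P)%E phi| <=
    decouple_const * (1 + m) / g%:R ^+ 3.
Proof.
move=> k0 g_gt0 mphi md mp; have m0 := mom_ge0 md.
have gR : 0 < g%:R :> R by rewrite ltr0n.
have g3 : 0 < g%:R ^+ 3 :> R by rewrite exprn_gt0.
have s0 : 0 < s by move: (q1) (qs) => h1 h2; nra.
have [gg0|gg0] := leqP g0 g; last first.
  have [Ld Ed] := mom_L1 (ltW q1) md; have [Lp Ep] := mom_L1 (ltW q1) mp.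
  rewrite ler_pdivlMr//; apply: (@le_trans _ _ (2 * (1 + m) * g0%:R ^+ 3)).
    apply: ler_pM => //.
      apply: le_trans (ler_normB _ _) _.
      by rewrite [leRHS](_ : _ = (1 + m) + (1 + m)); [exact: lerD|ring].
    by apply: lerXn2r; rewrite ?nnegrE// ler_nat ltnW.
  rewrite /decouple_const; have := exprn_ge0 3 (ler0n R g0).
  by move: (g0%:R ^+ 3) (C00) => x h x0; nra.
have H := near_indep_beta k0 (rate gg0 g_gt0).
have [mdm Ld Ed] := md; have [mpm Lp Ep] := mp.
have mX i : measurable_fun setT (X i) by [].
have K0 : 0 < g%:R `^ s by rewrite powR_gt0.
have := moment_dev (sigma_of_sigma_algebra X _) (sigma_of_sigma_algebra X _)
  (sigma_of_measurable mX) (sigma_of_measurable mX) H mphi K0 (ltW q1) Ld Lp Ed Ep.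
move=> /le_trans; apply.
have E1 : g%:R `^ s * g%:R `^ (- (3 + s)) = (g%:R ^+ 3)^-1 :> R.
  rewrite -powRD; last by rewrite (gt_eqF gR) implybT.
  by rewrite (_ : s + - (3 + s) = - 3%:R) ?powR_invn//; ring.
have E2 : (g%:R `^ s) `^ (1 - q) = (g%:R ^+ 3)^-1 :> R.
  rewrite -powRrM (_ : s * (1 - q) = - 3%:R) ?powR_invn//.
  by rewrite -qs; ring.
rewrite E2 -mulrA [X in 2 * X](_ : _ = C0 * (g%:R ^+ 3)^-1); last first.
  by rewrite mulrCA E1.
rewrite mulrA -mulrDl ler_pM2r ?invr_gt0// /decouple_const.
have := exprn_ge0 3 (ler0n R g0).
by move: (g0%:R ^+ 3) (C00) => x h x0; nra.
Qed.

End Decoupling.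
(** * Equality in law *)

Section SameLaw.
Context (d1 d2 d3 : measure_display) (T1 : measurableType d1)
  (T2 : measurableType d2) (W : measurableType d3) (R : realType)
  (Q1 : probability T1 R) (Q2 : probability T2 R).

Definition same_law (U1 : T1 -> W) (U2 : T2 -> W) :=
  [/\ measurable_fun setT U1, measurable_fun setT U2 &
      forall C, measurable C -> Q1 (U1 @^-1` C) = Q2 (U2 @^-1` C)].

Variables (U1 : T1 -> W) (U2 : T2 -> W).
Hypothesis U12 : same_law U1 U2.

Lemma ge0_same_law_integral (f : W -> \bar R) : measurable_fun setT f ->
  (forall x, (0 <= f x)%E) ->
  (\int[Q1]_w f (U1 w) = \int[Q2]_w f (U2 w))%E.
Proof.
move=> mf f0; case: U12 => mU1 mU2 E.
rewrite -[LHS](ge0_integral_pushforward mU1 Q1 measurableT (f := f))//.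
rewrite -[RHS](ge0_integral_pushforward mU2 Q2 measurableT (f := f))//.
by apply: eq_measure_integral => A mA _; exact: E.
Qed.

Lemma same_law_integral (f : W -> \bar R) : measurable_fun setT f ->
  (\int[Q1]_w f (U1 w) = \int[Q2]_w f (U2 w))%E.
Proof.
move=> mf; rewrite integralE [RHS]integralE.
congr (_ - _)%E.
- transitivity (\int[Q1]_x f^\+ (U1 x))%E.
    by apply: eq_integral => x _; rewrite -[LHS]/((f \o U1)^\+ x)%E funepos_comp.
  transitivity (\int[Q2]_x f^\+ (U2 x))%E; last first.
    by apply/esym; apply: eq_integral => x _;
      rewrite -[LHS]/((f \o U2)^\+ x)%E funepos_comp.
  by apply: (ge0_same_law_integral (f := f^\+%E)) => //; exact: measurable_funepos.
- transitivity (\int[Q1]_x f^\- (U1 x))%E.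
    by apply: eq_integral => x _; rewrite -[LHS]/((f \o U1)^\- x)%E funeneg_comp.
  transitivity (\int[Q2]_x f^\- (U2 x))%E; last first.
    by apply/esym; apply: eq_integral => x _;
      rewrite -[LHS]/((f \o U2)^\- x)%E funeneg_comp.
  by apply: (ge0_same_law_integral (f := f^\-%E)) => //; exact: measurable_funeneg.
Qed.

Lemma same_law_Ex (f : W -> R) : measurable_fun setT f ->
  Ex Q1 (fun w => f (U1 w)) = Ex Q2 (fun w => f (U2 w)).
Proof.
move=> mf; rewrite /Ex /Rintegral; congr fine.
by apply: (same_law_integral (f := EFin \o f)); exact/measurable_EFinP.
Qed.

Lemma same_law_L1 (f : W -> R) : measurable_fun setT f ->
  L1 Q1 (fun w => f (U1 w)) -> L1 Q2 (fun w => f (U2 w)).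
Proof.
move=> mf /integrableP[_ Lf]; case: (U12) => mU1 mU2 _.
apply: L1_of_lty; first exact: measurableT_comp.
apply: le_lt_trans Lf; rewrite le_eqVlt; apply/orP; left; apply/eqP/esym.
apply: (same_law_integral (f := fun x => `|f x|%:E)).
by apply/measurable_EFinP; exact: measurableT_comp.
Qed.

Lemma same_law_mom (f : W -> R) p m : measurable_fun setT f ->
  mom Q1 (fun w => f (U1 w)) p m -> mom Q2 (fun w => f (U2 w)) p m.
Proof.
move=> mf [_ L E]; case: (U12) => mU1 mU2 _.
have mfp := measurable_abs_powR p mf.
split; first exact: measurableT_comp.
- exact: (same_law_L1 mfp L).
- by move: E; rewrite (same_law_Ex mfp).
Qed.

End SameLaw.

Lemma same_law_sym (d1 d2 d3 : measure_display) (T1 : measurableType d1)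
  (T2 : measurableType d2) (W : measurableType d3) (R : realType)
  (Q1 : probability T1 R) (Q2 : probability T2 R) (U1 : T1 -> W) (U2 : T2 -> W) :
  same_law Q1 Q2 U1 U2 -> same_law Q2 Q1 U2 U1.
Proof. by case=> ? ? E; split => // C mC; rewrite E. Qed.

Section Fubini.
Context (d : measure_display) (Omega : measurableType d) (R : realType)
  (P : probability Omega R).

Lemma ae_L1_section (f : Omega * Omega -> R) : L1 (P \x P)%E f ->
  {ae P, forall w, L1 P (fun v => f (v, w))}.
Proof. by move=> Lf; exact: (ae_integrable2 Lf). Qed.

Lemma Ex_fubini (f : Omega * Omega -> R) : L1 (P \x P)%E f ->
  Ex (P \x P)%E f = Ex P (fun w => Ex P (fun v => f (v, w))).
Proof.
move=> Lf; rewrite {1 2}/Ex /Rintegral -(integral21_prod_meas1 Lf); congr fine.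
have mG := measurable_fubini_G Lf.
apply: ae_eq_integral => //.
- apply/measurable_EFinP.
  have -> : (fun w => Ex P (fun v => f (v, w))) = fine \o fubini_G P (EFin \o f) by [].
  exact: measurableT_comp.
- apply: filterS (ae_L1_section Lf) => w Lw _.
  by rewrite -(ExE Lw).
Qed.

Lemma same_law_snd : same_law (P \x P)%E P snd id.
Proof.
split => // C mC; rewrite (_ : snd @^-1` C = setT `*` C); last first.
  by apply/seteqP; split => z //= [].
transitivity (P setT * P C)%E; first exact: product_measure1E.
by rewrite probability_setT mul1e.
Qed.

Lemma mom_snd (f : Omega -> R) p m : mom P f p m ->
  mom (P \x P)%E (fun z : Omega * Omega => f z.2) p m.
Proof. by move=> fM; have [mf _ _] := fM; exact: (same_law_mom (same_law_sym same_law_snd) mf fM). Qed.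

End Fubini.

(** * Moments of sums of a degenerate kernel *)

Section Process.
Context (d d' : measure_display) (Omega : measurableType d)
  (V : measurableType d') (R : realType) (P : probability Omega R)
  (X : nat -> {RV P >-> V}).

Definition marginal : probability V R := distribution P (X 1%N).

Section Stationary.
Hypothesis statX : stationary P X.

Let tup k n w : n.-tuple V := [tuple X (k + i.+1)%N w | i < n].

Let measurable_tup k n : measurable_fun setT (tup k n).
Proof.
apply/measurable_fun_tnthP => i.
rewrite (_ : _ \o _ = X (k + i.+1)%N)//.
by apply/funext => w /=; rewrite tnth_mktuple.
Qed.

Lemma same_law_marginal i : (0 < i)%N -> same_law P marginal (X i) id.
Proof.
move=> i0; split => // C mC.
pose A := (fun t : 1.-tuple V => tnth t ord0) @^-1` C.
have mA : measurable A.
  by rewrite -[A]setTI; apply: measurable_tnth.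
have := statX i.-1 mA.
rewrite /A/=; under eq_set do rewrite tnth_mktuple.
under [in RHS]eq_set do rewrite tnth_mktuple/= addn1 prednK//.
by move/esym.
Qed.

(** The pair is read at both ends of a tuple of b - a + 1 consecutive variables. *)
Lemma same_law_pair a b : (0 < a)%N -> (a < b)%N ->
  same_law P P (fun w => (X a w, X b w)) (fun w => (X 1%N w, X (1 + (b - a))%N w)).
Proof.
move=> a0 ab; split; [exact: measurable_fun_pair|exact: measurable_fun_pair|].
move=> C mC.
pose n := (b - a).+1.
pose A := (fun t : n.-tuple V => (tnth t ord0, tnth t ord_max)) @^-1` C.
have mA : measurable A.
  have mt : measurable_fun setT (fun t : n.-tuple V => (tnth t ord0, tnth t ord_max)).
    by apply: measurable_fun_pair; exact: measurable_tnth.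
  by rewrite -[A]setTI; exact: mt.
have := statX a.-1 mA.
rewrite /A/=; under eq_set do rewrite !tnth_mktuple/=.
under [in RHS]eq_set do rewrite !tnth_mktuple/= addn1 prednK//.
by move=> /esym; rewrite add1n -addSnnS prednK// subnKC// ltnW.
Qed.

(** A measure on the product is determined by its values on rectangles. *)
Lemma same_law_product i j : (0 < i)%N -> (0 < j)%N ->
  same_law (P \x P)%E (marginal \x marginal)%E
    (fun z : Omega * Omega => (X i z.1, X j z.2)) id.
Proof.
move=> i0 j0.
have mU : measurable_fun setT (fun z : Omega * Omega => (X i z.1, X j z.2)).
  by apply: measurable_fun_pair; apply: measurableT_comp.
split => // C mC.
have [nu nuE] : exists nu : {measure set (V * V) -> \bar R}, forall A,
    nu A = (P \x P)%E ((fun z : Omega * Omega => (X i z.1, X j z.2)) @^-1` A).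
  by unshelve eexists (pushforward (P \x P)%E
    (fun z : Omega * Omega => (X i z.1, X j z.2))) => //.
transitivity (nu C); first exact/esym/nuE.
apply/esym; apply: product_measure_unique => // A B mA mB.
have [_ _ Ei] := same_law_marginal i0; have [_ _ Ej] := same_law_marginal j0.
transitivity (P (X i @^-1` A) * P (X j @^-1` B))%E; last by rewrite Ei// Ej.
rewrite nuE.
rewrite (_ : _ @^-1` _ = (X i @^-1` A) `*` (X j @^-1` B))//.
by apply: product_measure1E; rewrite -[X in measurable X]setTI; exact: measurable_funP.
Qed.

Lemma ae_marginal (Z : set V) i : (0 < i)%N -> {ae marginal, forall x, Z x} ->
  {ae P, forall w, Z (X i w)}.
Proof.
move=> i0 [N [mN N0 sN]]; exists (X i @^-1` N).
have [_ _ E] := same_law_marginal i0; split.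
- by rewrite -[X in measurable X]setTI; exact: measurable_funP.
- by rewrite -N0; exact: E.
- by move=> w nZ; apply: sN.
Qed.

End Stationary.
End Process.
Section KernelMoments.
Context (d d' : measure_display) (Omega : measurableType d)
  (V : measurableType d') (R : realType) (P : probability Omega R)
  (X : nat -> {RV P >-> V}).
Variables (q s C0 : R) (g0 : nat).
Hypotheses (q1 : 1 < q) (qs : (q - 1) * s = 3) (C00 : 0 <= C0)
  (rate : forall g, (g0 <= g)%N -> (0 < g)%N ->
    (beta_coef P X g <= (C0 * g%:R `^ (- (3 + s)))%:E)%E)
  (statX : stationary P X).

(* D selects the pairs of indices at which H has a moment bound: i <> j for a
   kernel on pairs, no restriction for a product of two functions. *)
Variables (H : V -> V -> R) (D : rel nat) (r : nat) (m : R).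
Hypotheses (r2 : (2 <= r)%N)
  (mH : measurable_fun setT (fun z : V * V => H z.1 z.2))
  (deg_l : {ae marginal X, forall y, Ex (marginal X) (fun x => H x y) = 0})
  (deg_r : {ae marginal X, forall x, Ex (marginal X) (fun y => H x y) = 0})
  (mom_joint : forall i j, (0 < i)%N -> (0 < j)%N -> D i j ->
     mom P (fun w => H (X i w) (X j w)) (r%:R * q) m)
  (mom_product : mom (marginal X \x marginal X)%E (fun z => H z.1 z.2) (r%:R * q) m).

Section Tuples.
Variables (J : finType) (idx : J -> nat).
Hypotheses (idx_inj : injective idx) (idx_gt0 : forall j, (0 < idx j)%N).

Local Notation slot := ('I_r * bool)%type.

Definition pair_term (i j : J) (v w : Omega) : R :=
  if D (idx i) (idx j) then H (X (idx i) v) (X (idx j) w) else 0.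

Definition kernel_sum (w : Omega) : R := \sum_(i : J) \sum_(j : J) pair_term i j w w.

(** The product of kernels over a tuple, in which each slot may be evaluated at
    a sample point of its own. *)
Definition slot_term (a : {ffun slot -> J}) (x : slot -> Omega) : R :=
  \prod_(k < r) pair_term (a (k, false)) (a (k, true)) (x (k, false)) (x (k, true)).

Definition free_slot (t : slot) (z : Omega * Omega) : slot -> Omega :=
  fun u => if u == t then z.1 else z.2.

Lemma measurable_slot_term d1 (W : measurableType d1) (a : {ffun slot -> J})
    (x : W -> slot -> Omega) :
  (forall u, measurable_fun setT (fun w => X (idx (a u)) (x w u))) ->
  measurable_fun setT (fun w => slot_term a (x w)).
Proof.
move=> mx; apply: measurable_prod => k _; rewrite /pair_term.
case: (D _ _); last exact: measurable_cst.
exact: (measurableT_comp mH (measurable_fun_pair (mx (k, false)) (mx (k, true)))).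
Qed.

Let rq0 : 0 < r%:R * q.
Proof. by move: (q1) => h; rewrite mulr_gt0 ?ltr0n ?(ltn_trans _ r2)//; lra. Qed.

Let m0 : 0 <= m. Proof. exact: mom_ge0 mom_product. Qed.

Let card_r : (0 < #|'I_r|)%N. Proof. by rewrite card_ord (ltn_trans _ r2). Qed.

Let q0 : 0 <= q. Proof. by move: (q1) => h; lra. Qed.

Let mom_zero d1 (W : measurableType d1) (Q : probability W R) :
  mom Q (fun=> 0) (r%:R * q) m.
Proof.
apply: (mom_le (m := `|0| `^ (r%:R * q))); last exact: mom_cst.
by rewrite normr0 powR0 ?gt_eqF.
Qed.

Let mom_pair_diag i j : mom P (fun w => pair_term i j w w) (r%:R * q) m.
Proof. by rewrite /pair_term; case Dij: (D _ _); [exact: mom_joint|exact: mom_zero]. Qed.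

Lemma mom_slot_diag a : mom P (fun w => slot_term a (fun=> w)) q (r%:R * m).
Proof.
rewrite -[r in r%:R * m]card_ord; apply: mom_prod => // k.
by rewrite card_ord; exact: mom_pair_diag.
Qed.

Let mom_pair_product i j : mom (P \x P)%E (fun z => pair_term i j z.1 z.2) (r%:R * q) m.
Proof.
rewrite /pair_term; case Dij: (D _ _); last exact: mom_zero.
have sl := same_law_sym (same_law_product statX (idx_gt0 i) (idx_gt0 j)).
exact: (same_law_mom sl mH mom_product).
Qed.

Lemma mom_slot_free a t :
  mom (P \x P)%E (fun z => slot_term a (free_slot t z)) q (r%:R * m).
Proof.
rewrite -[r in r%:R * m]card_ord; apply: mom_prod => // k; rewrite card_ord.
case: t => k' b; rewrite /free_slot !xpair_eqE.
have [->|kk'] := eqVneq k k'; last first.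
  exact: (mom_snd (mom_pair_diag (a (k, false)) (a (k, true)))).
case: b => /=; last exact: mom_pair_product.
exact: (mom_swap (mom_pair_product (a (k', false)) (a (k', true)))).
Qed.

Let Ex_pair_l i j : {ae P, forall w, Ex P (fun v => pair_term i j v w) = 0}.
Proof.
rewrite /pair_term; case Dij: (D _ _); last by apply: filterE => w; exact: Ex_cst.
apply: filterS (ae_marginal statX (idx_gt0 j) deg_l) => w <-.
apply: (same_law_Ex (same_law_marginal statX (idx_gt0 i)) (f := fun x => H x (X (idx j) w))).
have mp : measurable_fun setT (fun x : V => (x, X (idx j) w : V)).
  exact: measurable_fun_pair.
exact: (measurableT_comp mH mp).
Qed.

Let Ex_pair_r i j : {ae P, forall w, Ex P (fun v => pair_term i j w v) = 0}.
Proof.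
rewrite /pair_term; case Dij: (D _ _); last by apply: filterE => w; exact: Ex_cst.
apply: filterS (ae_marginal statX (idx_gt0 i) deg_r) => w <-.
apply: (same_law_Ex (same_law_marginal statX (idx_gt0 j)) (f := fun y => H (X (idx i) w) y)).
have mp : measurable_fun setT (fun y : V => (X (idx i) w : V, y)).
  exact: measurable_fun_pair.
exact: (measurableT_comp mH mp).
Qed.

(** Degeneracy: integrating out one slot annihilates the product. *)
Lemma Ex_slot_free a t :
  Ex (P \x P)%E (fun z => slot_term a (free_slot t z)) = 0.
Proof.
have [Lf _] := mom_L1 (ltW q1) (mom_slot_free a t).
have rq1 : 1 <= r%:R * q.
  by move: (q1) => h; rewrite (le_trans (ltW h))// ler_peMl ?ler1n ?(ltn_trans _ r2)//; lra.
rewrite Ex_fubini// -[RHS](Ex_cst P); apply: ae_eq_Ex => //.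
  have mG := measurable_fubini_G Lf.
  have -> : (fun w => Ex P (fun v => slot_term a (free_slot t (v, w)))) =
    fine \o fubini_G P (EFin \o (fun z => slot_term a (free_slot t z))) by [].
  exact: measurableT_comp.
case: t Lf => k b Lf.
have E v w : slot_term a (free_slot (k, b) (v, w)) =
  (\prod_(k' < r | k' != k) pair_term (a (k', false)) (a (k', true)) w w) *
  (if b then pair_term (a (k, false)) (a (k, true)) w v
   else pair_term (a (k, false)) (a (k, true)) v w).
  rewrite /slot_term (bigD1 k)//= mulrC; congr (_ * _).
    apply: eq_bigr => k' kk'; rewrite /free_slot !xpair_eqE (negbTE kk')//=.
  by rewrite /free_slot !xpair_eqE eqxx/=; case: b {Lf}.
have [Lp _] := mom_L1 rq1 (mom_pair_product (a (k, false)) (a (k, true))).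
case: b {Lf} E => E.
- have Lw := ae_L1_section (L1_swap Lp).
  apply: filterS2 Lw (Ex_pair_r (a (k, false)) (a (k, true))) => w Lw Ew.
  by rewrite (Ex_ext _ (fun v => E v w)) ExZ// Ew mulr0.
- have Lw := ae_L1_section Lp.
  apply: filterS2 Lw (Ex_pair_l (a (k, false)) (a (k, true))) => w Lw Ew.
  by rewrite (Ex_ext _ (fun v => E v w)) ExZ// Ew mulr0.
Qed.

Let C := decouple_const C0 g0 * (1 + r%:R * m).

Let free_diag t w : free_slot t (w, w) = fun=> w.
Proof. by apply/funext => u; rewrite /free_slot; case: ifP. Qed.

(** Decoupling across the gap gives the isolated point an independent copy, after
    which the expectation vanishes by degeneracy. *)
Lemma Ex_slot_left (a : {ffun slot -> J}) t g : (0 < g)%N ->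
  (forall u, u != t -> (idx (a t) + g <= idx (a u))%N) ->
  `|Ex P (fun w => slot_term a (fun=> w))| <= C / g%:R ^+ 3.
Proof.
move=> g_gt0 left_t.
have sF := sigma_of_sigma_algebra X.
have := @decouple _ _ _ _ _ _ X q s C0 g0 q1 qs C00 rate (idx (a t)) g
  (fun z => slot_term a (free_slot t z)) (r%:R * m) (idx_gt0 _) g_gt0.
rewrite (Ex_slot_free a t) subr0 -/C.
rewrite (@Ex_ext _ _ _ P (fun w => slot_term a (free_slot t (w, w)))
  (fun w => slot_term a (fun=> w))); last by move=> w; rewrite free_diag.
apply.
- apply: measurable_slot_term => u; rewrite /free_slot.
  have [->|ut] := eqVneq u t.
    apply: (measurable_rectangles_fst (sF _) (sF _)).
    by apply: measurable_sigma_of => /=; rewrite idx_gt0 leqnn.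
  apply: (measurable_rectangles_snd (sF _) (sF _)).
  by apply: measurable_sigma_of => /=; exact: left_t.
- under eq_fun do rewrite free_diag; exact: mom_slot_diag.
- exact: mom_slot_free.
Qed.

(** The mirror image of the previous bound: the isolated point is now in the
    future, so the two copies are exchanged. *)
Lemma Ex_slot_right (a : {ffun slot -> J}) t g : (0 < g)%N ->
  (forall u, u != t -> (idx (a u) + g <= idx (a t))%N) ->
  `|Ex P (fun w => slot_term a (fun=> w))| <= C / g%:R ^+ 3.
Proof.
move=> g_gt0 right_t.
have sF := sigma_of_sigma_algebra X.
have [u ut] : exists u : slot, u != t.
  by exists (t.1, ~~ t.2); case: t {right_t} => k [] /=; rewrite xpair_eqE eqxx.
have k0 : (0 < idx (a t) - g)%N.
  rewrite subn_gt0; apply: leq_trans (right_t u ut).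
  by rewrite -[X in (X < _)%N]add0n ltn_add2r.
have gt : (g <= idx (a t))%N by rewrite ltnW// -subn_gt0.
have := @decouple _ _ _ _ _ _ X q s C0 g0 q1 qs C00 rate (idx (a t) - g) g
  (fun z => slot_term a (free_slot t (z.2, z.1))) (r%:R * m) k0 g_gt0.
have [Lf _] := mom_L1 (ltW q1) (mom_slot_free a t).
rewrite (Ex_swap Lf) (Ex_slot_free a t) subr0 -/C subnK//.
rewrite (@Ex_ext _ _ _ P (fun w => slot_term a (free_slot t (w, w)))
  (fun w => slot_term a (fun=> w))); last by move=> w; rewrite free_diag.
apply.
- apply: measurable_slot_term => u'; rewrite /free_slot.
  have [->|ut'] := eqVneq u' t.
    apply: (measurable_rectangles_snd (sF _) (sF _)).
    by apply: measurable_sigma_of => /=; exact: leqnn.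
  apply: (measurable_rectangles_fst (sF _) (sF _)).
  apply: measurable_sigma_of => /=; rewrite idx_gt0/=.
  by rewrite -(leq_add2r g) subnK// right_t.
- under eq_fun do rewrite free_diag; exact: mom_slot_diag.
- exact: (mom_swap (mom_slot_free a t)).
Qed.

Lemma kernel_sum_expand w :
  kernel_sum w ^+ r = \sum_(a : {ffun slot -> J}) slot_term a (fun=> w).
Proof.
rewrite /kernel_sum pair_big/= -[LHS](_ : \prod_(k < r) \sum_(p : J * J) pair_term p.1 p.2 w w = _); last first.
  by rewrite prodr_const card_ord.
rewrite bigA_distr_bigA/=.
pose e (f : {ffun 'I_r -> J * J}) : {ffun slot -> J} :=
  [ffun u => if u.2 then (f u.1).2 else (f u.1).1].
pose e' (a : {ffun slot -> J}) : {ffun 'I_r -> J * J} :=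
  [ffun k => (a (k, false), a (k, true))].
rewrite (reindex e)/=; last first.
  exists e' => [f _|a _]; apply/ffunP.
    by move=> k; rewrite /e /e' !ffunE/=; case: (f k).
  by move=> [k b]; rewrite /e /e' !ffunE/=; case: b.
by apply: eq_bigr => f _; apply: eq_bigr => k _; rewrite /e !ffunE.
Qed.

(** Every tuple of 2r points has two extreme points, so that the r-th moment of
    a degenerate double sum over N points is of order $N^{2r-2}$. *)
Theorem kernel_sum_moment :
  L1 P (fun w => kernel_sum w ^+ r) /\
  #|J|%:R ^+ 2 * Ex P (fun w => kernel_sum w ^+ r) <=
  288 * (r%:R * 2) ^+ 4 * C * #|J|%:R ^+ (r * 2).
Proof.
have La a : L1 P (fun w => slot_term a (fun=> w)).
  by have [] := mom_L1 (ltW q1) (mom_slot_diag a).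
have Ea a : `|Ex P (fun w => slot_term a (fun=> w))| <= C.
  have [_ E] := mom_L1 (ltW q1) (mom_slot_diag a); apply: le_trans E _.
  by rewrite /C ler_peMl ?decouple_const_ge1// addr_ge0// mulr_ge0.
have CC : 0 <= C.
  have c1 := decouple_const_ge1 g0 C00.
  by rewrite /C mulr_ge0 ?addr_ge0 ?mulr_ge0// (le_trans ler01 c1).
have -> : (fun w => kernel_sum w ^+ r) =
    fun w => \sum_(a : {ffun slot -> J}) slot_term a (fun=> w).
  by apply/funext => w; exact: kernel_sum_expand.
split; first exact: L1_sum.
rewrite Ex_sum//.
have c4 : (4 <= #|{: slot}|)%N.
  by rewrite card_prod card_ord card_bool; move: (r2) => h; lia.
have := @sum_isolated_extremes R slot J idx c4 idx_inj
  (fun a => `|Ex P (fun w => slot_term a (fun=> w))|) C CC Ea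
  Ex_slot_left Ex_slot_right.
rewrite card_prod card_ord card_bool natrM; apply: le_trans.
by rewrite ler_wpM2l ?exprn_ge0//; apply: ler_sum => a _; exact: ler_norm.
Qed.

End Tuples.
End KernelMoments.
(** * The Hoeffding decomposition *)

(** The exponents are tied by $(q-1)s=3$, which makes decoupling at distance g cost
    $g^{-3}$ for functions with q moments. Moments of order 4q leave q moments
    to products of four values of the kernel. *)
Record kernel_setting (d d' : measure_display) (Omega : measurableType d)
    (V : measurableType d') (R : realType) (P : probability Omega R)
    (X : nat -> {RV P >-> V}) (h : V -> V -> R) (q s C0 m : R) (g0 : nat) : Prop :=
  KernelSetting {
  ks_q : 1 < q;
  ks_qs : (q - 1) * s = 3;
  ks_C0 : 0 <= C0;
  ks_rate : forall g, (g0 <= g)%N -> (0 < g)%N ->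
    (beta_coef P X g <= (C0 * g%:R `^ (- (3 + s)))%:E)%E;
  ks_stat : stationary P X;
  ks_sym : forall x y, h x y = h y x;
  ks_meas : measurable_fun setT (fun z : V * V => h z.1 z.2);
  ks_joint : forall i j, (0 < i)%N -> (0 < j)%N -> i != j ->
     mom P (fun w => h (X i w) (X j w)) (4 * q) m;
  ks_product : mom (marginal X \x marginal X)%E (fun z => h z.1 z.2) (4 * q) m }.

Section Hoeffding.
Context (d d' : measure_display) (Omega : measurableType d)
  (V : measurableType d') (R : realType) (P : probability Omega R)
  (X : nat -> {RV P >-> V}).
Variables (q s C0 : R) (g0 : nat) (h : V -> V -> R) (m : R).
Hypothesis KS : kernel_setting X h q s C0 m g0.

Local Notation mu := (marginal X).
Local Notation p := (4 * q).

Let q1 : 1 < q. Proof. exact: (ks_q KS). Qed.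
Let qs := ks_qs KS.
Let C00 := ks_C0 KS.
Let rate := ks_rate KS.
Let statX := ks_stat KS.
Let h_sym := ks_sym KS.
Let mh := ks_meas KS.
Let mom_h_joint := ks_joint KS.
Let mom_h_product := ks_product KS.

Definition h_mean : R := Ex (mu \x mu)%E (fun z => h z.1 z.2).

Definition h_proj (x : V) : R := Ex mu (fun y => h x y).

Definition h1 (x : V) : R := h_proj x - h_mean.

Definition h2 (x y : V) : R := h x y - h_proj x - h_proj y + h_mean.

Let p1 : 1 < p. Proof. by move: (q1) => ?; lra. Qed.

Let Lh : L1 (mu \x mu)%E (fun z => h z.1 z.2).
Proof. by have [] := mom_L1 (ltW p1) mom_h_product. Qed.

Let Lhp : L1 (mu \x mu)%E (fun z => `|h z.1 z.2| `^ p).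
Proof. by case: mom_h_product. Qed.

Lemma measurable_h_proj : measurable_fun setT h_proj.
Proof.
have mF := measurable_fubini_F Lh.
have -> : h_proj = fine \o fubini_F mu (EFin \o (fun z => h z.1 z.2)) by [].
exact: measurableT_comp.
Qed.

Let ae_L1_h : {ae mu, forall x, L1 mu (fun y => h x y)}.
Proof. exact: (ae_integrable1 Lh). Qed.

Let ae_L1_hp : {ae mu, forall x, L1 mu (fun y => `|h x y| `^ p)}.
Proof. exact: (ae_integrable1 Lhp). Qed.

(** Jensen's inequality in each section of the kernel. *)
Lemma mom_h_proj : mom mu h_proj p m.
Proof.
apply: mom_integral; first exact: measurable_h_proj.
have [_ _ Em] := mom_h_product.
apply: (@le_trans _ _ (Ex (mu \x mu)%E (fun z => `|h z.1 z.2| `^ p))%:E); last first.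
  by rewrite lee_fin.
have mhp : measurable_fun setT (fun z : V * V => (`|h z.1 z.2| `^ p)%:E).
  by apply/measurable_EFinP; exact: measurable_abs_powR.
have hp0 z : (0 <= (`|h z.1 z.2| `^ p)%:E)%E by rewrite lee_fin powR_ge0.
rewrite -ExE// fubini_tonelli1//.
apply: ae_ge0_le_integral => //.
- apply/measurable_EFinP; apply: measurable_abs_powR; exact: measurable_h_proj.
- by move=> x _; apply: integral_ge0.
- exact: measurable_fun_fubini_tonelli_F.
- apply: filterS2 ae_L1_h ae_L1_hp => x Lx Lxp _.
  rewrite /fubini_F (ExE Lxp) lee_fin.
  exact: jensen_powR.
Qed.

Let L1_h_proj : L1 mu h_proj. Proof. by have [] := mom_L1 (ltW p1) mom_h_proj. Qed.

Let Ex_h_proj : Ex mu h_proj = h_mean.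
Proof.
rewrite /h_mean -(Ex_swap Lh) Ex_fubini; last exact: (L1_swap Lh).
by [].
Qed.

Lemma measurable_h1 : measurable_fun setT h1.
Proof. by apply: measurable_funB => //; exact: measurable_h_proj. Qed.

Lemma measurable_h2 : measurable_fun setT (fun z : V * V => h2 z.1 z.2).
Proof.
apply: measurable_funD => //; apply: measurable_funB; last first.
  by apply: measurableT_comp measurable_h_proj _.
by apply: measurable_funB => //; apply: measurableT_comp measurable_h_proj _.
Qed.

Lemma h2_sym x y : h2 x y = h2 y x.
Proof. by rewrite /h2 h_sym; ring. Qed.

Lemma Ex_h1 : Ex mu h1 = 0.
Proof. by rewrite /h1 ExB ?Ex_h_proj ?Ex_cst ?subrr//; exact: L1_cst. Qed.

(** Almost every y only: the section of h at y is integrable for almost every y. *)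
Lemma h2_degenerate : {ae mu, forall y, Ex mu (fun x => h2 x y) = 0}.
Proof.
apply: filterS ae_L1_h => y Ly.
have Ly' : L1 mu (fun x => h x y) by apply: L1_ext Ly => x; rewrite h_sym.
rewrite (@Ex_ext _ _ _ _ _ (fun x => (h x y - h_proj x) + (h_mean - h_proj y))).
  rewrite ExD ?Ex_cst; [|exact: L1B|exact: L1_cst].
  rewrite ExB// Ex_h_proj.
  rewrite (@Ex_ext _ _ _ _ _ (fun x => h y x)); last by move=> x; rewrite h_sym.
  by rewrite -/(h_proj y); ring.
by move=> x; rewrite /h2; ring.
Qed.

Definition m1 : R := 2 `^ p * (m + `|- h_mean| `^ p).
Definition m2 : R := 2 `^ p * (2 `^ p * (m + m) + 2 `^ p * (m + `|h_mean| `^ p)).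

Let momN d1 (W : measurableType d1) (Q : probability W R) (f : W -> R) c :
  mom Q f p c -> mom Q (fun w => - f w) p c.
Proof.
move=> fM; have := momZ (-1) fM; rewrite normrN1 powR1 mul1r.
by under eq_fun do rewrite mulN1r.
Qed.

Let mom_h_proj_law d1 (W : measurableType d1) (Q : probability W R) (U : W -> V) :
  same_law Q mu U id -> mom Q (fun w => h_proj (U w)) p m.
Proof.
move=> [mU _ E]; have sl : same_law mu Q id U by split => // C mC; rewrite E.
exact: (same_law_mom sl measurable_h_proj mom_h_proj).
Qed.

Lemma mom_h1 i : (0 < i)%N -> mom P (fun w => h1 (X i w)) p m1.
Proof.
move=> i0; apply: momD => //; last exact: mom_cst.
by apply: mom_h_proj_law; exact: same_law_marginal.
Qed.

Lemma mom_h1_marginal : mom mu h1 p m1.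
Proof. by apply: momD => //; [exact: mom_h_proj|exact: mom_cst]. Qed.

Let mom_h2_law d1 (W : measurableType d1) (Q : probability W R) (U1 U2 : W -> V) :
  same_law Q mu U1 id -> same_law Q mu U2 id ->
  mom Q (fun w => h (U1 w) (U2 w)) p m -> mom Q (fun w => h2 (U1 w) (U2 w)) p m2.
Proof.
move=> U1M U2M hM.
have := momD p1 (momD p1 hM (momN (mom_h_proj_law U1M)))
  (momD p1 (momN (mom_h_proj_law U2M)) (mom_cst Q h_mean p)).
congr mom; apply/funext => w; rewrite /h2; ring.
Qed.

Lemma mom_h2 i j : (0 < i)%N -> (0 < j)%N -> i != j ->
  mom P (fun w => h2 (X i w) (X j w)) p m2.
Proof.
by move=> i0 j0 ij; apply: mom_h2_law; [exact: same_law_marginal|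
  exact: same_law_marginal|exact: mom_h_joint].
Qed.

Lemma mom_h2_product : mom (mu \x mu)%E (fun z => h2 z.1 z.2) p m2.
Proof.
have sl2 := same_law_snd mu.
have sl1 : same_law (mu \x mu)%E mu fst id.
  split => // C mC; rewrite (_ : fst @^-1` C = C `*` setT); last first.
    by apply/seteqP; split => z //= [].
  transitivity (mu C * mu setT)%E; first exact: product_measure1E.
  by rewrite probability_setT mule1.
exact: (mom_h2_law sl1 sl2 mom_h_product).
Qed.

Let momM2 d1 (W : measurableType d1) (Q : probability W R) (f g : W -> R) (c : R) :
  mom Q f p c -> mom Q g p c -> mom Q (fun w => f w * g w) (2 * q) (2 * c).
Proof.
rewrite (_ : p = 2 * (2 * q)); last by ring.
by apply: momM; move: (q1) => ?; lra.
Qed.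

Section Sums.
Variables (J : finType) (idx : J -> nat).
Hypotheses (idx_inj : injective idx) (idx_gt0 : forall j, (0 < idx j)%N).

Definition sum_h1 (w : Omega) : R := \sum_(j : J) h1 (X (idx j) w).

Definition sum_h2 (w : Omega) : R :=
  \sum_(i : J) \sum_(j : J) (if i != j then h2 (X (idx i) w) (X (idx j) w) else 0).

(** The constants given by the count of index tuples for $(\sum h_1)^4$,
    $(\sum h_2)^2$ and $(\sum h_2)^4$. *)
Definition K1 : R := 288 * (2 * 2) ^+ 4 * (decouple_const C0 g0 * (1 + 2 * (2 * m1))).
Definition K2 : R := 288 * (2 * 2) ^+ 4 * (decouple_const C0 g0 * (1 + 2 * (1 + m2))).
Definition K4 : R := 288 * (4 * 2) ^+ 4 * (decouple_const C0 g0 * (1 + 4 * m2)).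

(** The fourth power of the sum is the square of the double sum of the degenerate
    kernel h1(x) h1(y). *)
Lemma sum_h1_moment4 :
  #|J|%:R ^+ 2 * Ex P (fun w => sum_h1 w ^+ 4) <= K1 * #|J|%:R ^+ 4.
Proof.
have mH : measurable_fun setT (fun z : V * V => h1 z.1 * h1 z.2).
  by apply: measurable_funM; apply: measurableT_comp measurable_h1 _.
have L1h1 : L1 mu h1 by have [] := mom_L1 (ltW p1) mom_h1_marginal.
have dl : {ae mu, forall y, Ex mu (fun x => h1 x * h1 y) = 0}.
  apply: filterE => y; rewrite (@Ex_ext _ _ _ _ _ (fun x => h1 y * h1 x)).
    by rewrite ExZ// Ex_h1 mulr0.
  by move=> x; rewrite mulrC.
have dr : {ae mu, forall x, Ex mu (fun y => h1 x * h1 y) = 0}.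
  by apply: filterE => x; rewrite ExZ// Ex_h1 mulr0.
have mP : mom (mu \x mu)%E (fun z => h1 z.1 * h1 z.2) (2%:R * q) (2 * m1).
  have m2' := mom_snd mom_h1_marginal; exact: (momM2 (mom_swap m2') m2').
have [_] := @kernel_sum_moment _ _ _ _ _ P X q s C0 g0 q1 qs C00 rate statX
  (fun x y => h1 x * h1 y) (fun _ _ => true) 2 (2 * m1) isT mH dl dr
  (fun i j i0 j0 _ => momM2 (mom_h1 i0) (mom_h1 j0)) mP J idx idx_inj idx_gt0.
rewrite -/K1 (_ : (2 * 2)%N = 4%N)//; apply: le_trans.
rewrite ler_wpM2l ?exprn_ge0// le_eqVlt; apply/orP; left; apply/eqP.
apply: Ex_ext => w; rewrite -[4%N]/(2 * 2)%N exprM; congr (_ ^+ _).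
rewrite /kernel_sum /pair_term /sum_h1 expr2 mulr_suml; apply: eq_bigr => i _.
by rewrite mulr_sumr.
Qed.

Let D (i j : nat) := i != j.

Let kernel_sum_h2 w : kernel_sum X h2 D idx w = sum_h2 w.
Proof.
apply: eq_bigr => i _; apply: eq_bigr => j _.
by rewrite /pair_term /D (inj_eq idx_inj).
Qed.

Let h2_degenerate_r : {ae mu, forall x, Ex mu (fun y => h2 x y) = 0}.
Proof.
apply: filterS h2_degenerate => x <-; apply: Ex_ext => y; exact: h2_sym.
Qed.

Lemma sum_h2_moment2 :
  #|J|%:R ^+ 2 * Ex P (fun w => sum_h2 w ^+ 2) <= K2 * #|J|%:R ^+ 4.
Proof.
have qq : 0 <= 2%:R * q <= p by move: (q1) => ?; apply/andP; split; lra.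
have [_] := @kernel_sum_moment _ _ _ _ _ P X q s C0 g0 q1 qs C00 rate statX
  h2 D 2 (1 + m2) isT measurable_h2 h2_degenerate h2_degenerate_r
  (fun i j i0 j0 ij => mom_weaken qq (mom_h2 i0 j0 ij))
  (mom_weaken qq mom_h2_product) J idx idx_inj idx_gt0.
rewrite -/K2 (_ : (2 * 2)%N = 4%N)//; apply: le_trans.
rewrite ler_wpM2l ?exprn_ge0// le_eqVlt; apply/orP; left; apply/eqP.
by apply: Ex_ext => w; rewrite kernel_sum_h2.
Qed.

Lemma sum_h2_moment4 :
  #|J|%:R ^+ 2 * Ex P (fun w => sum_h2 w ^+ 4) <= K4 * #|J|%:R ^+ 8.
Proof.
have [_] := @kernel_sum_moment _ _ _ _ _ P X q s C0 g0 q1 qs C00 rate statX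
  h2 D 4 m2 isT measurable_h2 h2_degenerate h2_degenerate_r
  (fun i j i0 j0 ij => mom_h2 i0 j0 ij) mom_h2_product J idx idx_inj idx_gt0.
rewrite -/K4 (_ : (4 * 2)%N = 8%N)//; apply: le_trans.
rewrite ler_wpM2l ?exprn_ge0// le_eqVlt; apply/orP; left; apply/eqP.
by apply: Ex_ext => w; rewrite kernel_sum_h2.
Qed.

End Sums.
End Hoeffding.
(** * U-statistics of blocks *)

(** Telescoping comparison with $2/k^2$. *)
Lemma sum_inv_cube (R : realType) (a b : nat) : (0 < a)%N ->
  \sum_(a <= k < b) (k%:R ^+ 3)^-1 <= 2 / a%:R ^+ 2 :> R.
Proof.
move=> a0; have [ba|ab] := leqP b a.
  by rewrite big_geq// divr_ge0// exprn_ge0.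
suff H n : \sum_(a <= k < a + n) (k%:R ^+ 3)^-1 <=
    2 / a%:R ^+ 2 - 2 / (a + n)%:R ^+ 2 :> R.
  rewrite -(subnKC (ltnW ab)); apply: le_trans (H _) _.
  by rewrite gerBl divr_ge0// exprn_ge0.
elim: n => [|n IH]; first by rewrite addn0 big_geq// subrr.
rewrite addnS big_nat_recr/= ?leq_addr//; apply: le_trans (lerD IH (lexx _)) _.
have -> : (a + n).+1%:R = (a + n)%:R + 1 :> R by rewrite natr1.
have : 1 <= (a + n)%:R :> R by rewrite ler1n addn_gt0 a0.
move: {IH} ((a + n)%:R : R) => x x1.
have x0 : 0 < x by lra.
suff : (x ^+ 3)^-1 <= 2 / x ^+ 2 - 2 / (x + 1) ^+ 2 by lra.
have x10 : 0 < x + 1 by lra.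
rewrite -subr_ge0 [X in 0 <= X](_ : _ =
  (3 * x ^+ 2 - 1) / (x ^+ 3 * (x + 1) ^+ 2)); last first.
  by field; apply/andP; split; lra.
by rewrite divr_ge0 ?mulr_ge0 ?exprn_ge0 ?(ltW x0) ?(ltW x10)//; nra.
Qed.

Lemma count_const_ge0 (R : realType) (n a b c : R) :
  0 <= n -> 0 <= a -> 0 <= b -> 0 <= c ->
  0 <= 288 * n ^+ 4 * (a * (1 + b * c)).
Proof.
move=> n0 a0 b0 c0; apply: mulr_ge0.
  by apply: mulr_ge0; [exact: ler0n|exact: exprn_ge0].
by apply: mulr_ge0; [exact: a0|apply: addr_ge0; [exact: ler01|exact: mulr_ge0]].
Qed.

Section Blocks.
Context (d d' : measure_display) (Omega : measurableType d)
  (V : measurableType d') (R : realType) (P : probability Omega R)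
  (X : nat -> {RV P >-> V}) (h : V -> V -> R) (q s C0 m : R) (g0 : nat).
Hypothesis KS : kernel_setting X h q s C0 m g0.

Local Notation p := (4 * q).
Local Notation theta := (h_mean X h).

(** The U-statistic of a block, summed over ordered pairs: this form ignores the
    order of the indices, which a circular block does not preserve. *)
Definition pair_mean (l : nat) (idx : 'I_l -> nat) (w : Omega) : R :=
  (l%:R * (l%:R - 1))^-1 *
  \sum_(i < l) \sum_(j < l) (if i != j then h (X (idx i) w) (X (idx j) w) else 0).

Definition linear_part (l : nat) (idx : 'I_l -> nat) (w : Omega) : R :=
  2 / l%:R * sum_h1 X h idx w.

Definition degen_part (l : nat) (idx : 'I_l -> nat) (w : Omega) : R :=
  (l%:R * (l%:R - 1))^-1 * sum_h2 X h idx w.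

(** A single bound for the moments of blocks of every length. *)
Definition block_const : R :=
  16 * K1 X q C0 g0 h m + 4 * K2 X q C0 g0 h m + 16 * K4 X q C0 g0 h m +
  2 `^ p * (2 `^ p * m + `|- theta| `^ p).

Lemma sum_if_ne l (f : 'I_l -> R) :
  \sum_(i < l) \sum_(j < l) (if i != j then f i else 0) =
  (l%:R - 1) * \sum_(i < l) f i.
Proof.
rewrite mulr_sumr; apply: eq_bigr => i _.
rewrite -big_mkcond/= (eq_bigl (predC1 i)); last by move=> j; rewrite /= eq_sym.
rewrite sumr_const cardC1 card_ord -[LHS]mulr_natl.
by rewrite -subn1 natrB// (leq_ltn_trans _ (ltn_ord i)).
Qed.

(** Each h1 value occurs in l - 1 of the ordered pairs on either side. *)
Lemma hoeffding_decomposition l (idx : 'I_l -> nat) w : (2 <= l)%N ->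
  pair_mean idx w - theta = linear_part idx w + degen_part idx w.
Proof.
move=> l2; have l0 : l%:R != 0 :> R by rewrite pnatr_eq0; lia.
have l1 : l%:R - 1 != 0 :> R by rewrite subr_eq0 pnatr_eq1; lia.
rewrite /pair_mean /linear_part /degen_part /sum_h2 /sum_h1.
pose e i := h1 X h (X (idx i) w).
rewrite -[\sum_(j < l) h1 X h (X (idx j) w)]/(\sum_(j < l) e j).
set S1 := \sum_(j < l) e j.
rewrite (eq_bigr (fun i => \sum_(j < l) (if i != j then h2 X h (X (idx i) w) (X (idx j) w) else 0)
    + \sum_(j < l) (if i != j then e i else 0)
    + \sum_(j < l) (if j != i then e j else 0)
    + \sum_(j < l) (if i != j then theta else 0))); last first.
  move=> i _; rewrite -!big_split/=; apply: eq_bigr => j _.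
  rewrite (eq_sym j i) /h2 /e /h1; case: ifP => _; ring.
rewrite !big_split/= (exchange_big _ _ _ _ _ (fun i j => if j != i then e j else 0)).
rewrite !sum_if_ne sumr_const card_ord -[theta *+ l]mulr_natl -/S1.
by field; rewrite l0 l1.
Qed.

Section OneBlock.
Variables (l : nat) (idx : 'I_l -> nat).
Hypotheses (l2 : (2 <= l)%N) (idx_inj : injective idx)
  (idx_gt0 : forall j, (0 < idx j)%N).

Let q1 : 1 < q. Proof. exact: (ks_q KS). Qed.
Let p1 : 1 < p. Proof. by move: (q1) => ?; lra. Qed.
Let m0 : 0 <= m. Proof. exact: mom_ge0 (ks_product KS). Qed.

Let lR : 2 <= l%:R :> R. Proof. by rewrite ler_nat. Qed.

Let sum_inv (c : R) n k x : (0 < n)%N -> 0 <= c ->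
  n%:R ^+ 2 * x <= c * n%:R ^+ (k + 2) -> x <= c * n%:R ^+ k.
Proof.
move=> n0 c0; have n2 : 0 < n%:R ^+ 2 :> R by rewrite exprn_gt0 ?ltr0n.
by rewrite exprD mulrA (mulrC _ (n%:R ^+ 2)) ler_pM2l.
Qed.

Let m1_ge0 : 0 <= m1 X q h m.
Proof.
exact: (mom_ge0 (mom_h1_marginal KS)).
Qed.

Let m2_ge0 : 0 <= m2 X q h m.
Proof.
exact: (mom_ge0 (mom_h2_product KS)).
Qed.

Let dc0 : 0 <= decouple_const C0 g0.
Proof. exact: le_trans ler01 (decouple_const_ge1 g0 (ks_C0 KS)). Qed.

Let K1_ge0 : 0 <= K1 X q C0 g0 h m.
Proof.
exact: (count_const_ge0 (mulr_ge0 (ler0n R 2) (ler0n R 2)) dc0 (ler0n R 2) (mulr_ge0 (ler0n R 2) m1_ge0)).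
Qed.

Let K2_ge0 : 0 <= K2 X q C0 g0 h m.
Proof.
exact: (count_const_ge0 (mulr_ge0 (ler0n R 2) (ler0n R 2)) dc0 (ler0n R 2) (addr_ge0 ler01 m2_ge0)).
Qed.

Let K4_ge0 : 0 <= K4 X q C0 g0 h m.
Proof.
exact: (count_const_ge0 (mulr_ge0 (ler0n R 4) (ler0n R 2)) dc0 (ler0n R 4) m2_ge0).
Qed.

Let l_gt0 : (0 < l)%N. Proof. exact: ltnW l2. Qed.

Let KU_ge0 : 0 <= 2 `^ p * (2 `^ p * m + `|- theta| `^ p).
Proof. by rewrite mulr_ge0 ?addr_ge0 ?mulr_ge0 ?powR_ge0. Qed.

Lemma block_const_ge0 : 0 <= block_const.
Proof.
rewrite /block_const; move: K1_ge0 K2_ge0 K4_ge0 KU_ge0; set KU := _ * (_ + _) => a b c e; lra.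
Qed.

Lemma mom_block : mom P (fun w => pair_mean idx w - theta) p block_const.
Proof.
apply: (mom_le (m := 2 `^ p * (2 `^ p * m + `|- theta| `^ p))).
  by rewrite /block_const; move: K1_ge0 K2_ge0 K4_ge0 KU_ge0; set KU := _ * (_ + _) => a b c e; lra.
apply: momD => //; last exact: mom_cst.
pose F (x : 'I_l * 'I_l) w := if x.1 != x.2 then h (X (idx x.1) w) (X (idx x.2) w) else 0.
have FM x : mom P (F x) p m.
  rewrite /F; case: x => i j /=; have [->|ij] := eqVneq i j.
    apply: (mom_le (m := `|0| `^ p)); last exact: mom_cst.
    by rewrite normr0 powR0// gt_eqF//; move: (p1) => ?; lra.
  by apply: (ks_joint KS) => //; rewrite (inj_eq idx_inj).
have := momZ (l%:R / (l%:R - 1)) (mom_mean m0 p1 FM).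
rewrite card_prod card_ord natrM; move: (lR) => l2R.
have -> : (fun w => l%:R / (l%:R - 1) * ((l%:R * l%:R)^-1 * \sum_x F x w)) = pair_mean idx.
  apply/funext => w; rewrite /pair_mean pair_big/= mulrA; congr (_ * _).
  by field; apply/andP; split; lra.
apply: mom_le; rewrite ler_wpM2r// ger0_norm; last by rewrite divr_ge0; lra.
apply: ge0_ler_powR; rewrite ?nnegrE ?divr_ge0//; try lra.
  by move: (p1) => ?; lra.
by rewrite ler_pdivrMr; lra.
Qed.

Definition linear_mom_const : R := `|2| `^ p * m1 X q h m.

Definition degen_mom_const : R :=
  2 `^ p * (block_const + `|-1| `^ p * linear_mom_const).

Lemma mom_linear_part : mom P (linear_part idx) p linear_mom_const.
Proof.
have hM j := mom_h1 KS (idx_gt0 j).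
have := momZ 2 (mom_mean m1_ge0 p1 hM); rewrite card_ord.
congr mom; apply/funext => w.
by rewrite /linear_part mulrA.
Qed.

Lemma mom_degen_part : mom P (degen_part idx) p degen_mom_const.
Proof.
have := momD p1 mom_block (momZ (-1) mom_linear_part).
congr mom; apply/funext => w; rewrite hoeffding_decomposition//; ring.
Qed.

(** The three bounds below divide moments of order $l^2$, $l^2$ and $l^6$ of sums by
    $l^4$, $l^4$ and $l^8$. *)
Lemma linear_part_moment4 : Ex P (fun w => linear_part idx w ^+ 4) <= block_const / l%:R ^+ 2.
Proof.
have S4 : L1 P (fun w => sum_h1 X h idx w ^+ 4).
  have LM := mom_linear_part.
  have [] := @mom_exprn _ _ _ _ _ _ _ 4 _ (momZ (l%:R / 2) LM).
    by move: (q1) => ?; lra.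
  move=> L _; apply: L1_ext L => w; congr (_ ^+ _); rewrite /linear_part; field.
  by move: (lR) => ?; lra.
have := sum_h1_moment4 KS idx_inj idx_gt0.
rewrite card_ord => H; have {}H : Ex P (fun w => sum_h1 X h idx w ^+ 4) <= K1 X q C0 g0 h m * l%:R ^+ 2.
  exact: (sum_inv (k := 2) l_gt0 K1_ge0 H).
rewrite (@Ex_ext _ _ _ _ _ (fun w => 16 / l%:R ^+ 4 * sum_h1 X h idx w ^+ 4)); last first.
  move=> w; rewrite /linear_part exprMn expr_div_n; congr (_ / _ * _); ring.
rewrite ExZ//; have l4 : 0 <= 16 / l%:R ^+ 4 :> R by rewrite divr_ge0 ?exprn_ge0.
apply: le_trans (ler_wpM2l l4 H) _.
rewrite [leLHS](_ : _ = 16 * K1 X q C0 g0 h m / l%:R ^+ 2); last first.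
  by field; move: (lR) => ?; lra.
rewrite ler_wpM2r ?invr_ge0 ?exprn_ge0// /block_const.
by move: K1_ge0 K2_ge0 K4_ge0 KU_ge0; set KU := _ * (_ + _) => a b c e; lra.
Qed.

Let deg_ratio : (l%:R - 1)^-1 <= 2 / l%:R :> R.
Proof.
move: (lR) => l2R; rewrite ler_pdivlMr; last lra.
by rewrite ler_pdivrMl; lra.
Qed.

Lemma degen_part_moment2 : Ex P (fun w => degen_part idx w ^+ 2) <= block_const / l%:R ^+ 2.
Proof.
have l0 : l%:R != 0 :> R by move: (lR) => ?; lra.
have l1 : l%:R - 1 != 0 :> R by move: (lR) => ?; lra.
have S2 : L1 P (fun w => sum_h2 X h idx w ^+ 2).
  have DM := mom_degen_part.
  have [] := @mom_exprn _ _ _ _ _ _ _ 2 _ (momZ (l%:R * (l%:R - 1)) DM).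
    by move: (q1) => ?; lra.
  move=> L _; apply: L1_ext L => w; congr (_ ^+ _); rewrite /degen_part.
  by rewrite mulVKf// mulf_neq0.
have := sum_h2_moment2 KS idx_inj idx_gt0.
rewrite card_ord => H; have {}H : Ex P (fun w => sum_h2 X h idx w ^+ 2) <= K2 X q C0 g0 h m * l%:R ^+ 2.
  exact: (sum_inv (k := 2) l_gt0 K2_ge0 H).
rewrite (@Ex_ext _ _ _ _ _ (fun w => (l%:R * (l%:R - 1)) ^- 2 * sum_h2 X h idx w ^+ 2)); last first.
  by move=> w; rewrite /degen_part exprMn exprVn.
rewrite ExZ//; have l4 : 0 <= (l%:R * (l%:R - 1)) ^- 2 :> R by rewrite invr_ge0 sqr_ge0.
apply: le_trans (ler_wpM2l l4 H) _.
rewrite [leLHS](_ : _ = K2 X q C0 g0 h m * (l%:R - 1)^-1 ^+ 2); last by field; rewrite l0 l1.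
apply: (@le_trans _ _ (K2 X q C0 g0 h m * (2 / l%:R) ^+ 2)).
  rewrite ler_wpM2l//; apply: lerXn2r; rewrite ?nnegrE ?invr_ge0 ?divr_ge0//.
  by move: (lR) => ?; lra.
rewrite expr_div_n mulrA ler_wpM2r ?invr_ge0 ?exprn_ge0//.
rewrite mulrC (_ : 2 ^+ 2 = 4); last by ring.
rewrite /block_const.
by move: (mulr_ge0 (ler0n R 16) K1_ge0) (mulr_ge0 (ler0n R 16) K4_ge0) (KU_ge0) => a b c; lra.
Qed.

Lemma degen_part_moment4 : Ex P (fun w => degen_part idx w ^+ 4) <= block_const / l%:R ^+ 2.
Proof.
have l0 : l%:R != 0 :> R by move: (lR) => ?; lra.
have l1 : l%:R - 1 != 0 :> R by move: (lR) => ?; lra.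
have S4 : L1 P (fun w => sum_h2 X h idx w ^+ 4).
  have DM := mom_degen_part.
  have [] := @mom_exprn _ _ _ _ _ _ _ 4 _ (momZ (l%:R * (l%:R - 1)) DM).
    by move: (q1) => ?; lra.
  move=> L _; apply: L1_ext L => w; congr (_ ^+ _); rewrite /degen_part.
  by rewrite mulVKf// mulf_neq0.
have := sum_h2_moment4 KS idx_inj idx_gt0.
rewrite card_ord => H; have {}H : Ex P (fun w => sum_h2 X h idx w ^+ 4) <= K4 X q C0 g0 h m * l%:R ^+ 6.
  exact: (sum_inv (k := 6) l_gt0 K4_ge0 H).
rewrite (@Ex_ext _ _ _ _ _ (fun w => (l%:R * (l%:R - 1)) ^- 4 * sum_h2 X h idx w ^+ 4)); last first.
  by move=> w; rewrite /degen_part exprMn exprVn.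
rewrite ExZ//; have l4 : 0 <= (l%:R * (l%:R - 1)) ^- 4 :> R.
  by rewrite invr_ge0 exprn_even_ge0.
apply: le_trans (ler_wpM2l l4 H) _.
rewrite [leLHS](_ : _ = K4 X q C0 g0 h m * (l%:R ^+ 2 * (l%:R - 1)^-1 ^+ 4)); last by field; rewrite l0 l1.
apply: (@le_trans _ _ (K4 X q C0 g0 h m * (l%:R ^+ 2 * (2 / l%:R) ^+ 4))).
  rewrite ler_wpM2l// ler_wpM2l ?exprn_ge0//; apply: lerXn2r; rewrite ?nnegrE ?invr_ge0 ?divr_ge0//.
  by move: (lR) => ?; lra.
rewrite [leLHS](_ : _ = (16 * K4 X q C0 g0 h m) / l%:R ^+ 2); last by field.
rewrite ler_wpM2r ?invr_ge0 ?exprn_ge0// /block_const.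
by move: (mulr_ge0 (ler0n R 16) K1_ge0) (mulr_ge0 (ler0n R 4) K2_ge0) (KU_ge0) => a b c; lra.
Qed.

End OneBlock.
End Blocks.
(** * Long-run variance *)

Section LongRun.
Context (R : realType) (gam : nat -> R) (c : R).
Hypothesis gam_le : forall k, (0 < k)%N -> `|gam k| <= c / k%:R ^+ 3.

Definition lag_sum (j : nat) : R := gam 0 + 2 * \sum_(1 <= k < j.+1) gam k.

Definition cov_sum (l : nat) : R := \sum_(i < l) \sum_(j < l) gam (dist_nat i j).

(** Adding the index l to the square adds a row and a column of lags 0, ..., l. *)
Lemma cov_sumE l : cov_sum l = \sum_(j < l) lag_sum j.
Proof.
elim: l => [|l IH]; first by rewrite /cov_sum !big_ord0.
rewrite [RHS]big_ord_recr/= -IH /cov_sum big_ord_recr/=.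
rewrite (eq_bigr (fun i : 'I_l => \sum_(j < l) gam (dist_nat i j) + gam (dist_nat i l))); last first.
  by move=> i _; rewrite big_ord_recr.
rewrite big_split/= big_ord_recr/=.
have E : \sum_(i < l) gam (dist_nat i l) = \sum_(1 <= k < l.+1) gam k.
  rewrite (reindex_inj rev_ord_inj)/= big_add1 big_mkord; apply: eq_bigr => i _.
  congr (gam _); rewrite /dist_nat subKn// (eqP (_ : l - i.+1 - l == 0)%N) ?add0n//.
  by rewrite subn_eq0 leq_subr.
rewrite E [\sum_(i < l) gam (dist_nat l i)](eq_bigr (fun i : 'I_l => gam (dist_nat i l))); last first.
  by move=> i _; congr gam; rewrite /dist_nat addnC.
rewrite E /lag_sum (_ : dist_nat l l = 0%N); first by ring.
by rewrite /dist_nat subnn.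
Qed.

Let c0 : 0 <= c.
Proof. by have := gam_le (isT : (0 < 1)%N); rewrite expr1n divr1; apply: le_trans. Qed.

Lemma lag_sum_tail j n : (j <= n)%N ->
  `|lag_sum j - lag_sum n| <= 4 * c / j.+1%:R ^+ 2.
Proof.
move=> jn; rewrite /lag_sum [X in _ - (_ + 2 * X)](@big_cat_nat _ _ _ j.+1)//=.
rewrite [X in `|X|](_ : _ = - (2 * \sum_(j.+1 <= k < n.+1) gam k)); last by ring.
rewrite normrN normrM (ger0_norm (ler0n R 2)).
apply: (@le_trans _ _ (2 * \sum_(j.+1 <= k < n.+1) (c * (k%:R ^+ 3)^-1))).
  rewrite ler_wpM2l//; apply: le_trans (ler_norm_sum _ _ _) _.
  rewrite big_nat_cond [leRHS]big_nat_cond; apply: ler_sum => k /andP[/andP[jk _] _].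
  by apply: gam_le; lia.
rewrite -mulr_sumr; have := ler_wpM2l c0 (@sum_inv_cube R j.+1 n.+1 isT).
rewrite (_ : 4 * c / _ = 2 * (c * (2 / j.+1%:R ^+ 2))); last by ring.
by move=> H; rewrite ler_wpM2l.
Qed.

Lemma sum_inv_sqr l : \sum_(j < l) (j.+1%:R ^+ 2)^-1 <= 2 :> R.
Proof.
have H n : \sum_(j < n.+1) (j.+1%:R ^+ 2)^-1 <= 2 - n.+1%:R^-1 :> R.
  elim: n => [|n IH]; first by rewrite big_ord_recl big_ord0 expr1n invr1; lra.
  rewrite big_ord_recr/=; apply: le_trans (lerD IH (lexx _)) _.
  have -> : n.+2%:R = n.+1%:R + 1 :> R by rewrite natr1.
  have : 1 <= n.+1%:R :> R by rewrite ler1n.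
  move: {IH} (n.+1%:R : R) => x x1; rewrite -subr_ge0 [X in 0 <= X](_ : _ =
    1 / (x * (x + 1) ^+ 2)); last by field; apply/andP; split; lra.
  by rewrite divr_ge0 ?mulr_ge0 ?exprn_ge0//; lra.
case: l => [|l]; first by rewrite big_ord0.
by apply: le_trans (H l) _; rewrite gerBl invr_ge0.
Qed.

Let cov_sum_lag l n : (0 < l <= n)%N -> `|cov_sum l / l%:R - lag_sum n| <= 8 * c / l%:R.
Proof.
move=> /andP[l0 ln]; have lR : 0 < l%:R :> R by rewrite ltr0n.
rewrite cov_sumE [X in `|X|](_ : _ = (\sum_(j < l) (lag_sum j - lag_sum n)) / l%:R); last first.
  rewrite sumrB sumr_const card_ord -[lag_sum n *+ l]mulr_natl mulrBl; congr (_ - _).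
  by field; rewrite gt_eqF.
rewrite normrM (gtr0_norm (_ : 0 < l%:R^-1)) ?invr_gt0// ler_wpM2r ?invr_ge0//.
apply: le_trans (ler_norm_sum _ _ _) _.
apply: (@le_trans _ _ (\sum_(j < l) (4 * c * (j.+1%:R ^+ 2)^-1))).
  by apply: ler_sum => j _; apply: lag_sum_tail; exact: ltnW (leq_trans (ltn_ord j) ln).
rewrite -mulr_sumr; have c4 : 0 <= 4 * c by move: (c0) => ?; lra.
by apply: le_trans (ler_wpM2l c4 (sum_inv_sqr l)) _; lra.
Qed.

(** The normalized variances of the partial sums converge at rate 1/l. *)
Lemma cov_sum_rate l n : (0 < l <= n)%N ->
  `|cov_sum l / l%:R - cov_sum n / n%:R| <= 16 * c / l%:R.
Proof.
move=> /andP[l0 ln]; have n0 : (0 < n)%N by exact: leq_trans ln.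
have H1 := @cov_sum_lag l n; have H2 := @cov_sum_lag n n.
rewrite l0 ln in H1; rewrite n0 leqnn in H2.
move: (H1 isT) (H2 isT) => {}H1 {}H2.
have H3 : 8 * c / n%:R <= 8 * c / l%:R.
  rewrite ler_wpM2l ?mulr_ge0// lef_pV2 ?posrE ?ltr0n// ler_nat//.
rewrite (_ : _ - _ = (cov_sum l / l%:R - lag_sum n) - (cov_sum n / n%:R - lag_sum n)); last by ring.
apply: le_trans (ler_normB _ _) _.
rewrite (_ : 16 * c / l%:R = 8 * c / l%:R + 8 * c / l%:R); last by ring.
by apply: lerD => //; exact: le_trans H3.
Qed.

End LongRun.

Section BlockVariance.
Context (d d' : measure_display) (Omega : measurableType d)
  (V : measurableType d') (R : realType) (P : probability Omega R)
  (X : nat -> {RV P >-> V}) (h : V -> V -> R) (q s C0 m : R) (g0 : nat).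
Hypothesis KS : kernel_setting X h q s C0 m g0.

Local Notation p := (4 * q).
Local Notation theta := (h_mean X h).
Local Notation hh := (h1 X h).
Local Notation Kb := (block_const X h q C0 m g0).

Let q1 : 1 < q. Proof. exact: (ks_q KS). Qed.
Let p1 : 1 < p. Proof. by move: (q1) => ?; lra. Qed.

Definition autocov (k : nat) : R := Ex P (fun w => hh (X 1%N w) * hh (X (1 + k)%N w)).

Definition autocov_const : R := decouple_const C0 g0 * (1 + (1 + 2 * m1 X q h m)).

Let mh1 : measurable_fun setT hh.
Proof. exact: (measurable_h1 KS). Qed.

Let mom_hh i : (0 < i)%N -> mom P (fun w => hh (X i w)) p (m1 X q h m).
Proof. exact: (mom_h1 KS). Qed.

Let mom_q (d1 : measure_display) (W : measurableType d1) (Q : probability W R)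
  (f g : W -> R) c : mom Q f p c -> mom Q g p c ->
  mom Q (fun w => f w * g w) q (1 + 2 * c).
Proof.
rewrite (_ : p = 2 * (2 * q)); last by ring.
move=> fM gM; have q2 : 0 <= 2 * q by move: (q1) => ?; lra.
apply: (mom_weaken _ (momM q2 fM gM)).
by move: (q1) => ?; apply/andP; split; lra.
Qed.

Let Ex_hh i : (0 < i)%N -> Ex P (fun w => hh (X i w)) = 0.
Proof.
move=> i0; rewrite (same_law_Ex (same_law_marginal (ks_stat KS) i0) mh1).
exact: (Ex_h1 KS).
Qed.

Let L1_hh i : (0 < i)%N -> L1 P (fun w => hh (X i w)).
Proof. by move=> i0; have [] := mom_L1 (ltW p1) (mom_hh i0). Qed.

(** Decoupling at distance k: the product of the two independent factors has
    expectation 0. *)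
Lemma autocov_le k : (0 < k)%N -> `|autocov k| <= autocov_const / k%:R ^+ 3.
Proof.
move=> k0; have sF := sigma_of_sigma_algebra X.
have k1 : (0 < 1 + k)%N by [].
have mp : mom (P \x P)%E (fun z : Omega * Omega => hh (X 1%N z.1) * hh (X (1 + k)%N z.2)) q
    (1 + 2 * m1 X q h m).
  exact: (mom_q (mom_swap (mom_snd (mom_hh (isT : (0 < 1)%N)))) (mom_snd (mom_hh k1))).
have mdg : mom P (fun w => hh (X 1%N w) * hh (X (1 + k)%N w)) q (1 + 2 * m1 X q h m).
  exact: (mom_q (mom_hh (isT : (0 < 1)%N)) (mom_hh k1)).
have mX i D : D i -> @measurable_fun _ _ (g_sigma_algebraType (sigma_of D X)) R setT
    (fun w => hh (X i w)).
  by move=> Di; apply: (measurableT_comp mh1); exact: measurable_sigma_of.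
have mphi : @measurable_fun _ _
    (g_sigma_algebraType (rectangles (past X 1) (future X (1 + k)))) R setT
    (fun z : Omega * Omega => hh (X 1%N z.1) * hh (X (1 + k)%N z.2)).
  apply: measurable_funM.
    apply: (measurable_rectangles_fst (sF _) (sF _) (f := fun w => hh (X 1%N w))).
    by apply: mX.
  apply: (measurable_rectangles_snd (sF _) (sF _) (f := fun w => hh (X (1 + k)%N w))).
  by apply: mX => /=.
have := decouple (ks_q KS) (ks_qs KS) (ks_C0 KS) (ks_rate KS) (isT : (0 < 1)%N) k0 mphi mdg mp.
rewrite [X in _ - X](_ : _ = 0) ?subr0//.
have [Lf _] := mom_L1 (ltW q1) mp.
rewrite Ex_fubini// -[RHS](Ex_cst P); apply: Ex_ext => w /=.
rewrite (@Ex_ext _ _ _ _ _ (fun v => hh (X (1 + k)%N w) * hh (X 1%N v))); last first.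
  by move=> v; rewrite mulrC.
by rewrite ExZ ?L1_hh// Ex_hh// mulr0.
Qed.

Lemma cov_h1 a b : (0 < a)%N -> (0 < b)%N ->
  Ex P (fun w => hh (X a w) * hh (X b w)) = autocov (dist_nat a b).
Proof.
have mhh : measurable_fun setT (fun z : V * V => hh z.1 * hh z.2).
  by apply: measurable_funM; apply: measurableT_comp mh1 _.
have lt_case a' b' : (0 < a')%N -> (a' < b')%N ->
    Ex P (fun w => hh (X a' w) * hh (X b' w)) = autocov (dist_nat a' b').
  move=> a0 ab.
  have /= -> := same_law_Ex (same_law_pair (ks_stat KS) a0 ab) mhh.
  by rewrite /autocov /dist_nat (eqP (ltnW ab)).
move=> a0 b0; have [ab|ba|->] := ltngtP a b; first exact: lt_case.
  rewrite (_ : dist_nat a b = dist_nat b a); last by rewrite /dist_nat addnC.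
  by rewrite -(lt_case _ _ b0 ba); apply: Ex_ext => w; exact: mulrC.
have mh2 : measurable_fun setT (fun x => hh x * hh x) by exact: measurable_funM.
have S := same_law_Ex (same_law_marginal (ks_stat KS) _) mh2.
by rewrite /autocov /dist_nat subnn; have /= -> := S _ b0; have /= -> := S 1%N isT.
Qed.

Section OneBlock.
Variables (l : nat) (idx : 'I_l -> nat).
Hypotheses (l2 : (2 <= l)%N) (idx_inj : injective idx)
  (idx_gt0 : forall j, (0 < idx j)%N).

Let lR : 2 <= l%:R :> R. Proof. by rewrite ler_nat. Qed.

Lemma L1_block_sqr : [/\ L1 P (fun w => linear_part X h idx w ^+ 2),
  L1 P (fun w => degen_part X h idx w ^+ 2),
  L1 P (fun w => linear_part X h idx w ^+ 4) &
  L1 P (fun w => degen_part X h idx w ^+ 4)].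
Proof.
have LM := mom_linear_part KS idx_gt0.
have DM := mom_degen_part KS l2 idx_inj idx_gt0.
have h2 : 2%:R <= p by move: (q1) => ?; lra.
have h4 : 4%:R <= p by move: (q1) => ?; lra.
split.
- exact: (mom_exprn h2 LM).1.
- exact: (mom_exprn h2 DM).1.
- exact: (mom_exprn h4 LM).1.
- exact: (mom_exprn h4 DM).1.
Qed.

(** From the fourth moment, by $2x\le lx^2+1/l$ at the square of the linear part. *)
Lemma linear_part_moment2 : Ex P (fun w => linear_part X h idx w ^+ 2) <= (Kb + 1) / (2 * l%:R).
Proof.
have [L2 _ L4 _] := L1_block_sqr.
have lam : 0 < l%:R :> R by move: (lR) => ?; lra.
apply: (@le_trans _ _ (Ex P (fun w => l%:R / 2 * linear_part X h idx w ^+ 4 + (2 * l%:R)^-1))).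
  apply: le_Ex => //[|w]; first by apply: L1D; [exact: L1Z|exact: L1_cst].
  rewrite -subr_ge0 [X in 0 <= X](_ : _ =
    (l%:R * linear_part X h idx w ^+ 2 - 1) ^+ 2 / (2 * l%:R)); last by field; rewrite gt_eqF.
  by rewrite divr_ge0 ?sqr_ge0// mulr_ge0 ?ltW.
rewrite ExD ?Ex_cst ?ExZ//; [|exact: L1Z|exact: L1_cst].
have H := linear_part_moment4 KS l2 idx_inj idx_gt0.
have l20 : 0 <= l%:R / 2 :> R by rewrite divr_ge0 ?ltW.
have := ler_wpM2l l20 H.
rewrite [X in _ <= X -> _](_ : _ = Kb / (2 * l%:R)); last by field; rewrite gt_eqF.
move=> {}H; rewrite [leRHS](_ : _ = Kb / (2 * l%:R) + (2 * l%:R)^-1).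
  exact: lerD.
by rewrite mulrDl mul1r.
Qed.

Let Kb0 : 0 <= Kb. Proof. exact: (block_const_ge0 KS). Qed.

Lemma L1_block_prod : L1 P (fun w => linear_part X h idx w * degen_part X h idx w).
Proof.
have [L2 D2 _ _] := L1_block_sqr.
have [mL _ _] := mom_linear_part KS idx_gt0.
have [mD _ _] := mom_degen_part KS l2 idx_inj idx_gt0.
apply: (L1_dom (g := fun w => linear_part X h idx w ^+ 2 + degen_part X h idx w ^+ 2)).
- exact: measurable_funM.
- move=> w; move: (linear_part _ _ _ _) (degen_part _ _ _ _) => x y.
  by rewrite ler_norml; apply/andP; split; nra.
- exact: L1D.
Qed.

(** The linear part has exactly the variance of a partial sum. The cross term is
    split by Cauchy-Schwarz with weight $\sqrt l$, since the degenerate part is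
    smaller than the linear part by that factor; this is what limits the rate. *)
Lemma block_second_moment (e : nat) : (forall j, idx j = (e + j)%N) ->
  `|l%:R * Ex P (fun w => (pair_mean X h idx w - theta) ^+ 2)
    - 4 * (cov_sum autocov l / l%:R)| <= (3 * Kb + 1) / Num.sqrt l%:R.
Proof.
move=> idxE; have [L2 D2 _ _] := L1_block_sqr; have LD := L1_block_prod.
have lam : 0 < l%:R :> R by move: (lR) => ?; lra.
rewrite (@Ex_ext _ _ _ _ _ (fun w => linear_part X h idx w ^+ 2 +
    (2 * (linear_part X h idx w * degen_part X h idx w) + degen_part X h idx w ^+ 2))); last first.
  by move=> w; rewrite (hoeffding_decomposition X h idx w l2); ring.
have L2LD : L1 P (fun w => 2 * (linear_part X h idx w * degen_part X h idx w)) by exact: L1Z.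
have Lrest := L1D L2LD D2.
rewrite ExD//.
have -> : Ex P (fun w => linear_part X h idx w ^+ 2) = 4 / l%:R ^+ 2 * cov_sum autocov l.
  have L1c i j : L1 P (fun w => hh (X (idx i) w) * hh (X (idx j) w)).
    by have [] := mom_L1 (ltW q1) (mom_q (mom_hh (idx_gt0 i)) (mom_hh (idx_gt0 j))).
  rewrite (@Ex_ext _ _ _ _ _ (fun w => 4 / l%:R ^+ 2 *
     \sum_(i < l) \sum_(j < l) hh (X (idx i) w) * hh (X (idx j) w))); last first.
    move=> w; rewrite /linear_part exprMn expr_div_n (_ : 2 ^+ 2 = 4); last by ring.
    congr (_ * _); rewrite /sum_h1 expr2 mulr_suml; apply: eq_bigr => i _.
    by rewrite mulr_sumr.
  rewrite ExZ; last by apply: L1_sum => i _; apply: L1_sum => j _; exact: L1c.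
  congr (_ * _); rewrite Ex_sum; last by move=> i _; apply: L1_sum => j _; exact: L1c.
  apply: eq_bigr => i _; rewrite Ex_sum; last by move=> j _; exact: L1c.
  apply: eq_bigr => j _; rewrite (cov_h1 (idx_gt0 i) (idx_gt0 j)) !idxE.
  by rewrite /dist_nat !subnDl.
set r := Ex P (fun w => _ + _).
rewrite [X in `|X|](_ : _ = l%:R * r); last by field; rewrite gt_eqF.
set t := Num.sqrt l%:R; have t0 : 0 < t by rewrite sqrtr_gt0.
have tl : t ^+ 2 = l%:R by rewrite sqr_sqrtr// ltW.
have t1 : 1 <= t.
  by rewrite -(ler_pXn2r (_ : (0 < 2)%N)) ?nnegrE ?ltW// tl expr1n; move: (lR) => ?; lra.
have rb : `|r| <= t^-1 * ((Kb + 1) / (2 * l%:R)) + (t + 1) * (Kb / l%:R ^+ 2).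
  apply: (@le_trans _ _ (Ex P (fun w => t^-1 * linear_part X h idx w ^+ 2 +
                                        (t + 1) * degen_part X h idx w ^+ 2))).
    apply: le_trans (norm_Ex Lrest) _; apply: le_Ex.
    - exact: L1_norm.
    - by apply: L1D; exact: L1Z.
    - move=> w; move: (linear_part _ _ _ _) (degen_part _ _ _ _) => x y.
      have H z : 2 * (x * z) <= t^-1 * x ^+ 2 + t * z ^+ 2.
        rewrite -subr_ge0 [X in 0 <= X](_ : _ = (x - t * z) ^+ 2 / t); last by field; rewrite gt_eqF.
        by rewrite divr_ge0 ?sqr_ge0 ?ltW.
      have := H y; have := H (- y); rewrite sqrrN mulrN => h1 h2.
      have y2 := sqr_ge0 y.
      by rewrite ler_norml; apply/andP; split; lra.
  rewrite ExD ?ExZ//; [|exact: L1Z|exact: L1Z].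
  apply: lerD.
    rewrite ler_wpM2l//; first by rewrite invr_ge0 ltW.
    exact: linear_part_moment2.
  rewrite ler_wpM2l//; first by rewrite addr_ge0 ?ltW.
  exact: (degen_part_moment2 KS).
rewrite normrM (gtr0_norm lam).
apply: le_trans (ler_wpM2l (ltW lam) rb) _.
rewrite -tl -subr_ge0 [X in 0 <= X](_ : _ =
  (Kb * (3 / 2 * t - 1) + t / 2) / t ^+ 2); last by field; rewrite gt_eqF.
apply: divr_ge0; last exact: sqr_ge0.
apply: addr_ge0; last by lra.
by apply: mulr_ge0; [exact: Kb0|lra].
Qed.

End OneBlock.
End BlockVariance.
(** * Averages over blocks *)

Lemma sum_irregular (R : numDomainType) (N : nat) (regular : pred 'I_N) :
  \sum_i (~~ regular i)%:R = #|predC regular|%:R :> R.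
Proof.
by rewrite -natr_sum -sum1_card [in RHS]big_mkcond.
Qed.

Section MeanVariance.
Context (d : measure_display) (Omega : measurableType d) (R : realType)
  (P : probability Omega R).
Variables (N L : nat) (regular : pred 'I_N) (Y : 'I_N -> Omega -> R) (c c' : R).
Hypotheses (N0 : (0 < N)%N) (L0 : (0 < L)%N)
  (irregular : (#|predC regular| <= L)%N)
  (mY : forall i, measurable_fun setT (Y i))
  (L1Y2 : forall i, L1 P (fun w => Y i w ^+ 2))
  (Y2 : forall i, Ex P (fun w => Y i w ^+ 2) <= c)
  (covY : forall i j : 'I_N, regular i -> regular j -> (i + 2 * L < j)%N ->
    `|Ex P (fun w => Y i w * Y j w) - Ex P (Y i) * Ex P (Y j)| <=
      c' * (L%:R / (dist_nat i j)%:R) ^+ 2).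

Let L1YY i j : L1 P (fun w => Y i w * Y j w).
Proof.
apply: (L1_dom (g := fun w => Y i w ^+ 2 + Y j w ^+ 2)).
- exact: measurable_funM.
- move=> w; move: (Y i w) (Y j w) => x y.
  by rewrite ler_norml; apply/andP; split; nra.
- exact: L1D.
Qed.

Let L1Y i : L1 P (Y i).
Proof.
apply: (L1_dom (g := fun w => Y i w ^+ 2 + 1)); first exact: mY.
- move=> w; move: (Y i w) => x.
  by rewrite ler_norml; apply/andP; split; nra.
- by apply: L1D; [exact: L1Y2|exact: L1_cst].
Qed.

Let cov i j := Ex P (fun w => Y i w * Y j w) - Ex P (Y i) * Ex P (Y j).

Let cov_sym i j : cov i j = cov j i.
Proof.
rewrite /cov mulrC; congr (_ - _); apply: Ex_ext => w; exact: mulrC.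
Qed.

Let c0 : 0 <= c.
Proof.
apply: le_trans (Y2 (Ordinal N0)); apply: Ex_ge0 => w; exact: sqr_ge0.
Qed.

Let Ex_sqr i : Ex P (Y i) ^+ 2 <= c.
Proof.
by apply: le_trans (Y2 i); exact: sqr_Ex_le.
Qed.

Let cov_le i j : `|cov i j| <= 2 * c.
Proof.
have H1 : `|Ex P (fun w => Y i w * Y j w)| <= c.
  apply: le_trans (norm_Ex (L1YY i j)) _.
  apply: (@le_trans _ _ (Ex P (fun w => 2^-1 * Y i w ^+ 2 + 2^-1 * Y j w ^+ 2))).
    apply: le_Ex.
    - exact: L1_norm.
    - by apply: L1D; apply: L1Z; exact: L1Y2.
    - move=> w; move: (Y i w) (Y j w) => x y.
      have := sqr_ge0 (x - y); have := sqr_ge0 (x + y).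
      rewrite sqrrD sqrrB ler_norml -[x * y *+ 2]mulr_natl => u v.
      by apply/andP; split; lra.
  rewrite (ExD (L1Z _ (L1Y2 i)) (L1Z _ (L1Y2 j))) (ExZ _ (L1Y2 i)) (ExZ _ (L1Y2 j)).
  by have := Y2 i; have := Y2 j; move: (Ex P _) (Ex P _) => x y h1 h2; lra.
have H2 : `|Ex P (Y i) * Ex P (Y j)| <= c.
  have := Ex_sqr i; have := Ex_sqr j; move: (Ex P _) (Ex P _) => x y h1 h2.
  by rewrite ler_norml; apply/andP; split; nra.
by apply: le_trans (ler_normB _ _) _; lra.
Qed.

Let c'0 (i j : 'I_N) : regular i -> regular j -> (i + 2 * L < j)%N -> 0 <= c'.
Proof.
move=> ri rj ij; have := le_trans (normr_ge0 _) (covY ri rj ij).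
rewrite pmulr_lge0// exprn_gt0// divr_gt0 ?ltr0n// /dist_nat; lia.
Qed.

(* Comparable with (L/r)^2 for r > L, but bounded and summable from r = 0. *)
Let weight (r : nat) : R := (L%:R / (L + r)%:R) ^+ 2.

Let weight_ge0 r : 0 <= weight r. Proof. exact: sqr_ge0. Qed.

Let sum_weight n : \sum_(r < n) weight r <= 2 * L%:R.
Proof.
have LR : 0 < L%:R :> R by rewrite ltr0n.
have H k : \sum_(r < k) ((L + r)%:R ^+ 2)^-1 <= 2 / L%:R - 2 / (L + k)%:R :> R.
  elim: k => [|k IH]; first by rewrite big_ord0 addn0 subrr.
  rewrite big_ord_recr/=; apply: le_trans (lerD IH (lexx _)) _.
  have -> : (L + k.+1)%:R = (L + k)%:R + 1 :> R by rewrite addnS natr1.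
  have : 1 <= (L + k)%:R :> R by rewrite ler1n addn_gt0 L0.
  move: {IH} ((L + k)%:R : R) (2 / L%:R) => x y x1.
  rewrite -subr_ge0 [X in 0 <= X](_ : _ = (x - 1) / (x ^+ 2 * (x + 1))); last first.
    by field; apply/andP; split; lra.
  by rewrite divr_ge0 ?mulr_ge0 ?sqr_ge0//; lra.
rewrite (eq_bigr (fun r : 'I_n => L%:R ^+ 2 * ((L + r)%:R ^+ 2)^-1)); last first.
  by move=> r _; rewrite /weight expr_div_n.
rewrite -mulr_sumr; apply: (@le_trans _ _ (L%:R ^+ 2 * (2 / L%:R))).
  rewrite ler_wpM2l ?sqr_ge0//; apply: le_trans (H n) _.
  by rewrite gerBl divr_ge0.
by rewrite le_eqVlt; apply/orP; left; apply/eqP; field; rewrite gt_eqF.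
Qed.

Let K := 5 * c + `|c'|.

Let cov_regular i j : regular i -> regular j -> `|cov i j| <= K * (4 * weight (dist_nat i j)).
Proof.
move=> ri rj; have LR : 1 <= L%:R :> R by rewrite ler1n.
have near_case : (dist_nat i j <= 2 * L)%N -> `|cov i j| <= K * (4 * weight (dist_nat i j)).
  move=> rL; apply: le_trans (cov_le i j) _.
  have : 4 / 9 <= 4 * weight (dist_nat i j).
    rewrite [4 / 9](_ : _ = 4 * (1 / 3) ^+ 2); last by field.
    rewrite ler_wpM2l//; apply: lerXn2r; rewrite ?nnegrE ?divr_ge0//.
    rewrite ler_pdivlMr ?ltr0n ?addn_gt0 ?L0// mul1r ler_pdivrMl//.
    by rewrite -natrM ler_nat; lia.
  by move: (4 * weight _) => t t1; rewrite /K; have := normr_ge0 c'; have := c0; nra.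
have far_case i' j' : regular i' -> regular j' -> (i' + 2 * L < j')%N ->
    `|cov i' j'| <= K * (4 * weight (dist_nat i' j')).
  move=> ri' rj' ij; apply: le_trans (covY ri' rj' ij) _.
  have c'p := c'0 ri' rj' ij.
  have -> : 4 * weight (dist_nat i' j') = (2 * (L%:R / (L + dist_nat i' j')%:R)) ^+ 2.
    by rewrite /weight exprMn; ring.
  set r := dist_nat i' j'; have Lr : (L < r)%N by rewrite /r /dist_nat; lia.
  have r0 : 0 < r%:R :> R by rewrite ltr0n (leq_ltn_trans _ Lr).
  have LrR : L%:R <= r%:R :> R by rewrite ler_nat ltnW.
  apply: ler_pM => //.
    by rewrite /K ger0_norm// lerDr mulr_ge0.
  apply: lerXn2r; rewrite ?nnegrE ?mulr_ge0 ?divr_ge0 ?(ltW r0)//.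
  rewrite mulrA ler_pdivrMr// mulrAC ler_pdivlMr; last by rewrite ltr0n addn_gt0 L0.
  by rewrite natrD; nra.
have [rL|rL] := leqP (dist_nat i j) (2 * L); first exact: near_case.
have [ij|ji] := leqP i j; first by apply: far_case => //; move: rL; rewrite /dist_nat; lia.
rewrite cov_sym (_ : dist_nat i j = dist_nat j i); last by rewrite /dist_nat addnC.
by apply: far_case => //; move: rL; rewrite /dist_nat; lia.
Qed.

Definition mean_dev (w : Omega) : R := N%:R^-1 * \sum_i (Y i w - Ex P (Y i)).

Let L1c i j : L1 P (fun w => (Y i w - Ex P (Y i)) * (Y j w - Ex P (Y j))).
Proof.
apply: (@L1_ext _ _ _ _ (fun w => (Y i w * Y j w + (- Ex P (Y j)) * Y i w) +
    ((- Ex P (Y i)) * Y j w + Ex P (Y i) * Ex P (Y j)))).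
  by move=> w; ring.
apply: L1D; first by apply: L1D; [exact: L1YY|exact: L1Z].
by apply: L1D; [exact: L1Z|exact: L1_cst].
Qed.

Let Ex_c i j : Ex P (fun w => (Y i w - Ex P (Y i)) * (Y j w - Ex P (Y j))) = cov i j.
Proof.
rewrite (@Ex_ext _ _ _ _ _ (fun w => (Y i w * Y j w + (- Ex P (Y j)) * Y i w) +
    ((- Ex P (Y i)) * Y j w + Ex P (Y i) * Ex P (Y j)))); last by move=> w; ring.
have A := L1Z (- Ex P (Y j)) (L1Y i); have B := L1Z (- Ex P (Y i)) (L1Y j).
rewrite (ExD (L1D (L1YY i j) A) (L1D B (L1_cst _ _))) (ExD (L1YY i j) A).
rewrite (ExD B (L1_cst _ _)) (ExZ _ (L1Y i)) (ExZ _ (L1Y j)) Ex_cst /cov.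
ring.
Qed.

Let sqr_mean_dev w : mean_dev w ^+ 2 =
  N%:R ^- 2 * \sum_i \sum_j (Y i w - Ex P (Y i)) * (Y j w - Ex P (Y j)).
Proof.
rewrite /mean_dev exprMn exprVn; congr (_ * _).
rewrite expr2 mulr_suml; apply: eq_bigr => i _.
by rewrite mulr_sumr.
Qed.

(** Each block is correlated with about L others, so that the average of N
    blocks has variance of order L/N. *)
Lemma mean_dev_moment2 : L1 P (fun w => mean_dev w ^+ 2) /\
  Ex P (fun w => mean_dev w ^+ 2) <= (16 * (5 * c + `|c'|) + 4 * c) * (L%:R / N%:R).
Proof.
have E : (fun w => mean_dev w ^+ 2) = fun w =>
    N%:R ^- 2 * \sum_i \sum_j (Y i w - Ex P (Y i)) * (Y j w - Ex P (Y j)).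
  by apply/funext => w; exact: sqr_mean_dev.
have LS i : L1 P (fun w => \sum_j (Y i w - Ex P (Y i)) * (Y j w - Ex P (Y j))).
  by apply: L1_sum => j _; exact: L1c.
have LSS : L1 P (fun w => \sum_i \sum_j (Y i w - Ex P (Y i)) * (Y j w - Ex P (Y j))).
  by apply: L1_sum => i _; exact: LS.
rewrite E; split; first exact: L1Z.
rewrite (ExZ _ LSS) Ex_sum; last by move=> i _; exact: LS.
have NR : 0 < N%:R :> R by rewrite ltr0n.
rewrite ler_pdivrMl ?exprn_gt0//.
apply: (@le_trans _ _ (\sum_(i : 'I_N) \sum_(j : 'I_N)
    (K * (4 * weight (dist_nat i j)) +
     ((~~ regular i)%:R + (~~ regular j)%:R) * (2 * c)))).
  apply: ler_sum => i _; rewrite Ex_sum; last by move=> j _; exact: L1c.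
  apply: ler_sum => j _; rewrite Ex_c; apply: le_trans (ler_norm _) _.
  have Kp : 0 <= K by rewrite /K addr_ge0 ?mulr_ge0.
  have k0 : 0 <= K * (4 * weight (dist_nat i j)).
    by apply: mulr_ge0 => //; apply: mulr_ge0 => //; exact: weight_ge0.
  have c2 : 0 <= 2 * c by rewrite mulr_ge0.
  case ri : (regular i) => /=; case rj : (regular j) => /=.
  - by rewrite addr0 mul0r addr0; exact: cov_regular.
  - by apply: le_trans (cov_le i j) _; rewrite add0r mul1r lerDr.
  - by apply: le_trans (cov_le i j) _; rewrite addr0 mul1r lerDr.
  - by apply: le_trans (cov_le i j) _; move: c2; move: (2 * c) => t c2; lra.
under eq_bigr => i _ do rewrite big_split/= -mulr_sumr -mulr_sumr -mulr_suml big_split/= sumr_const card_ord.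
rewrite big_split/= -mulr_suml big_split/=.
have irr : \sum_(i : 'I_N) (~~ regular i)%:R <= L%:R :> R.
  by rewrite sum_irregular ler_nat.
have W : \sum_(i : 'I_N) K * (4 * \sum_(j : 'I_N) weight (dist_nat i j)) <= N%:R * (K * (4 * (2 * (2 * L%:R)))).
  have -> : N%:R * (K * (4 * (2 * (2 * L%:R)))) = \sum_(i : 'I_N) K * (4 * (2 * (2 * L%:R))).
    by rewrite sumr_const card_ord mulr_natl.
  apply: ler_sum => i _; rewrite ler_wpM2l ?addr_ge0 ?mulr_ge0// ler_wpM2l//.
  by apply: sum_dist_le => //; exact: val_inj.
rewrite sumr_const card_ord.
have -> : \sum_(i : 'I_N) (~~ regular i)%:R *+ N = N%:R * \sum_(i : 'I_N) (~~ regular i)%:R :> R.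
  by rewrite mulr_sumr; apply: eq_bigr => i _; rewrite mulr_natl.
rewrite -[(\sum_(i : 'I_N) _) *+ N]mulr_natl.
apply: (@le_trans _ _ (N%:R * (K * (4 * (2 * (2 * L%:R)))) + (N%:R * L%:R + N%:R * L%:R) * (2 * c))).
  apply: lerD => //; rewrite ler_wpM2r ?mulr_ge0//.
  by apply: lerD; rewrite ler_wpM2l.
rewrite le_eqVlt; apply/orP; left; apply/eqP; rewrite /K; field.
by rewrite gt_eqF.
Qed.

End MeanVariance.
Section BlockAverages.
Context (d d' : measure_display) (Omega : measurableType d)
  (V : measurableType d') (R : realType) (P : probability Omega R)
  (X : nat -> {RV P >-> V}) (h : V -> V -> R) (q s C0 m : R) (g0 : nat).
Hypothesis KS : kernel_setting X h q s C0 m g0.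

Local Notation p := (4 * q).
Local Notation theta := (h_mean X h).
Local Notation Kb := (block_const X h q C0 m g0).

Let q1 : 1 < q. Proof. exact: (ks_q KS). Qed.
Let p1 : 1 < p. Proof. by move: (q1) => ?; lra. Qed.

Lemma sigma_of_mono (D D' : set nat) d1 (W : measurableType d1) (f : Omega -> W) :
  D `<=` D' ->
  @measurable_fun _ _ (g_sigma_algebraType (sigma_of D X)) W setT f ->
  @measurable_fun _ _ (g_sigma_algebraType (sigma_of D' X)) W setT f.
Proof.
move=> DD' mf _ A mA; have sF := sigma_of_sigma_algebra X.
have := mf measurableT A mA.
by rewrite (subfieldE (sF D)) (subfieldE (sF D')); exact: sigma_ofS.
Qed.

Section Measurability.
Variables (D : set nat) (l : nat) (idx : 'I_l -> nat).
Hypothesis idxD : forall j, D (idx j).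

Let mX j : @measurable_fun _ _ (g_sigma_algebraType (sigma_of D X)) V setT (X (idx j)).
Proof. exact: measurable_sigma_of. Qed.

Let measurable_double_sum (H : V -> V -> R) : measurable_fun setT (fun z : V * V => H z.1 z.2) ->
  @measurable_fun _ _ (g_sigma_algebraType (sigma_of D X)) R setT
    (fun w => \sum_(i < l) \sum_(j < l) (if i != j then H (X (idx i) w) (X (idx j) w) else 0)).
Proof.
move=> mH; apply: measurable_sum => i; apply: measurable_sum => j.
case: (i != j); last exact: measurable_cst.
exact: (measurableT_comp mH (measurable_fun_pair (mX i) (mX j))).
Qed.

Lemma measurable_pair_mean :
  @measurable_fun _ _ (g_sigma_algebraType (sigma_of D X)) R setT (pair_mean X h idx).
Proof.
by apply: measurable_funM => //; apply: measurable_double_sum; exact: (ks_meas KS).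
Qed.

Lemma measurable_degen_part :
  @measurable_fun _ _ (g_sigma_algebraType (sigma_of D X)) R setT (degen_part X h idx).
Proof.
apply: measurable_funM => //; apply: measurable_double_sum.
exact: (measurable_h2 KS).
Qed.

End Measurability.

(** Squares of functions with 4q moments have 2q moments, so that their product
    has the q moments needed for decoupling. *)
Lemma cov_sqr_le (k g : nat) (f f' : Omega -> R) c : (0 < k)%N -> (0 < g)%N ->
  @measurable_fun _ _ (g_sigma_algebraType (past X k)) R setT f ->
  @measurable_fun _ _ (g_sigma_algebraType (future X (k + g))) R setT f' ->
  mom P f p c -> mom P f' p c ->
  `|Ex P (fun w => f w ^+ 2 * f' w ^+ 2) - Ex P (fun w => f w ^+ 2) * Ex P (fun w => f' w ^+ 2)|
    <= decouple_const C0 g0 * (1 + 4 * c) / g%:R ^+ 3.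
Proof.
move=> k0 g1 mf mf' fM f'M; have sF := sigma_of_sigma_algebra X.
have q0 : 0 <= q by move: (q1) => ?; lra.
have q2 : 0 <= 2 * q by rewrite mulr_ge0.
have p2 : p = 2 * (2 * q) by ring.
have q2ge : 1 <= 2 * q by move: (q1) => ?; lra.
have sqM (e : Omega -> R) : mom P e p c -> mom P (fun w => e w ^+ 2) (2 * q) (2 * c).
  by rewrite p2 => eM; exact: (momM q2 eM eM).
have m4 : 2 * (2 * c) = 4 * c by ring.
have fs := sqM _ fM; have fs' := sqM _ f'M.
have md := momM q0 fs fs'; rewrite m4 in md.
have mp := momM q0 (mom_swap (mom_snd fs)) (mom_snd fs'); rewrite m4 /= in mp.
have mphi : @measurable_fun _ _
    (g_sigma_algebraType (rectangles (past X k) (future X (k + g)))) R setT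
    (fun z : Omega * Omega => f z.1 ^+ 2 * f' z.2 ^+ 2).
  apply: measurable_funM; apply: measurable_funX.
    exact: (measurable_rectangles_fst (sF _) (sF _) mf).
  exact: (measurable_rectangles_snd (sF _) (sF _) mf').
have := decouple (ks_q KS) (ks_qs KS) (ks_C0 KS) (ks_rate KS) k0 g1 mphi md mp.
rewrite [X in _ - X](_ : _ = Ex P (fun w => f w ^+ 2) * Ex P (fun w => f' w ^+ 2)); first exact.
have [Lp _] := mom_L1 (ltW q1) mp; have [Lf _] := mom_L1 q2ge fs; have [Lf' _] := mom_L1 q2ge fs'.
rewrite Ex_fubini//= -ExZ//; apply: Ex_ext => w /=.
rewrite mulrC -ExZ//; apply: Ex_ext => v; exact: mulrC.
Qed.

Section ManyBlocks.
Variables (N L step l : nat) (f : 'I_N -> Omega -> R) (regular : pred 'I_N) (cf c4 : R).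
Hypotheses (N0 : (0 < N)%N) (L0 : (0 < L)%N) (step0 : (0 < step)%N) (stepL : (step * L = l)%N)
  (irregular : (#|predC regular| <= L)%N)
  (fM : forall i, mom P (f i) p cf)
  (f4 : forall i, l%:R ^+ 2 * Ex P (fun w => f i w ^+ 4) <= c4)
  (f_meas : forall i : 'I_N, regular i -> @measurable_fun _ _
     (g_sigma_algebraType (sigma_of [set a | (step * i + 1 <= a <= step * i + l)%N] X))
     R setT (f i)).

(** Once j - i exceeds 2L, the gap between the blocks i and j is at least half of
    the distance step * (j - i) between their first indices. *)
Lemma sqr_mean_dev_moment2 :
  L1 P (fun w => mean_dev P (fun i w => l%:R * f i w ^+ 2) w ^+ 2) /\
  Ex P (fun w => mean_dev P (fun i w => l%:R * f i w ^+ 2) w ^+ 2) <=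
  (16 * (5 * c4 + `|8 * (decouple_const C0 g0 * (1 + 4 * cf))|) + 4 * c4) * (L%:R / N%:R).
Proof.
have mf i : measurable_fun setT (f i) by case: (fM i).
have [p2 p4] : 2%:R <= p /\ 4%:R <= p by move: (q1) => ?; split; lra.
have f4L i : L1 P (fun w => f i w ^+ 4) by have [] := mom_exprn p4 (fM i).
have f2L i : L1 P (fun w => f i w ^+ 2) by have [] := mom_exprn p2 (fM i).
have sqE i w : (l%:R * f i w ^+ 2) ^+ 2 = l%:R ^+ 2 * f i w ^+ 4 by ring.
apply: (mean_dev_moment2 N0 L0 irregular).
- by move=> i; apply: measurable_funM => //; exact: measurable_funX.
- by move=> i; apply: L1_ext (L1Z (l%:R ^+ 2) (f4L i)) => w; rewrite sqE.
- by move=> i; rewrite (@Ex_ext _ _ _ _ _ (fun w => l%:R ^+ 2 * f i w ^+ 4)) ?ExZ.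
move=> i j ri rj ij.
have l0 : (0 < l)%N by rewrite -stepL muln_gt0 step0.
pose r := dist_nat i j; have rE : r = (j - i)%N by rewrite /r /dist_nat; lia.
have r0 : (0 < r)%N by rewrite rE; lia.
have rL : (2 * L < r)%N by rewrite rE; lia.
have jE : (j : nat) = (i + r)%N by rewrite rE; lia.
pose k := (step * i + l)%N; pose g := (step * j + 1 - k)%N.
have kg : (k + g = step * j + 1)%N.
  rewrite subnKC// /k -stepL jE -mulnDr; apply: leq_trans (leq_addr _ _).
  by rewrite leq_mul2l; apply/orP; right; lia.
have gr : (step * r <= 2 * g)%N.
  have : (k + g = step * i + step * r + 1)%N by rewrite kg jE mulnDr.
  rewrite /k -stepL; have : (step * (2 * L) <= step * r)%N by rewrite leq_mul2l (ltnW rL) orbT.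
  lia.
have sr : (0 < step * r)%N by rewrite muln_gt0 step0.
have g_gt0 : (0 < g)%N by lia.
have k0 : (0 < k)%N by rewrite /k addn_gt0 l0 orbT.
have cov := @cov_sqr_le k g (f i) (f j) cf k0 g_gt0 _ _ (fM i) (fM j).
have {cov} : `|Ex P (fun w => f i w ^+ 2 * f j w ^+ 2) -
    Ex P (fun w => f i w ^+ 2) * Ex P (fun w => f j w ^+ 2)|
    <= decouple_const C0 g0 * (1 + 4 * cf) / g%:R ^+ 3.
  apply: cov.
    by apply: sigma_of_mono (f_meas ri) => a /=; rewrite /k; lia.
  by apply: sigma_of_mono (f_meas rj) => a /=; rewrite kg; lia.
have f22 : L1 P (fun w => f i w ^+ 2 * f j w ^+ 2).
  apply: (L1_dom (g := fun w => f i w ^+ 4 + f j w ^+ 4)).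
  - by apply: measurable_funM; exact: measurable_funX.
  - move=> w; rewrite ger0_norm; last by apply: mulr_ge0; exact: sqr_ge0.
    rewrite (exprM _ 2 2) (exprM (f j w) 2 2); move: (f i w ^+ 2) (f j w ^+ 2) => x y.
    have := sqr_ge0 (x - y); have := sqr_ge0 (x + y).
    by rewrite sqrrD sqrrB -[x * y *+ 2]mulr_natl; lra.
  - exact: L1D.
rewrite (@Ex_ext _ _ _ P (fun w => l%:R * f i w ^+ 2 * (l%:R * f j w ^+ 2))
   (fun w => l%:R ^+ 2 * (f i w ^+ 2 * f j w ^+ 2))); last by move=> w; ring.
rewrite (ExZ _ f22) (ExZ _ (f2L i)) (ExZ _ (f2L j)).
set E2 := Ex P (fun w => f i w ^+ 2 * _); set Ei := Ex P (fun w => f i w ^+ 2); set Ej := Ex P (fun w => f j w ^+ 2) => H.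
rewrite [X in `|X|](_ : _ = l%:R ^+ 2 * (E2 - Ei * Ej)); last by ring.
rewrite normrM (ger0_norm (sqr_ge0 _)).
apply: le_trans (ler_wpM2l (sqr_ge0 _) H) _.
have cf0 := mom_ge0 (fM i).
have D0 : 0 <= decouple_const C0 g0 * (1 + 4 * cf).
  have := decouple_const_ge1 g0 (ks_C0 KS) => D1.
  by apply: mulr_ge0; lra.
move: (decouple_const C0 g0 * _) D0 => D D0.
rewrite -/r [leLHS](_ : _ = D * (l%:R ^+ 2 / g%:R ^+ 3)); last by ring.
rewrite [leRHS](_ : _ = D * (8 * (L%:R / r%:R) ^+ 2)); last by ring.
rewrite ler_wpM2l// ler_pdivrMr ?exprn_gt0 ?ltr0n//.
have gR : (step * r)%:R ^+ 3 <= 8 * g%:R ^+ 3 :> R.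
  rewrite [leRHS](_ : _ = (2 * g%:R) ^+ 3); last by ring.
  by apply: lerXn2r; rewrite ?nnegrE ?mulr_ge0// -natrM ler_nat.
rewrite -stepL [leRHS](_ : _ = (L%:R / r%:R) ^+ 2 * (8 * g%:R ^+ 3)); last by ring.
apply: le_trans (ler_wpM2l (sqr_ge0 _) gR).
have rR : 0 < r%:R :> R by rewrite ltr0n.
rewrite !natrM [leRHS](_ : _ = (step%:R * L%:R) ^+ 2 * (step%:R * r%:R)); last by field; rewrite gt_eqF.
by rewrite ler_peMr ?sqr_ge0// -natrM ler1n.
Qed.

End ManyBlocks.
End BlockAverages.
(** * Mean squared error of the block variance *)

Lemma mean_cst (R : numFieldType) (N : nat) (x : R) : (0 < N)%N ->
  N%:R^-1 * (x *+ N) = x.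
Proof. by move=> N0; rewrite -[x *+ N]mulr_natl mulKf// pnatr_eq0 -lt0n. Qed.

Lemma error_arith (R : realType) (c1 c2 c3 c4 K x r x1 x2 x3 x4 x5 : R) :
  x1 <= c1 * r -> x2 <= c2 * r -> x3 <= K * r -> x4 <= 2 * c3 * (x + r) ->
  x5 <= c4 * x -> 0 <= c1 * x -> 0 <= c2 * x -> 0 <= K * x -> 0 <= c4 * r ->
  3 * (x1 + (x4 + 16 * x5) + (8 * x3 + 16 * x2)) <=
  3 * (c1 + 2 * c3 + 8 * K + 16 * c2 + 16 * c4) * (x + r).
Proof. by move=> *; lra. Qed.

Lemma sqr_error_arith (R : realType) (x y z a b c : R) :
  z ^+ 2 <= 8 * a + 16 * b ^+ 2 + 16 * c ^+ 2 ->
  (x + y - z) ^+ 2 <= 3 * (x ^+ 2 + (y ^+ 2 + 16 * c ^+ 2) + (8 * a + 16 * b ^+ 2)).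
Proof.
move=> H; have := sqr_ge0 (x - y); have := sqr_ge0 (x + z); have := sqr_ge0 (y + z).
by rewrite !expr2 in H *; lra.
Qed.

Section BlockVarianceError.
Context (d d' : measure_display) (Omega : measurableType d)
  (V : measurableType d') (R : realType) (P : probability Omega R)
  (X : nat -> {RV P >-> V}) (h : V -> V -> R) (q s C0 m : R) (g0 : nat).
Hypothesis KS : kernel_setting X h q s C0 m g0.

Local Notation p := (4 * q).
Local Notation theta := (h_mean X h).
Local Notation Kb := (block_const X h q C0 m g0).

Let q1 : 1 < q. Proof. exact: (ks_q KS). Qed.
Let p1 : 1 < p. Proof. by move: (q1) => ?; lra. Qed.
Let Kb0 : 0 <= Kb. Proof. exact: (block_const_ge0 KS). Qed.

Let c_auto : R := autocov_const X h q C0 m g0.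

Let c_auto0 : 0 <= c_auto.
Proof.
by have := autocov_le KS (isT : (0 < 1)%N); rewrite expr1n divr1; apply: le_trans.
Qed.

Section OneBlock.
Variables (l : nat) (idx : 'I_l -> nat).
Hypotheses (l2 : (2 <= l)%N) (idx_inj : injective idx)
  (idx_gt0 : forall j, (0 < idx j)%N).

Let lR : 2 <= l%:R :> R. Proof. by rewrite ler_nat. Qed.

Local Notation U := (fun w => pair_mean X h idx w - theta).

Lemma block_moment4 : l%:R ^+ 2 * Ex P (fun w => U w ^+ 4) <= 16 * Kb.
Proof.
have [_ _ A4 B4] := L1_block_sqr KS l2 idx_inj idx_gt0.
have l2R : 0 < l%:R ^+ 2 :> R by rewrite exprn_gt0// ltr0n; lia.
rewrite mulrC -ler_pdivlMr//.
apply: (@le_trans _ _ (Ex P (fun w => 8 * (linear_part X h idx w ^+ 4 + degen_part X h idx w ^+ 4)))).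
  have p4 : 4%:R <= p by move: (q1) => ?; lra.
  have [L4 _] := mom_exprn p4 (mom_block KS l2 idx_inj idx_gt0).
  apply: (le_Ex L4); first by apply: L1Z; exact: L1D.
  move=> w; rewrite (hoeffding_decomposition X h idx w l2).
  move: (linear_part _ _ _ _) (degen_part _ _ _ _) => x y.
  rewrite -subr_ge0 [X in 0 <= X](_ : _ = (x - y) ^+ 2 * (7 * x ^+ 2 + 10 * x * y + 7 * y ^+ 2)); last by ring.
  rewrite mulr_ge0 ?sqr_ge0//.
  have := sqr_ge0 (x + y); have := sqr_ge0 x; have := sqr_ge0 y.
  by rewrite sqrrD -[x * y *+ 2]mulr_natl; lra.
rewrite (ExZ _ (L1D A4 B4)) (ExD A4 B4).
have := linear_part_moment4 KS l2 idx_inj idx_gt0.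
have := degen_part_moment4 KS l2 idx_inj idx_gt0.
rewrite [16 * Kb / _](_ : _ = 16 * (Kb / l%:R ^+ 2)); last by ring.
by move: (Ex P _) (Ex P _) (Kb / _) => x y z xz yz; lra.
Qed.

Lemma block_moment2 : l%:R * Ex P (fun w => U w ^+ 2) <= 3 * Kb + 1.
Proof.
have [A2 B2 _ _] := L1_block_sqr KS l2 idx_inj idx_gt0.
have lp : 0 < l%:R :> R by rewrite ltr0n; lia.
apply: (@le_trans _ _ (l%:R * Ex P (fun w => 2 * (linear_part X h idx w ^+ 2 + degen_part X h idx w ^+ 2)))).
  have p2 : 2%:R <= p by move: (q1) => ?; lra.
  have [L2 _] := mom_exprn p2 (mom_block KS l2 idx_inj idx_gt0).
  apply: ler_wpM2l; first exact: ltW.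
  apply: (le_Ex L2); first by apply: L1Z; exact: L1D.
  move=> w; rewrite (hoeffding_decomposition X h idx w l2).
  move: (linear_part _ _ _ _) (degen_part _ _ _ _) => x y.
  have := sqr_ge0 (x - y); rewrite sqrrB sqrrD -[x * y *+ 2]mulr_natl; lra.
rewrite (ExZ _ (L1D A2 B2)) (ExD A2 B2).
have H1 := linear_part_moment2 KS l2 idx_inj idx_gt0.
have H2 := degen_part_moment2 KS l2 idx_inj idx_gt0.
apply: (@le_trans _ _ (l%:R * (2 * ((Kb + 1) / (2 * l%:R) + Kb / l%:R ^+ 2)))).
  apply: ler_wpM2l; first exact: ltW.
  by apply: ler_wpM2l => //; exact: lerD.
rewrite [leLHS](_ : _ = Kb + 1 + 2 / l%:R * Kb); last by field; rewrite gt_eqF.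
have : 2 / l%:R * Kb <= 2 * Kb.
  rewrite ler_wpM2r ?Kb0// ler_pdivrMr//; move: (lR) => ?; lra.
move: (2 / _ * Kb) => t; lra.
Qed.

(** The linear part is centred, so that the degenerate part alone is biased. *)
Lemma block_bias : Ex P U ^+ 2 <= Kb / l%:R ^+ 2.
Proof.
have LA := (mom_L1 (ltW p1) (mom_linear_part KS idx_gt0)).1.
have LB := (mom_L1 (ltW p1) (mom_degen_part KS l2 idx_inj idx_gt0)).1.
have [_ B2 _ _] := L1_block_sqr KS l2 idx_inj idx_gt0.
rewrite (@Ex_ext _ _ _ P _ (fun w => linear_part X h idx w + degen_part X h idx w)); last first.
  by move=> w; exact: hoeffding_decomposition.
rewrite (ExD LA LB).
have mh1 := measurable_h1 KS.
have LX j : L1 P (fun w => h1 X h (X (idx j) w)).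
  by have [] := mom_L1 (ltW p1) (mom_h1 KS (idx_gt0 j)).
have -> : Ex P (linear_part X h idx) = 0.
  rewrite /linear_part ExZ; last by apply: L1_sum => j _; exact: LX.
  rewrite /sum_h1 Ex_sum; last by move=> j _; exact: LX.
  rewrite big1 ?mulr0// => j _.
  rewrite (same_law_Ex (same_law_marginal (ks_stat KS) (idx_gt0 j)) mh1).
  exact: (Ex_h1 KS).
rewrite add0r; apply: le_trans (degen_part_moment2 KS l2 idx_inj idx_gt0).
exact: sqr_Ex_le.
Qed.

End OneBlock.

Let step_inj n : injective (fun j : 'I_n => (0 + 1 + j)%N).
Proof. by move=> i j /eqP; rewrite eqn_add2l => /eqP /val_inj. Qed.

Definition sample_variance n : R :=
  n%:R * (Ex P (fun w => (pair_mean X h (fun j : 'I_n => (0 + 1 + j)%N) w - theta) ^+ 2) -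
          Ex P (fun w => pair_mean X h (fun j : 'I_n => (0 + 1 + j)%N) w - theta) ^+ 2).

Definition bias_const : R := 7 * Kb + 2 + 64 * c_auto.

Let root_bounds (l : nat) : (2 <= l)%N ->
  [/\ 1 <= Num.sqrt (l%:R : R), Num.sqrt (l%:R : R) <= l%:R & Num.sqrt (l%:R : R) ^+ 2 = l%:R].
Proof.
move=> l2; have lR : 2 <= l%:R :> R by rewrite ler_nat.
set t := Num.sqrt _; have t0 : 0 <= t by exact: sqrtr_ge0.
have tl : t ^+ 2 = l%:R by rewrite sqr_sqrtr//; lra.
have t1 : 1 <= t by rewrite -(ler_pXn2r (_ : (0 < 2)%N)) ?nnegrE// tl expr1n; lra.
by split => //; rewrite -tl expr2 ler_peMr.
Qed.

(** Both sides are close to the long-run variance $4S(l)/l$, respectively $4S(n)/n$,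
    where S is the variance of the partial sums of h1. *)
Lemma block_variance_bias l n (idx : 'I_l -> nat) e : (2 <= l <= n)%N ->
  (forall j, idx j = (e + 1 + j)%N) ->
  `|l%:R * Ex P (fun w => (pair_mean X h idx w - theta) ^+ 2) - sample_variance n| <=
  bias_const / Num.sqrt l%:R.
Proof.
move=> /andP[l2 ln] idxE; have n2 := leq_trans l2 ln.
have idx_inj : injective idx.
  by move=> i j; rewrite !idxE => /eqP; rewrite eqn_add2l => /eqP /val_inj.
have idx_gt0 j : (0 < idx j)%N by rewrite idxE addn1.
have B1 := block_second_moment KS l2 idx_inj idx_gt0 idxE.
have B2 := block_second_moment KS n2 (@step_inj n) (fun=> isT) (fun=> erefl).
have B3 := block_bias n2 (@step_inj n) (fun=> isT).
have ln0 : (0 < l <= n)%N by rewrite ln andbT; lia.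
have B4 := cov_sum_rate (autocov_le KS) ln0.
rewrite -/c_auto in B4.
rewrite /sample_variance; move: B1 B2 B3 B4.
set E1 := Ex P _; set E2 := Ex P _; set E3 := Ex P _; set s1 := cov_sum _ l / _; set s2 := cov_sum _ n / _.
have [t1 tl tE] := root_bounds l2; have [u1 un uE] := root_bounds n2.
have tu : Num.sqrt l%:R <= Num.sqrt n%:R :> R by rewrite ler_wsqrtr// ler_nat.
move: t1 tl tE u1 un uE tu; set t := Num.sqrt (l%:R : R); set u := Num.sqrt (n%:R : R).
move=> t1 tl tE u1 un uE tu B1 B2 B3 B4.
have t0 : 0 < t by lra.
have u0 : 0 < u by lra.
have l0 : 0 < l%:R :> R by lra.
have n0 : 0 < n%:R :> R by lra.
have tn : t <= n%:R by lra.
have inv_le (c x : R) : 0 <= c -> t <= x -> c / x <= c / t.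
  by move=> c0 tx; rewrite ler_wpM2l// lef_pV2 ?posrE//; lra.
have K3 : 0 <= 3 * Kb + 1 by move: (Kb0) => ?; lra.
have {}B2 := le_trans B2 (inv_le _ _ K3 tu).
have c16 : 0 <= 16 * c_auto by move: (c_auto0) => ?; lra.
have {}B4 := le_trans B4 (inv_le _ _ c16 tl).
have {}B3 : n%:R * E3 ^+ 2 <= Kb / t.
  apply: le_trans (inv_le _ _ Kb0 tn).
  apply: le_trans (ler_wpM2l (ltW n0) B3) _.
  by rewrite le_eqVlt; apply/orP; left; apply/eqP; field; rewrite gt_eqF.
have B5 : 0 <= n%:R * E3 ^+ 2 by rewrite mulr_ge0 ?sqr_ge0 ?ltW.
rewrite [bias_const / t](_ : _ = (3 * Kb + 1) / t + (3 * Kb + 1) / t + 4 * (16 * c_auto / t) + Kb / t); last first.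
  by rewrite /bias_const; ring.
move: B1 B2 B3 B4 B5; rewrite !ler_norml mulrBr.
move: (_ / t) (_ / t) (_ / t) (l%:R * E1) (n%:R * E2) (n%:R * _) => a b c x y z.
move=> /andP[? ?] /andP[? ?] ? /andP[? ?] ?; apply/andP; split; lra.
Qed.

Lemma sample_variance_ge0_le n : (2 <= n)%N -> 0 <= sample_variance n <= 3 * Kb + 1.
Proof.
move=> n2; have n0 : 0 <= n%:R :> R by [].
have := block_moment2 n2 (@step_inj n) (fun=> isT).
rewrite /sample_variance.
set U := fun w => pair_mean X h _ w - theta.
have UM : mom P U p Kb by exact: (mom_block KS n2 (@step_inj n) (fun=> isT)).
have LU := (mom_L1 (ltW p1) UM).1.
have p2 : 2%:R <= p by move: (q1) => ?; lra.
have [L2 _] := mom_exprn p2 UM.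
have := sqr_Ex_le LU L2; rewrite -/(Ex P U) -/(Ex P (fun w => U w ^+ 2)).
move: (Ex P (fun w => U w ^+ 2)) (Ex P U ^+ 2) (sqr_ge0 (Ex P U)) => y z z0 zy yK.
rewrite mulr_ge0 ?subr_ge0//=; apply: le_trans yK; rewrite ler_wpM2l// gerBl//.
Qed.

Section ManyBlocks.
Variables (N L step l n : nat) (idx : 'I_N -> 'I_l -> nat) (regular : pred 'I_N).
Hypotheses (l2 : (2 <= l <= n)%N) (L0 : (0 < L)%N) (LN : (L <= N)%N)
  (stepL : (step * L = l)%N)
  (irregular : (#|predC regular| <= L)%N)
  (idx_inj : forall i, injective (idx i))
  (idx_gt0 : forall i j, (0 < idx i j)%N)
  (idx_regular : forall (i : 'I_N) j, regular i -> idx i j = (step * i + 1 + j)%N)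
  (cover : forall e : nat -> R,
     \sum_i \sum_j e (idx i j) = L%:R * \sum_(a < step * N) e (0 + 1 + a)%N).

Definition block_variance (w : Omega) : R :=
  l%:R * (N%:R^-1 * \sum_i (pair_mean X h (idx i) w - theta) ^+ 2 -
          (N%:R^-1 * \sum_i (pair_mean X h (idx i) w - theta)) ^+ 2).

Let dev_const (c c4 : R) : R :=
  16 * (5 * c4 + `|8 * (decouple_const C0 g0 * (1 + 4 * c))|) + 4 * c4.

Let dev_const_ge0 c c4 : 0 <= c4 -> 0 <= dev_const c c4.
Proof. by move=> c40; rewrite addr_ge0 ?mulr_ge0 ?addr_ge0 ?mulr_ge0. Qed.

Definition error_const : R :=
  3 * (dev_const Kb (16 * Kb) + 2 * bias_const ^+ 2 + 8 * Kb +
       16 * dev_const (degen_mom_const X h q C0 m g0) Kb + 16 * Kb ^+ 2).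

Let N0 : (0 < N)%N. Proof. exact: leq_trans L0 LN. Qed.
Let l_ge2 : (2 <= l)%N. Proof. by case/andP: l2. Qed.
Let step0 : (0 < step)%N.
Proof. by move: (stepL) (l_ge2); case: (step) => [|//]; rewrite mul0n => <-. Qed.

Local Notation U i := (fun w => pair_mean X h (idx i) w - theta).
Local Notation A i := (linear_part X h (idx i)).
Local Notation B i := (degen_part X h (idx i)).
Local Notation Abar := (linear_part X h (fun a : 'I_(step * N) => (0 + 1 + a)%N)).
Local Notation ratio := (L%:R / N%:R : R).

Let NR : 0 < N%:R :> R. Proof. by rewrite ltr0n. Qed.
Let lR : 0 < l%:R :> R. Proof. by rewrite ltr0n ltnW// l_ge2. Qed.
Let lV1 : l%:R^-1 <= 1 :> R. Proof. by rewrite invf_le1// ler1n ltnW// l_ge2. Qed.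

Let ratio01 : 0 <= ratio <= 1.
Proof. by rewrite divr_ge0//= ler_pdivrMr ?NR// mul1r ler_nat. Qed.

(* Averaging the linear parts over all blocks weighs every observation equally. *)
Let mean_linear w : N%:R^-1 * \sum_i A i w = Abar w.
Proof.
rewrite /linear_part -mulr_sumr /sum_h1.
rewrite (cover (fun a => h1 X h (X a w))) natrM -stepL natrM.
have [s0 L0R N0R] : [/\ step%:R != 0 :> R, L%:R != 0 :> R & N%:R != 0 :> R].
  by split; rewrite pnatr_eq0 -lt0n ?step0 ?L0 ?N0.
by field; rewrite s0 L0R N0R.
Qed.

Let idx_reg (i : 'I_N) j : regular i -> (step * i + 1 <= idx i j <= step * i + l)%N.
Proof. by move=> ri; rewrite idx_regular// leq_addr/= -addnA leq_add2l add1n. Qed.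

Let devU w := mean_dev P (fun i w => l%:R * (U i w) ^+ 2) w.
Let devB w := mean_dev P (fun i w => l%:R * (B i w) ^+ 2) w.

Let devU2 : L1 P (fun w => devU w ^+ 2) /\
  Ex P (fun w => devU w ^+ 2) <= dev_const Kb (16 * Kb) * ratio.
Proof.
apply: (sqr_mean_dev_moment2 KS N0 L0 step0 stepL irregular).
- by move=> i; exact: (mom_block KS).
- by move=> i; exact: block_moment4.
- move=> i ri; apply: measurable_funB => //; apply: (measurable_pair_mean KS) => j.
  exact: idx_reg.
Qed.

Let devB2 : L1 P (fun w => devB w ^+ 2) /\
  Ex P (fun w => devB w ^+ 2) <= dev_const (degen_mom_const X h q C0 m g0) Kb * ratio.
Proof.
apply: (sqr_mean_dev_moment2 KS N0 L0 step0 stepL irregular).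
- by move=> i; exact: (mom_degen_part KS).
- move=> i; rewrite mulrC -ler_pdivlMr ?exprn_gt0//.
  exact: (degen_part_moment4 KS).
- move=> i ri; apply: (measurable_degen_part KS) => j.
  exact: idx_reg.
Qed.

Let bias := N%:R^-1 * \sum_i (l%:R * Ex P (fun w => U i w ^+ 2) - sample_variance n).

Let biasE : bias ^+ 2 <= 2 * bias_const ^+ 2 * (l%:R^-1 + ratio).
Proof.
have bc : 6 * Kb + 2 <= bias_const.
  by rewrite /bias_const; move: (Kb0) (c_auto0) => ? ?; lra.
have bc0 : 0 <= bias_const by move: (Kb0) => ?; lra.
have [t1 tl tE] := root_bounds l_ge2.
move: t1 tl tE; set t := Num.sqrt (l%:R : R) => t1 tl tE.
have t0 : 0 < t by lra.
have Hb : `|bias| <= bias_const * (t^-1 + ratio).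
  rewrite /bias normrM gtr0_norm ?invr_gt0// ler_pdivrMl//.
  apply: le_trans (ler_norm_sum _ _ _) _.
  apply: (@le_trans _ _ (\sum_(i : 'I_N) (bias_const / t + (~~ regular i)%:R * bias_const))).
    apply: ler_sum => i _; case ri : (regular i).
      rewrite mul0r addr0.
      by apply: (block_variance_bias (e := (step * i)%N) l2) => j; exact: idx_regular.
    rewrite mul1r; apply: (@le_trans _ _ (6 * Kb + 2)); last first.
      by apply: le_trans bc _; rewrite lerDr; apply: divr_ge0 => //; exact: ltW.
    have := block_moment2 l_ge2 (@idx_inj i) (@idx_gt0 i).
    have n2 : (2 <= n)%N by case/andP: (l2) => a; exact: leq_trans a.
    have /andP[] := sample_variance_ge0_le n2.
    have : 0 <= l%:R * Ex P (fun w => U i w ^+ 2).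
      by rewrite mulr_ge0// Ex_ge0// => w; exact: sqr_ge0.
    move: (l%:R * _) (sample_variance n) => x y a b c e.
    by move: (Kb0) => ?; rewrite ler_norml; apply/andP; split; lra.
  rewrite big_split/= sumr_const card_ord -mulr_suml -[_ *+ N]mulr_natl.
  have irr : \sum_(i : 'I_N) (~~ regular i)%:R <= L%:R :> R.
    by rewrite sum_irregular ler_nat.
  rewrite [leRHS](_ : _ = N%:R * (bias_const / t) + L%:R * bias_const); last first.
    by field; rewrite !gt_eqF.
  by rewrite lerD2l ler_wpM2r.
rewrite -[bias ^+ 2]real_normK ?num_real//; apply: (@le_trans _ _ ((bias_const * (t^-1 + ratio)) ^+ 2)).
  by apply: lerXn2r; rewrite ?nnegrE// mulr_ge0// addr_ge0 ?invr_ge0 ?(ltW t0)//; case/andP: (ratio01).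
rewrite exprMn (mulrC 2) -[leRHS]mulrA; apply: ler_wpM2l; first exact: sqr_ge0.
rewrite -tE.
have -> : (t ^+ 2)^-1 = t^-1 ^+ 2 by rewrite exprVn.
case/andP: (ratio01); move: (t^-1) ratio => x y y0 y1.
have := sqr_ge0 (x - y); rewrite sqrrB sqrrD -[x * y *+ 2]mulr_natl.
by nra.
Qed.

Let NV0 : 0 <= N%:R^-1 :> R. Proof. by rewrite invr_ge0 ltW. Qed.

Let L1U2 i : L1 P (fun w => U i w ^+ 2).
Proof.
have p2 : 2%:R <= p by move: (q1) => ?; lra.
by have [] := mom_exprn p2 (mom_block KS l_ge2 (@idx_inj i) (@idx_gt0 i)).
Qed.

Let block_varianceE w : block_variance w - sample_variance n =
  devU w + bias - l%:R * (N%:R^-1 * \sum_i U i w) ^+ 2.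
Proof.
have -> : devU w + bias = l%:R * (N%:R^-1 * \sum_i U i w ^+ 2) - sample_variance n.
  rewrite /devU /bias /mean_dev -mulrDr -big_split/=.
  rewrite (eq_bigr (fun i => l%:R * U i w ^+ 2 - sample_variance n)); last first.
    by move=> i _; rewrite (ExZ _ (L1U2 i)); ring.
  rewrite sumrB sumr_const card_ord -mulr_sumr mulrBr mulrCA; congr (_ - _).
  exact: mean_cst.
by rewrite /block_variance; ring.
Qed.

Let bB := N%:R^-1 * \sum_i l%:R * Ex P (fun w => B i w ^+ 2).

Let bBE : 0 <= bB <= Kb / l%:R.
Proof.
apply/andP; split.
  apply: mulr_ge0 => //; apply: sumr_ge0 => i _; apply: mulr_ge0; first exact: ltW.
  by apply: Ex_ge0 => w; exact: sqr_ge0.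
apply: (@le_trans _ _ (N%:R^-1 * \sum_(i < N) (Kb / l%:R))); last first.
  by rewrite sumr_const card_ord mean_cst.
apply: ler_wpM2l => //.
apply: ler_sum => i _; have := degen_part_moment2 KS l_ge2 (@idx_inj i) (@idx_gt0 i) => H.
apply: le_trans (ler_wpM2l (ltW lR) H) _.
by rewrite le_eqVlt; apply/orP; left; apply/eqP; field; rewrite gt_eqF.
Qed.

Let sqr_meanU w : (l%:R * (N%:R^-1 * \sum_i U i w) ^+ 2) ^+ 2 <=
  8 * (l%:R ^+ 2 * Abar w ^+ 4) + 16 * devB w ^+ 2 + 16 * bB ^+ 2.
Proof.
have -> : N%:R^-1 * \sum_i U i w = Abar w + N%:R^-1 * \sum_i B i w.
  rewrite -mean_linear -mulrDr -big_split/=; congr (_ * _); apply: eq_bigr => i _.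
  exact: hoeffding_decomposition.
have jensen : l%:R * (N%:R^-1 * \sum_i B i w) ^+ 2 <= devB w + bB.
  have -> : devB w + bB = l%:R * (N%:R^-1 * \sum_i B i w ^+ 2).
    rewrite /devB /bB /mean_dev -mulrDr -big_split/= [RHS]mulrCA; congr (_ * _).
    rewrite mulr_sumr; apply: eq_bigr => i _.
    have p2 : 2%:R <= p by move: (q1) => ?; lra.
    have [L2 _] := mom_exprn p2 (mom_degen_part KS l_ge2 (@idx_inj i) (@idx_gt0 i)).
    by rewrite (ExZ _ L2) subrK.
  apply: ler_wpM2l; first exact: ltW.
  set a := N%:R^-1 * \sum_i B i w.
  have : 0 <= N%:R^-1 * \sum_i (B i w - a) ^+ 2.
    by apply: mulr_ge0 => //; apply: sumr_ge0 => i _; exact: sqr_ge0.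
  rewrite (eq_bigr (fun i => B i w ^+ 2 + (- 2 * a) * B i w + a ^+ 2)); last by move=> i _; ring.
  rewrite !big_split/= -mulr_sumr sumr_const card_ord.
  rewrite !mulrDr mean_cst// mulrCA -/a.
  by move: (N%:R^-1 * _) => x; nra.
have sq0 (x : R) : 0 <= l%:R * x ^+ 2 by apply: mulr_ge0; [exact: ltW|exact: sqr_ge0].
have dB0 := sq0 (N%:R^-1 * \sum_i B i w); have Ha0 := sq0 (Abar w).
rewrite (_ : l%:R ^+ 2 * Abar w ^+ 4 = (l%:R * Abar w ^+ 2) ^+ 2); last by ring.
have H1 : l%:R * (Abar w + N%:R^-1 * \sum_i B i w) ^+ 2 <=
    2 * (l%:R * Abar w ^+ 2) + 2 * (l%:R * (N%:R^-1 * \sum_i B i w) ^+ 2).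
  rewrite (mulrCA 2) (mulrCA 2 l%:R) -mulrDr; apply: ler_wpM2l; first exact: ltW.
  move: (Abar w) (_ * _) => x y; have := sqr_ge0 (x - y).
  by rewrite sqrrB sqrrD -[x * y *+ 2]mulr_natl; lra.
have H0 := sq0 (Abar w + N%:R^-1 * \sum_i B i w).
move: H0 H1 Ha0 jensen dB0.
set a := Abar w; set b' := N%:R^-1 * _.
move: (l%:R * (a + b') ^+ 2) (l%:R * a ^+ 2) (l%:R * b' ^+ 2) (devB w) bB => z x y b c.
move=> z0 H1 x0 H2 y0.
apply: (@le_trans _ _ ((2 * x + 2 * (b + c)) ^+ 2)).
  by apply: lerXn2r; rewrite ?nnegrE//; lra.
have := sqr_ge0 (2 * x - 2 * (b + c)); have := sqr_ge0 (b - c).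
by rewrite !expr2; lra.
Qed.

Let Abar4 : L1 P (fun w => Abar w ^+ 4) /\
  l%:R ^+ 2 * Ex P (fun w => Abar w ^+ 4) <= Kb * ratio.
Proof.
have M2 : (2 <= step * N)%N.
  by apply: leq_trans l_ge2 _; rewrite -stepL leq_mul2l LN orbT.
have Minj := @step_inj (step * N).
have [_ _ L4 _] := L1_block_sqr KS M2 Minj (fun=> isT).
split => //.
have := linear_part_moment4 KS M2 Minj (fun=> isT) => H.
have l20 : 0 <= l%:R ^+ 2 :> R by exact: sqr_ge0.
apply: le_trans (ler_wpM2l l20 H) _.
have [s0 L0R N0R] : [/\ step%:R != 0 :> R, L%:R != 0 :> R & N%:R != 0 :> R].
  by split; rewrite pnatr_eq0 -lt0n ?step0 ?L0 ?N0.
rewrite -stepL !natrM [leLHS](_ : _ = Kb * ratio ^+ 2); last by field; rewrite s0 N0R.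
rewrite ler_wpM2l ?Kb0//; case/andP: (ratio01); move: ratio => x x0 x1.
by rewrite expr2 ler_piMr.
Qed.

Lemma measurable_block_variance : measurable_fun setT block_variance.
Proof.
have mU i : measurable_fun setT (U i).
  by case: (mom_block KS l_ge2 (@idx_inj i) (@idx_gt0 i)).
apply: measurable_funM => //; apply: measurable_funB.
  apply: measurable_funM => //; apply: measurable_sum => i; exact: measurable_funX.
by apply: measurable_funX; apply: measurable_funM => //; exact: measurable_sum.
Qed.

(** With U the centred block statistics, the error is the sum of the deviation of
    the average of $lU^2$ from its mean, of the bias, and of minus
    $l\bar U^2$. In the last term the average of the linear parts is the linear
    part of the whole sample, and the average of the degenerate parts is
    controlled by the average of their squares. *)
Lemma block_variance_error :
  L1 P (fun w => (block_variance w - sample_variance n) ^+ 2) /\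
  Ex P (fun w => (block_variance w - sample_variance n) ^+ 2) <=
  error_const * (l%:R^-1 + ratio).
Proof.
have [LU EU] := devU2; have [LB EB] := devB2; have [LA EA] := Abar4.
pose D w := 3 * (devU w ^+ 2 + (bias ^+ 2 + 16 * bB ^+ 2) +
                 (8 * l%:R ^+ 2 * Abar w ^+ 4 + 16 * devB w ^+ 2)).
have LU' := L1D LU (L1_cst P (bias ^+ 2 + 16 * bB ^+ 2)).
have LAB := L1D (L1Z (8 * l%:R ^+ 2) LA) (L1Z 16 LB).
have LD : L1 P D by apply: L1Z; exact: L1D.
have le w : (block_variance w - sample_variance n) ^+ 2 <= D w.
  rewrite block_varianceE /D; have := sqr_meanU w.
  by rewrite -mulrA; exact: sqr_error_arith.
have LV : L1 P (fun w => (block_variance w - sample_variance n) ^+ 2).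
  apply: (L1_dom (g := D)) => //; first by apply: measurable_funX; exact: (measurable_funB measurable_block_variance).
  by move=> w; rewrite ger0_norm ?sqr_ge0.
split => //; apply: le_trans (le_Ex LV LD le) _.
rewrite /D (ExZ _ (L1D LU' LAB)) (ExD LU' LAB) (ExD LU (L1_cst P _)) Ex_cst.
rewrite (ExD (L1Z _ LA) (L1Z 16 LB)) (ExZ _ LA) (ExZ _ LB) -mulrA.
have bB2 : bB ^+ 2 <= Kb ^+ 2 * l%:R^-1.
  case/andP: bBE => b0 b1; apply: (@le_trans _ _ ((Kb / l%:R) ^+ 2)).
    by apply: lerXn2r; rewrite ?nnegrE// (le_trans b0 b1).
  rewrite exprMn ler_wpM2l ?sqr_ge0// expr2.
  by apply: ler_piMr => //; rewrite invr_ge0 ltW.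
have bE := biasE.
rewrite /error_const.
have l0 : 0 <= l%:R^-1 :> R by rewrite invr_ge0 ltW.
case/andP: (ratio01) => r0 _.
have d1 := mulr_ge0 (dev_const_ge0 Kb (mulr_ge0 (ler0n R 16) Kb0)) l0.
have d2 := mulr_ge0 (dev_const_ge0 (degen_mom_const X h q C0 m g0) Kb0) l0.
have d3 := mulr_ge0 Kb0 l0.
have d4 := mulr_ge0 (sqr_ge0 Kb) r0.
exact: (error_arith EU EB EA bE bB2 d1 d2 d3 d4).
Qed.

End ManyBlocks.
End BlockVarianceError.
(** * The two block schemes *)

Lemma sum_pairs_lt (R : nzRingType) (H : nat -> nat -> R) (s l : nat) :
  (forall a b, H a b = H b a) ->
  2 * \sum_(s <= a < s + l) \sum_(s <= b < s + l | (a < b)%N) H a b =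
  \sum_(i < l) \sum_(j < l) (if i != j then H (s + i)%N (s + j)%N else 0).
Proof.
move=> sym; have E F : \sum_(s <= a < s + l) F a = \sum_(i < l) F (s + i)%N :> R.
  by rewrite -{1}[s]add0n [(s + l)%N]addnC big_addn addnK big_mkord; apply: eq_bigr => i _;
    rewrite addnC.
rewrite E (eq_bigr (fun i : 'I_l => \sum_(j < l) (if (i < j)%N then H (s + i)%N (s + j)%N else 0))); last first.
  by move=> i _; rewrite big_mkcond/= E; apply: eq_bigr => j _; rewrite ltn_add2l.
rewrite mulr_natl mulr2n [X in _ + X](exchange_big) -big_split/=; apply: eq_bigr => i _.
rewrite -big_split/=; apply: eq_bigr => j _.
by rewrite -val_eqE/= neq_ltn; case: ltngtP => _; rewrite ?addr0 ?add0r// sym.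
Qed.

Section Schemes.
Context (d d' : measure_display) (Omega : measurableType d)
  (V : measurableType d') (R : realType) (P : probability Omega R)
  (X : nat -> {RV P >-> V}) (h : V -> V -> R).
Hypothesis h_sym : forall x y, h x y = h y x.

Let half_sum (l : nat) (x : R) : (2 <= l)%N ->
  2 / (l * (l - 1))%:R * x = (l%:R * (l%:R - 1))^-1 * (2 * x).
Proof.
by move=> l2; rewrite natrM natrB ?(ltnW l2)// (mulrC 2) -mulrA.
Qed.

Lemma U_stat_pair_mean n w : (2 <= n)%N ->
  U_stat X h n w = pair_mean X h (fun j : 'I_n => (0 + 1 + j)%N) w.
Proof.
move=> n2; rewrite /U_stat half_sum// /pair_mean; congr (_ * _).
by apply: (@sum_pairs_lt _ (fun a b => h (X a w) (X b w)) 1 n) => a b.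
Qed.

Definition block_index (k : block_scheme) (n l i : nat) (j : 'I_l) : nat :=
  sample_index k n (block_start k l i.+1 + j).

Lemma block_U_pair_mean k n l i w : (2 <= l)%N ->
  block_U k X h n l i.+1 w = pair_mean X h (@block_index k n l i) w.
Proof.
move=> l2; rewrite /block_U half_sum// /pair_mean; congr (_ * _).
by apply: (@sum_pairs_lt _ (fun a b => h (X (sample_index k n a) w) (X (sample_index k n b) w))) => a b.
Qed.

End Schemes.

(** The number of consecutive blocks to which an observation belongs. *)
Definition overlap (k : block_scheme) (l : nat) : nat :=
  match k with circular => l | nonoverlapping => 1 end.

Definition step_size (k : block_scheme) (l : nat) : nat :=
  match k with circular => 1 | nonoverlapping => l end.

(** A circular block is contiguous unless it runs past the end of the sample. *)
Definition unwrapped (k : block_scheme) (n l i : nat) : bool :=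
  match k with circular => (i + l <= n)%N | nonoverlapping => true end.

Section BlockIndices.
Variables (k : block_scheme) (n l : nat).
Hypothesis l2 : (2 <= l <= n)%N.

Let l_gt0 : (0 < l)%N. Proof. by case/andP: l2 => a _; exact: ltnW. Qed.
Let ln : (l <= n)%N. Proof. by case/andP: l2. Qed.
Let n_gt0 : (0 < n)%N. Proof. exact: leq_trans ln. Qed.

Lemma overlap_gt0 : (0 < overlap k l)%N.
Proof. by case: k. Qed.

Lemma step_sizeM : (step_size k l * overlap k l = l)%N.
Proof. by case: k; rewrite /= ?mul1n ?muln1. Qed.

Lemma overlap_le : (overlap k l <= num_blocks k n l)%N.
Proof. by case: k => //=; rewrite divn_gt0. Qed.

(** Complete nonoverlapping blocks cover at least half of the sample. *)
Lemma overlap_ratio : (n * overlap k l <= 2 * l * num_blocks k n l)%N.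
Proof.
case: k => /=; first by rewrite mulnC leq_mul2r leq_pmull ?orbT.
rewrite muln1 {1}(divn_eq n l) mulnC -mulnA mul2n -addnn leq_add2l.
by apply: leq_trans (ltnW (ltn_pmod n l_gt0)) _; rewrite leq_pmulr// divn_gt0.
Qed.

Lemma unwrappedP i j : unwrapped k n l i ->
  @block_index k n l i j = (step_size k l * i + 1 + j)%N.
Proof.
rewrite /block_index; case: k => /=; last by rewrite subn1.
by move=> il; rewrite mul1n addn1 ifN// -leqNgt addSn; have := ltn_ord j; lia.
Qed.

Lemma card_wrapped :
  (#|predC (fun i : 'I_(num_blocks k n l) => unwrapped k n l i)| <= overlap k l)%N.
Proof.
case: k => /=; last by rewrite -sum1_card big_pred0.
rewrite -sum1_card (reindex_inj rev_ord_inj)/=.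
apply: (@leq_trans (\sum_(i < n | (i < l)%N) 1)).
  rewrite [leqLHS]big_mkcond [leqRHS]big_mkcond; apply: leq_sum => i _.
  rewrite inE/= -ltnNge; have := ltn_ord i; case: ifP => // il; case: ifP => // il'.
  by move=> ?; exfalso; move: il il'; lia.
by rewrite -(big_ord_widen n (fun=> 1%N) ln) sum1_card card_ord.
Qed.

Lemma block_index_inj (i : 'I_(num_blocks k n l)) : injective (@block_index k n l i).
Proof.
move=> a b; rewrite /block_index; have [al bl] := (ltn_ord a, ltn_ord b).
case: k i => /= i; last by move/eqP; rewrite eqn_add2l => /eqP/val_inj.
by have := ln; case: ifP => Ha; case: ifP => Hb ? E; apply: val_inj => /=; move: Ha Hb E; lia.
Qed.

Lemma block_index_gt0 i j : (0 < @block_index k n l i j)%N.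
Proof.
rewrite /block_index; case: k => /=; last by rewrite addn1.
by case: ifP => H; move: H; lia.
Qed.

Lemma block_index_le (i : 'I_(num_blocks k n l)) j : (@block_index k n l i j <= n)%N.
Proof.
rewrite /block_index; have jl := ltn_ord j; case: k i => /= i.
  have := ltn_ord i; move: (ln) jl; case: ifP => H; move: H; lia.
rewrite subn1/=; apply: (@leq_trans (l * i.+1)); first by rewrite mulnS; lia.
by apply: leq_trans (leq_trunc_div n l); rewrite mulnC leq_mul2r ltn_ord orbT.
Qed.

(** Each observation lies in the same number of blocks, except for those lost at
    the end of the sample when the blocks do not overlap. *)
Lemma sum_block_index (R : nzRingType) (e : nat -> R) :
  \sum_(i < num_blocks k n l) \sum_(j < l) e (@block_index k n l i j) =
  (overlap k l)%:R * \sum_(a < step_size k l * num_blocks k n l) e (0 + 1 + a)%N.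
Proof.
rewrite /block_index; case: k => /=; last first.
  rewrite mul1r; elim: (n %/ l)%N => [|N IH]; first by rewrite muln0 !big_ord0.
  rewrite big_ord_recr/= IH mulnS [(l + l * N)%N]addnC.
  rewrite big_split_ord/=; congr (_ + _); apply: eq_bigr => j _; congr e; rewrite subn1/=; lia.
rewrite mul1n exchange_big/= mulr_natl -[l in RHS]card_ord -sumr_const; apply: eq_bigr => j _.
pose r (i : 'I_n) := Ordinal (ltn_pmod (i + j) n_gt0).
have r_inj : injective r.
  move=> a b /(congr1 val)/= /eqP; rewrite eqn_modDr !modn_small// => /eqP; exact: val_inj.
rewrite [RHS](reindex_inj r_inj)/=; apply: eq_bigr => i _; congr e.
have jn : (j < n)%N := leq_trans (ltn_ord j) ln.
have [ijn|ijn] := ltnP (i + j) n; first by rewrite modn_small// addSn ltnNge ijn.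
rewrite addSn ltnS ijn -[in RHS](subnK ijn) modnDr modn_small; first by lia.
by have := ltn_ord i; lia.
Qed.

End BlockIndices.
(** * The conditional variance of the resampled statistic *)

Section IndependentFields.
Context (d : measure_display) (Omega : measurableType d) (R : realType)
  (P : probability Omega R).

Section Product.
Variables F G : set (set Omega).
Hypotheses (sF : sigma_algebra setT F) (sG : sigma_algebra setT G)
  (mF : F `<=` measurable) (mG : G `<=` measurable)
  (FG : independent_fields P F G).

Lemma independent_near_indep : near_indep P F G 0.
Proof.
exists (cst 0%E); split => //; first by rewrite integral0.
move=> A B FA GB; have [mA mB] := (mF FA, mG GB).
by rewrite FG// subee ?fin_numM ?fin_num_measure// abse0 integral0.
Qed.

(** Independence is near independence with defect 0; the truncation level is then
    arbitrary and the truncation error tends to 0. *)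
Lemma Ex_independent_indic (B : set Omega) (W : Omega -> R) r c : 1 < r -> F B ->
  @measurable_fun _ _ (g_sigma_algebraType G) R setT W -> mom P W r c ->
  Ex P (fun w => \1_B w * W w) = fine (P B) * Ex P W.
Proof.
move=> r1 FB mW WM; have mB := mF FB; have [mW' LWr EWr] := WM.
have r0 : 0 <= r by lra.
have [LW _] := mom_L1 (ltW r1) WM.
have ind1 w : `|\1_B w| <= 1 :> R.
  by rewrite indicE; case: (_ \in _); rewrite ?normr1 ?normr0.
have dom (T : Type) (f : T -> Omega) w (y : R) : `|\1_B w * y| <= `|y|.
  by rewrite normrM ler_piMl.
have mphi : @measurable_fun _ _ (g_sigma_algebraType (rectangles F G)) R setT
    (fun z : Omega * Omega => \1_B z.1 * W z.2).
  apply: measurable_funM.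
    have m1B : @measurable_fun _ _ (g_sigma_algebraType F) R setT (\1_B : Omega -> R).
      by apply: measurable_indic; rewrite subfieldE.
    exact: (measurable_rectangles_fst sF sG m1B).
  exact: (measurable_rectangles_snd sF sG mW).
have md : mom P (fun w => \1_B w * W w) r c.
  by apply: (mom_dom r0 _ _ WM) => [|w]; [exact: measurable_funM|exact: (dom _ id)].
have mp : mom (P \x P)%E (fun z : Omega * Omega => \1_B z.1 * W z.2) r c.
  apply: (mom_dom r0 _ _ (mom_snd WM)) => [|z]; last exact: (dom _ id).
  exact: (rectangles_measurable_fun sF sG mF mG independent_near_indep mphi).
have EE : Ex (P \x P)%E (fun z : Omega * Omega => \1_B z.1 * W z.2) = fine (P B) * Ex P W.
  have [Lp _] := mom_L1 (ltW r1) mp.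
  rewrite Ex_fubini// -ExZ//; apply: Ex_ext => w /=.
  rewrite -Ex_indic// mulrC -ExZ; last exact: L1_indic.
  by apply: Ex_ext => v; rewrite mulrC.
have dev K : 0 < K -> `|Ex P (fun w => \1_B w * W w) - fine (P B) * Ex P W| <= 2 * c * K `^ (1 - r).
  move=> K0; rewrite -EE; have [_ Ld Ed] := md; have [_ Lp Ep] := mp.
  have := moment_dev sF sG mF mG independent_near_indep mphi K0 (ltW r1) Ld Lp Ed Ep.
  by rewrite mulr0 add0r.
apply/eqP; rewrite -subr_eq0 -normr_le0 leNgt; apply/negP => e0.
have c0 := mom_ge0 WM; move: e0 dev; set e := `|_| => e0 dev.
pose x := e / (4 * (c + 1)).
have x0 : 0 < x by rewrite divr_gt0// mulr_gt0//; lra.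
have := dev (x `^ (1 - r)^-1) (powR_gt0 _ x0).
rewrite -powRrM mulVf ?powRr1 ?(ltW x0)//; last by lra.
apply/negP; rewrite -ltNge /x mulrA ltr_pdivrMr; last by lra.
by nra.
Qed.

End Product.
End IndependentFields.

Lemma measurable_random_index (d : measure_display) (Omega : measurableType d)
  (R : realType) (T : Omega -> nat) (F : nat -> Omega -> R) :
  measurable_fun setT T -> (forall i, measurable_fun setT (F i)) ->
  measurable_fun setT (fun w => F (T w) w).
Proof.
move=> mT mF _ B mB; rewrite setTI.
rewrite (_ : _ @^-1` _ = \bigcup_i (T @^-1` [set i] `&` F i @^-1` B)).
  apply: bigcup_measurable => i _; apply: measurableI.
    by rewrite -[X in measurable X]setTI; exact: mT.
  by rewrite -[X in measurable X]setTI; exact: mF.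
apply/seteqP; split => [w /= Bw|w [i _ [/= <-]]//].
by exists (T w).
Qed.

Section ConditionalExpectation.
Context (d : measure_display) (Omega : measurableType d) (R : realType)
  (P : probability Omega R).
Variable G : set (set Omega).
Hypotheses (sG : sigma_algebra setT G) (mG : G `<=` measurable).

Lemma integral_Ex_indic (f : Omega -> R) A : measurable A -> L1 P f ->
  (\int[P]_(w in A) (f w)%:E)%E = (Ex P (fun w => \1_A w * f w))%:E.
Proof.
move=> mA Lf; have mf := L1_meas Lf.
rewrite -ExE; last first.
  apply: (L1_dom _ _ (L1_norm Lf)); first exact: measurable_funM.
  move=> w; rewrite normrM ler_piMl// indicE.
  by case: (_ \in _); rewrite ?normr1 ?normr0.
rewrite integral_mkcond; apply: eq_integral => w _.
rewrite patchE indicE; case: ifP => _; by rewrite ?mul1r ?mul0r.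
Qed.

Lemma is_cexp_intro (Y f : Omega -> R) :
  @measurable_fun _ _ (g_sigma_algebraType G) R setT f -> L1 P f -> L1 P Y ->
  (forall A, G A -> Ex P (fun w => \1_A w * f w) = Ex P (fun w => \1_A w * Y w)) ->
  is_cexp P G Y f.
Proof.
move=> mf Lf LY H; split => // A GA.
by rewrite !integral_Ex_indic ?H//; exact: mG.
Qed.

Lemma is_cexp_ae (Y Y' f : Omega -> R) : measurable_fun setT Y -> measurable_fun setT Y' ->
  {ae P, forall w, Y w = Y' w} -> is_cexp P G Y f -> is_cexp P G Y' f.
Proof.
move=> mY mY' YY' [mf If fE]; split => // A GA; rewrite fE//.
apply: ae_eq_integral; first exact: mG.
- by apply: measurable_funTS; exact/measurable_EFinP.
- by apply: measurable_funTS; exact/measurable_EFinP.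
- by apply: filterS YY' => w -> _.
Qed.

Lemma cexpP (Y f : Omega -> R) : is_cexp P G Y f -> is_cexp P G Y (cexp P G Y).
Proof. by move=> fP; rewrite /cexp; case: xgetP => [g _ //|/(_ f)]. Qed.

End ConditionalExpectation.

Lemma variance_shift (R : numFieldType) (N : nat) (f : 'I_N -> R) (t : R) : (0 < N)%N ->
  N%:R^-1 * \sum_i (f i - t) ^+ 2 - (N%:R^-1 * \sum_i (f i - t)) ^+ 2 =
  N%:R^-1 * \sum_i f i ^+ 2 - (N%:R^-1 * \sum_i f i) ^+ 2.
Proof.
move=> N0; rewrite sumrB sumr_const card_ord mulrBr mean_cst//.
rewrite (eq_bigr (fun i => f i ^+ 2 + (- 2 * t) * f i + t ^+ 2)); last by move=> i _; ring.
rewrite !big_split/= -mulr_sumr sumr_const card_ord !mulrDr mean_cst// mulrCA.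
ring.
Qed.

Section Bootstrap.
Context (d d' : measure_display) (Omega : measurableType d)
  (V : measurableType d') (R : realType) (P : probability Omega R)
  (X : nat -> {RV P >-> V}) (T : nat -> {RV P >-> nat}).
Variables (N m : nat) (D : set nat) (F : nat -> Omega -> R) (r c a : R).
Hypotheses (N0 : (0 < N)%N) (TX : resampling P X N T)
  (D1 : D `<=` [set i | (1 <= i)%N]) (r1 : 1 < r)
  (F_meas : forall i, measurable_fun setT (F i))
  (F_sub : forall i : 'I_N,
     @measurable_fun _ _ (g_sigma_algebraType (sigma_of D X)) R setT (F i.+1))
  (FM : forall i : 'I_N, mom P (F i.+1) (2 * r) c).

Local Notation G := (sigma_of D X).

Let sG : sigma_algebra setT G. Proof. exact: sigma_of_sigma_algebra. Qed.
Let mG : G `<=` measurable. Proof. exact: sigma_of_measurable. Qed.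
Let mT j : measurable_fun setT (T j). Proof. by []. Qed.

Definition resampled (w : Omega) : R := a * \sum_(1 <= j < m.+1) F (T j w) w.

Definition block_mean (w : Omega) : R := N%:R^-1 * \sum_(i < N) F i.+1 w.

Definition block_dev (i : 'I_N) (w : Omega) : R := F i.+1 w - block_mean w.

Let drawn j (i : 'I_N) : set Omega := T j @^-1` [set i.+1].

Let m_drawn j i : measurable (drawn j i).
Proof. by rewrite -[X in measurable X]setTI; exact: mT. Qed.

Let P_drawn j i : (0 < j)%N -> P (drawn j i) = (N%:R^-1)%:E.
Proof. by case: TX => H _ _ j0; apply: H => //=; rewrite ltn_ord. Qed.

Let NR : 0 < N%:R :> R. Proof. by rewrite ltr0n. Qed.

Let drawn_ae : {ae P, forall w, forall j, (0 < j)%N -> exists i : 'I_N, T j w = i.+1}.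
Proof.
apply/ae_foralln => j; have [->|j0] := posnP j; first exact: filterE.
pose U := \big[setU/set0]_(i < N) drawn j i.
have mU : measurable U by exact: bigsetU_measurable.
exists (~` U); split; first exact: measurableC.
  transitivity (1 - P U)%E; first exact: probability_setC.
  rewrite (_ : P U = 1%E) ?subee//.
  have tI : trivIset setT (drawn j).
    apply/trivIsetP => i i' _ _ ii'; rewrite -subset0 => w []; rewrite /drawn /= => Ti.
    by rewrite Ti => -[/val_inj E]; rewrite E eqxx in ii'.
  transitivity (\sum_(i < N) P (drawn j i))%E.
    exact: (measure_semi_additive_ord P (m_drawn j) tI mU).
  under eq_bigr do rewrite P_drawn//.
  by rewrite sumEFin sumr_const card_ord -[_ *+ N]mulr_natl mulfV// gt_eqF.
move=> w /= nT Uw; apply: nT => _.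
by move: Uw; rewrite /U -bigcup_seq => -[i _ /= Ti]; exists i.
Qed.

Let drawn_fam j i : (0 < j)%N -> sigma_of [set j | (1 <= j)%N] T (drawn j i).
Proof. by move=> j0; apply: (sigma_of_preimage (X := fun j => T j)). Qed.

Let Ex_drawn B W r' c' : 1 < r' -> sigma_of [set j | (1 <= j)%N] T B ->
  @measurable_fun _ _ (g_sigma_algebraType G) R setT W -> mom P W r' c' ->
  Ex P (fun w => \1_B w * W w) = fine (P B) * Ex P W.
Proof.
move=> r'1 TB mW WM; have [_ _ ind] := TX.
apply: (@Ex_independent_indic _ _ _ _ _ _ _ _ _ _ ind B W r' c') => //.
- exact: sigma_of_sigma_algebra.
- exact: sigma_of_sigma_algebra.
- exact: sigma_of_measurable.
- exact: sigma_of_measurable.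
- exact: (sigma_of_mono D1).
Qed.

Let meas_mean : @measurable_fun _ _ (g_sigma_algebraType G) R setT block_mean.
Proof. by apply: measurable_funM => //; exact: measurable_sum. Qed.

Let meas_dev i : @measurable_fun _ _ (g_sigma_algebraType G) R setT (block_dev i).
Proof. exact: measurable_funB. Qed.

Let r2 : 1 < 2 * r. Proof. by move: (r1) => ?; lra. Qed.
Let c0 : 0 <= c. Proof. exact: mom_ge0 (FM (Ordinal N0)). Qed.

Let mom_block_mean : mom P block_mean (2 * r) c.
Proof. by have := mom_mean c0 r2 FM; rewrite card_ord. Qed.

Definition dev_mom_const : R := 2 `^ (2 * r) * (c + `|-1| `^ (2 * r) * c).

Let mom_dev i : mom P (block_dev i) (2 * r) dev_mom_const.
Proof.
have := momD r2 (FM i) (momZ (-1) mom_block_mean); congr mom.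
by apply/funext => w; rewrite /block_dev mulN1r.
Qed.

Let mom_dev2 i i' : mom P (fun w => block_dev i w * block_dev i' w) r (2 * dev_mom_const).
Proof. by apply: momM; rewrite ?(le_trans ler01 (ltW r1)). Qed.

Let indic_le1 (B : set Omega) w : `|\1_B w| <= 1 :> R.
Proof. by rewrite indicE; case: (_ \in _); rewrite ?normr1 ?normr0. Qed.

Let mom_indic A W r' c' : 1 < r' -> measurable A -> mom P W r' c' ->
  mom P (fun w => \1_A w * W w) r' c'.
Proof.
move=> r'1 mA WM; have [mW _ _] := WM.
apply: (mom_dom _ _ _ WM); [by lra|exact: measurable_funM|].
by move=> w; rewrite normrM ler_piMl.
Qed.

Let meas_indic A : G A -> @measurable_fun _ _ (g_sigma_algebraType G) R setT \1_A.
Proof. by move=> GA; apply: measurable_indic; rewrite subfieldE. Qed.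

Let drawn_sum (f : 'I_N -> Omega -> R) j w : (exists i : 'I_N, T j w = i.+1) ->
  exists2 i : 'I_N, T j w = i.+1 & \sum_i \1_(drawn j i) w * f i w = f i w.
Proof.
move=> [i Ti]; exists i => //; rewrite (bigD1 i)//= big1 ?addr0.
  by rewrite indicE mem_set ?mul1r.
move=> i' ii'; have ne : ~ drawn j i' w.
  by rewrite /drawn /= Ti => -[/val_inj E]; rewrite E eqxx in ii'.
by rewrite indicE memNset ?mul0r.
Qed.

(** Almost surely the value of f at the block drawn at time j; the sum over blocks
    separates the draws from the sample. *)
Definition draw (f : 'I_N -> Omega -> R) (w : Omega) j : R :=
  \sum_i \1_(drawn j i) w * f i w.

Let L1_indic_mul B W : measurable B -> L1 P W -> L1 P (fun w => \1_B w * W w).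
Proof.
move=> mB LW; apply: (L1_dom _ _ (L1_norm LW)).
  by apply: measurable_funM => //; exact: L1_meas LW.
by move=> w; rewrite normrM ler_piMl.
Qed.

Let L1F (i : 'I_N) : L1 P (F i.+1). Proof. by have [] := mom_L1 (ltW r2) (FM i). Qed.
Let L1_mean : L1 P block_mean. Proof. by have [] := mom_L1 (ltW r2) mom_block_mean. Qed.
Let L1_dev2 i i' : L1 P (fun w => block_dev i w * block_dev i' w).
Proof. by have [] := mom_L1 (ltW r1) (mom_dev2 i i'). Qed.

Let mean_cexp : is_cexp P G (fun w => a * \sum_(j < m) draw (fun i => F i.+1) w j.+1)
  (fun w => a * m%:R * block_mean w).
Proof.
have Ld j : L1 P (fun w => draw (fun i => F i.+1) w j).
  by apply: L1_sum => i _; exact: L1_indic_mul.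
apply: (is_cexp_intro mG).
- exact: measurable_funM.
- exact: L1Z.
- by apply: L1Z; apply: L1_sum => j _.
move=> A GA; have mA := mG GA.
have LAF (i : 'I_N) : L1 P (fun w => \1_A w * F i.+1 w) by exact: L1_indic_mul.
transitivity (a * (m%:R * (N%:R^-1 * \sum_(i < N) Ex P (fun w => \1_A w * F i.+1 w)))).
  rewrite -Ex_sum// -ExZ; last exact: L1_sum.
  rewrite -ExZ; last by apply: L1Z; exact: L1_sum.
  rewrite -ExZ; last by apply: L1Z; apply: L1Z; exact: L1_sum.
  apply: Ex_ext => w; rewrite /block_mean -mulr_sumr; ring.
have LA j : L1 P (fun w => \1_A w * draw (fun i => F i.+1) w j) by exact: L1_indic_mul.
rewrite (@Ex_ext _ _ _ P (fun w => \1_A w * _)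
  (fun w => a * \sum_(j < m) \1_A w * draw (fun i => F i.+1) w j.+1)); last first.
  by move=> w; rewrite -mulr_sumr mulrCA.
rewrite ExZ; last by apply: L1_sum => j _; exact: LA.
congr (_ * _); rewrite Ex_sum; last by move=> j _; exact: LA.
rewrite mulr_natl -[m in LHS]card_ord -sumr_const; apply: eq_bigr => j _.
rewrite (@Ex_ext _ _ _ P (fun w => \1_A w * draw _ _ _)
  (fun w => \sum_(i < N) \1_(drawn j.+1 i) w * (\1_A w * F i.+1 w))); last first.
  by move=> w; rewrite /draw mulr_sumr; apply: eq_bigr => i _; rewrite mulrCA.
rewrite Ex_sum; last by move=> i _; exact: L1_indic_mul.
rewrite mulr_sumr; apply: eq_bigr => i _.
rewrite (Ex_drawn r2 (drawn_fam i (isT : (0 < j.+1)%N)) _ (mom_indic r2 mA (FM i))).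
  by rewrite P_drawn.
by apply: measurable_funM; [exact: meas_indic|exact: F_sub].
Qed.

Let P_drawn2 j j' i i' : (0 < j)%N -> (0 < j')%N -> j != j' ->
  P (drawn j i `&` drawn j' i') = (N%:R^-1 * N%:R^-1)%:E.
Proof.
move=> j0 j0' jj'; have [_ ind _] := TX.
pose B x := if x == j then [set i.+1] else [set i'.+1].
have mB x : x \in [:: j; j'] -> (0 < x)%N /\ measurable (B x).
  by rewrite !inE => /orP[/eqP ->|/eqP ->].
have uq : uniq [:: j; j'] by rewrite /= inE jj'.
have := ind [:: j; j'] B uq mB.
rewrite !big_cons big_nil mule1 /B eqxx eq_sym (negbTE jj').
rewrite -/(drawn j i) -/(drawn j' i') !P_drawn// -EFinM => <-.
congr (P _); apply/seteqP; split => w.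
  move=> [/= Ti Ti'] x /=; rewrite !inE => /orP[/eqP ->|/eqP ->]; first by rewrite eqxx.
  by rewrite eq_sym (negbTE jj').
move=> /= H; split; first by have := H j; rewrite /= !inE eqxx; apply.
by have := H j'; rewrite /= !inE eqxx orbT eq_sym (negbTE jj'); apply.
Qed.

Let sum_dev w : \sum_i block_dev i w = 0.
Proof.
rewrite /block_dev sumrB sumr_const card_ord /block_mean -[_ *+ N]mulr_natl.
by rewrite mulrA mulfV ?gt_eqF// mul1r subrr.
Qed.

(* Two distinct draws are independent given the sample and contribute the square
   of the sum of the deviations, which is 0. *)
Let Ex_draw2 A j j' : G A -> (0 < j)%N -> (0 < j')%N ->
  Ex P (fun w => \1_A w * (draw block_dev w j * draw block_dev w j')) =
  if j == j' then N%:R^-1 * \sum_i Ex P (fun w => \1_A w * block_dev i w ^+ 2) else 0.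
Proof.
move=> GA j0 j0'; have mA := mG GA.
have mW i i' : @measurable_fun _ _ (g_sigma_algebraType G) R setT
    (fun w => \1_A w * (block_dev i w * block_dev i' w)).
  by apply: measurable_funM; [exact: meas_indic|exact: measurable_funM].
have LA i i' : L1 P (fun w => \1_A w * (block_dev i w * block_dev i' w)) by exact: L1_indic_mul.
have TT := sigma_of_sigma_algebra T [set j | (1 <= j)%N].
have capT B C : sigma_of [set j | (1 <= j)%N] T B -> sigma_of [set j | (1 <= j)%N] T C ->
    sigma_of [set j | (1 <= j)%N] T (B `&` C).
  by rewrite -!(subfieldE TT); exact: measurableI.
rewrite (@Ex_ext _ _ _ P (fun w => \1_A w * _) (fun w => \sum_i \sum_i'
   \1_(drawn j i `&` drawn j' i') w * (\1_A w * (block_dev i w * block_dev i' w)))); last first.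
  move=> w; rewrite /draw mulr_suml mulr_sumr; apply: eq_bigr => i _.
  rewrite !mulr_sumr; apply: eq_bigr => i' _; rewrite indicI/=; ring.
have mI i i' : measurable (drawn j i `&` drawn j' i') by exact: measurableI.
rewrite Ex_sum; last by move=> i _; apply: L1_sum => i' _; exact: L1_indic_mul.
have E i i' : Ex P (fun w => \1_(drawn j i `&` drawn j' i') w * (\1_A w * (block_dev i w * block_dev i' w)))
    = fine (P (drawn j i `&` drawn j' i')) * Ex P (fun w => \1_A w * (block_dev i w * block_dev i' w)).
  by apply: (Ex_drawn r1 _ _ (mom_indic r1 mA (mom_dev2 i i'))) => //; apply: capT; exact: drawn_fam.
under eq_bigr => i _.
  rewrite Ex_sum; last by move=> i' _; exact: L1_indic_mul.
  under eq_bigr => i' _ do rewrite E.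
  over.
have [jj'|jj'] := eqVneq j j'.
  rewrite mulr_sumr; apply: eq_bigr => i _; rewrite (bigD1 i)//= big1 ?addr0; last first.
    move=> i' ii'; rewrite jj' (_ : _ `&` _ = set0) ?measure0 ?mul0r//.
    rewrite -subset0 => w []; rewrite /drawn /= => Ti; rewrite Ti => -[/val_inj E'].
    by rewrite E' eqxx in ii'.
  by rewrite jj' setIid P_drawn.
transitivity (N%:R^-1 * N%:R^-1 * \sum_i \sum_i' Ex P (fun w => \1_A w * (block_dev i w * block_dev i' w))).
  rewrite mulr_sumr; apply: eq_bigr => i _; rewrite mulr_sumr; apply: eq_bigr => i' _.
  by rewrite P_drawn2.
rewrite (eq_bigr (fun i => Ex P (fun w => \sum_i' \1_A w * (block_dev i w * block_dev i' w)))); last first.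
  by move=> i _; rewrite Ex_sum.
rewrite big1 ?mulr0// => i _; rewrite -[RHS](Ex_cst P); apply: Ex_ext => w.
by rewrite -mulr_sumr -mulr_sumr sum_dev !mulr0.
Qed.

Let dev_cexp : is_cexp P G (fun w => a ^+ 2 * \sum_(j < m) \sum_(j' < m)
    (draw block_dev w j.+1 * draw block_dev w j'.+1))
  (fun w => a ^+ 2 * m%:R * (N%:R^-1 * \sum_i block_dev i w ^+ 2)).
Proof.
have Ldd j j' : L1 P (fun w => draw block_dev w j * draw block_dev w j').
  apply: (@L1_ext _ _ _ _ (fun w => \sum_i \sum_i'
     \1_(drawn j i `&` drawn j' i') w * (block_dev i w * block_dev i' w))).
    move=> w; rewrite /draw mulr_suml; apply: eq_bigr => i _.
    rewrite mulr_sumr; apply: eq_bigr => i' _; rewrite indicI/=; ring.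
  apply: L1_sum => i _; apply: L1_sum => i' _; apply: L1_indic_mul => //; exact: measurableI.
have Ld2 i : L1 P (fun w => block_dev i w ^+ 2) by exact: L1_dev2.
apply: (is_cexp_intro mG).
- apply: measurable_funM => //; apply: measurable_funM => //; apply: measurable_sum => i.
  exact: measurable_funX.
- by apply: L1Z; apply: L1Z; exact: L1_sum.
- by apply: L1Z; apply: L1_sum => j _; exact: L1_sum.
move=> A GA; have mA := mG GA.
have LA i : L1 P (fun w => \1_A w * block_dev i w ^+ 2) by exact: L1_indic_mul.
have LAdd j j' : L1 P (fun w => \1_A w * (draw block_dev w j * draw block_dev w j')).
  exact: L1_indic_mul.
transitivity (a ^+ 2 * (m%:R * (N%:R^-1 * \sum_(i < N) Ex P (fun w => \1_A w * block_dev i w ^+ 2)))).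
  rewrite -Ex_sum// -ExZ; last exact: L1_sum.
  rewrite -ExZ; last by apply: L1Z; exact: L1_sum.
  rewrite -ExZ; last by apply: L1Z; apply: L1Z; exact: L1_sum.
  apply: Ex_ext => w; rewrite -mulr_sumr; ring.
rewrite (@Ex_ext _ _ _ P (fun w => \1_A w * (a ^+ 2 * \sum_(j < m) _))
  (fun w => a ^+ 2 * \sum_(j < m) \sum_(j' < m) \1_A w * (draw block_dev w j.+1 * draw block_dev w j'.+1))); last first.
  move=> w; rewrite mulrCA; congr (_ * _); rewrite mulr_sumr; apply: eq_bigr => j _.
  by rewrite mulr_sumr.
rewrite ExZ; last by apply: L1_sum => j _; exact: L1_sum.
congr (_ * _); rewrite Ex_sum; last by move=> j _; exact: L1_sum.
rewrite mulr_natl -[m in LHS]card_ord -sumr_const; apply: eq_bigr => j _.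
rewrite Ex_sum// [RHS](bigD1 j)//= [X in _ = _ + X]big1 ?addr0; last first.
  by move=> j' jj'; rewrite Ex_draw2// ifN// eqSS eq_sym.
by rewrite Ex_draw2// eqxx.
Qed.

Let meas_resampled : measurable_fun setT resampled.
Proof.
apply: measurable_funM => //; apply: measurable_sum => j.
exact: measurable_random_index.
Qed.

Let meas_draw f j : (forall i, measurable_fun setT (f i)) -> measurable_fun setT (fun w => draw f w j).
Proof. by move=> mf; apply: measurable_sum => i; exact: measurable_funM. Qed.

(** Given the sample, the draws are uniform and independent, so that the
    conditional variance of a sum of m draws is m times the empirical variance
    of the blocks. *)
Lemma cvar_resampled : measurable_fun setT (cvar P G resampled) /\
  {ae P, forall w, cvar P G resampled w =
  a ^+ 2 * m%:R * (N%:R^-1 * \sum_(i < N) F i.+1 w ^+ 2 - (N%:R^-1 * \sum_(i < N) F i.+1 w) ^+ 2)}.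
Proof.
have cexpE : is_cexp P G resampled (fun w => a * m%:R * block_mean w).
  apply: (is_cexp_ae mG _ _ _ mean_cexp) => //.
    by apply: measurable_funM => //; apply: measurable_sum => j; apply: meas_draw => i.
  apply: filterS drawn_ae => w H; rewrite /resampled; congr (_ * _).
  rewrite big_add1/= big_mkord; apply: eq_bigr => j _.
  by have [i -> E] := drawn_sum (fun i => F i.+1) (H j.+1 isT).
have cexp_ae := is_cexp_ae_unique sG mG (cexpP cexpE) cexpE.
have [mc _ _] := cexpP cexpE; have mc' := measurable_fun_subfield sG mG mc.
have varE : is_cexp P G (fun w => (resampled w - cexp P G resampled w) ^+ 2)
    (fun w => a ^+ 2 * m%:R * (N%:R^-1 * \sum_i block_dev i w ^+ 2)).
  have mdev i : measurable_fun setT (block_dev i) by case: (mom_dev i).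
  apply: (is_cexp_ae mG _ _ _ dev_cexp).
  - apply: measurable_funM => //; apply: measurable_sum => j; apply: measurable_sum => j'.
    by apply: measurable_funM; exact: meas_draw.
  - by apply: measurable_funX; exact: measurable_funB.
  apply: filterS2 drawn_ae cexp_ae => w H ->.
  have E : \sum_(j < m) draw block_dev w j.+1 = \sum_(1 <= j < m.+1) F (T j w) w - m%:R * block_mean w.
    have -> : m%:R * block_mean w = \sum_(j < m) block_mean w.
      by rewrite sumr_const card_ord mulr_natl.
    rewrite big_add1/= big_mkord -sumrB.
    apply: eq_bigr => j _.
    by rewrite /draw; have [i -> ->] := drawn_sum block_dev (H j.+1 isT).
  rewrite /resampled -mulrA -mulrBr -E exprMn; congr (_ * _).
  rewrite expr2 mulr_suml; apply: eq_bigr => j _; by rewrite mulr_sumr.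
split; first by have [mv _ _] := cexpP varE; exact: measurable_fun_subfield mv.
apply: filterS (is_cexp_ae_unique sG mG (cexpP varE) varE) => w; rewrite /cvar => ->.
rewrite -(variance_shift (fun i : 'I_N => F i.+1 w) (block_mean w) N0).
by rewrite -/(\sum_i block_dev i w) sum_dev mulr0 expr0n subr0.
Qed.

End Bootstrap.
Section SchemeError.
Context (d d' : measure_display) (Omega : measurableType d)
  (V : measurableType d') (R : realType) (P : probability Omega R)
  (X : nat -> {RV P >-> V}) (h : V -> V -> R) (q s C0 m : R) (g0 : nat).
Hypothesis KS : kernel_setting X h q s C0 m g0.

Local Notation p := (4 * q).
Local Notation theta := (h_mean X h).
Local Notation Kb := (block_const X h q C0 m g0).

Let q1 : 1 < q. Proof. exact: (ks_q KS). Qed.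
Let p1 : 1 < p. Proof. by move: (q1) => ?; lra. Qed.

Lemma variance_U_stat n : (2 <= n)%N ->
  'V_P[fun w => Num.sqrt n%:R * U_stat X h n w] = (sample_variance X h n)%:E.
Proof.
move=> n2; pose U (w : Omega) := pair_mean X h (fun j : 'I_n => (0 + 1 + j)%N) w - theta.
have UE w : Num.sqrt n%:R * U_stat X h n w = Num.sqrt n%:R * (U w + theta).
  by rewrite (U_stat_pair_mean X (ks_sym KS))// subrK.
have idx_inj : injective (fun j : 'I_n => (0 + 1 + j)%N).
  by move=> i j /eqP; rewrite eqn_add2l => /eqP /val_inj.
have UM : mom P U p Kb by exact: (mom_block KS).
have LU := (mom_L1 (ltW p1) UM).1.
have p2 : 2%:R <= p by move: (q1) => ?; lra.
have [LU2 _] := mom_exprn p2 UM.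
have LUt := L1D LU (L1_cst P theta).
rewrite (_ : (fun w => _) = fun w => Num.sqrt n%:R * (U w + theta)); last exact/funext.
have eE : fine 'E_P[fun w => Num.sqrt n%:R * (U w + theta)] = Num.sqrt n%:R * (Ex P U + theta).
  rewrite unlock -[LHS]/(Ex P (fun w => Num.sqrt n%:R * (U w + theta))).
  by rewrite (ExZ _ LUt) (ExD LU (L1_cst P _)) Ex_cst.
rewrite /variance covariance.unlock eE expectation.unlock.
set e := Ex P U.
transitivity (\int[P]_w (n%:R * (U w ^+ 2 + (- 2 * e * U w + e ^+ 2)))%:E)%E.
  apply: eq_integral => w _; congr (_%:E).
  rewrite -[n%:R in RHS](@sqr_sqrtr R)//=.
  rewrite -[LHS]/((Num.sqrt n%:R * (U w + theta) - Num.sqrt n%:R * (e + theta)) *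
    (Num.sqrt n%:R * (U w + theta) - Num.sqrt n%:R * (e + theta))); ring.
have L1r := L1D (L1Z (- 2 * e) LU) (L1_cst P (e ^+ 2)).
rewrite ExE; last exact: (L1Z _ (L1D LU2 L1r)).
rewrite (ExZ _ (L1D LU2 L1r)) (ExD LU2 L1r) (ExD (L1Z _ LU) (L1_cst P _)) (ExZ _ LU) Ex_cst.
by congr (_%:E); rewrite /sample_variance -/U -/e; ring.
Qed.

Section OneSample.
Variables (k : block_scheme) (n l : nat) (T : nat -> {RV P >-> nat}).
Hypotheses (l2 : (2 <= l <= n)%N) (TX : resampling P X (num_blocks k n l) T).

Local Notation N := (num_blocks k n l).
Local Notation idx := (fun i : 'I_N => @block_index k n l i).

Let l_ge2 : (2 <= l)%N. Proof. by case/andP: l2. Qed.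
Let N0 : (0 < N)%N. Proof. exact: leq_trans (overlap_gt0 k l2) (overlap_le k l2). Qed.

Definition scheme_cvar : Omega -> R :=
  cvar P (sigma_of [set i | (1 <= i <= n)%N] X)
    (fun w => Num.sqrt (n %/ l * l)%:R * boot_U k X h n l T w).

Lemma scheme_cvarE : measurable_fun setT scheme_cvar /\
  {ae P, forall w, scheme_cvar w = block_variance X h idx w}.
Proof.
have m0 : (0 < n %/ l)%N by rewrite divn_gt0 ?(ltnW l_ge2)//; case/andP: l2.
have mR : (n %/ l)%:R != 0 :> R by rewrite pnatr_eq0 -lt0n.
pose F i w := block_U k X h n l i w.
have FE (i : 'I_N) w : F i.+1 w = pair_mean X h (idx i) w.
  exact: (block_U_pair_mean X (ks_sym KS)).
have resE : (fun w => Num.sqrt (n %/ l * l)%:R * boot_U k X h n l T w) =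
    resampled T (n %/ l) F (Num.sqrt (n %/ l * l)%:R / (n %/ l)%:R).
  by apply/funext => w; rewrite /resampled /boot_U mulrA.
have r1 : 1 < 2 * q by move: (q1) => ?; lra.
have p22 : p = 2 * (2 * q) by ring.
have DS : [set i | (1 <= i <= n)%N] `<=` [set i | (1 <= i)%N] by move=> i /= /andP[].
have F_meas i : measurable_fun setT (F i).
  pose H u v w := h (X (sample_index k n u) w) (X (sample_index k n v) w).
  pose b := block_start k l i.
  rewrite (_ : F i = fun w => 2 / (l * (l - 1))%:R * \sum_(b <= u < b + l)
    \sum_(b <= v < b + l) (if (u < v)%N then H u v w else 0)); last first.
    apply/funext => w; rewrite /F /block_U; congr (_ * _); apply: eq_bigr => u _.
    by rewrite big_mkcond.
  apply: measurable_funM => //; apply: measurable_sum => u; apply: measurable_sum => v.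
  case: (u < v)%N; last exact: measurable_cst.
  have mX : measurable_fun setT (fun w => (X (sample_index k n u) w, X (sample_index k n v) w)).
    exact: measurable_fun_pair.
  exact: (measurableT_comp (ks_meas KS) mX).
have F_sub (i : 'I_N) : @measurable_fun _ _
    (g_sigma_algebraType (sigma_of [set i | (1 <= i <= n)%N] X)) R setT (F i.+1).
  rewrite (_ : F i.+1 = pair_mean X h (idx i)); last by apply/funext => w; exact: FE.
  apply: (measurable_pair_mean KS) => j /=.
  by rewrite (@block_index_gt0 k n l l2 i j)/=; exact: block_index_le.
have FM (i : 'I_N) : mom P (F i.+1) (2 * (2 * q)) (2 `^ p * (Kb + `|theta| `^ p)).
  have UM := mom_block KS l_ge2 (@block_index_inj k n l l2 i) (@block_index_gt0 k n l l2 i).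
  rewrite -p22; have := momD p1 UM (mom_cst P theta p); congr mom.
  by apply/funext => w; rewrite subrK FE.
have [mc cE] := cvar_resampled (n %/ l)
  (Num.sqrt (n %/ l * l)%:R / (n %/ l)%:R) N0 TX DS r1 F_meas F_sub FM.
rewrite /scheme_cvar resE; split => //.
apply: filterS cE => w ->; rewrite expr_div_n sqr_sqrtr// /block_variance.
have -> : (n %/ l * l)%:R / (n %/ l)%:R ^+ 2 * (n %/ l)%:R = l%:R :> R.
  by rewrite natrM; field.
rewrite variance_shift//; congr (_ * (_ * _ - (_ * _) ^+ 2)).
  by apply: eq_bigr => i _; rewrite FE.
by apply: eq_bigr => i _; rewrite FE.
Qed.

Lemma scheme_error :
  (`|\int[P]_w ((scheme_cvar w)%:E - 'V_P[fun w' => Num.sqrt n%:R * U_stat X h n w']%R) ^+ 2|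
   <= (2 * error_const X h q C0 m g0 * `|l%:R^-1 + l%:R / n%:R|)%:E)%E.
Proof.
have n2 : (2 <= n)%N by case/andP: l2 => ?; exact: leq_trans.
have [LE EE] := block_variance_error KS l2 (overlap_gt0 k l2) (overlap_le k l2) (step_sizeM k l)
  (card_wrapped k l2) (@block_index_inj k n l l2) (fun i : 'I_N => @block_index_gt0 k n l l2 i)
  (fun i : 'I_N => @unwrappedP k n l l2 i) (@sum_block_index k n l l2 R).
have [mc cE] := scheme_cvarE.
have mv := measurable_block_variance KS l2 (@block_index_inj k n l l2)
  (fun i : 'I_N => @block_index_gt0 k n l l2 i).
rewrite variance_U_stat// (_ : (\int[P]_w _)%E =
    (Ex P (fun w => (block_variance X h idx w - sample_variance X h n) ^+ 2))%:E); last first.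
  rewrite -ExE//; apply: ae_eq_integral => //.
  - apply: (eq_measurable_fun (fun w => ((scheme_cvar w - sample_variance X h n) ^+ 2)%:E)) => //.
    by apply/measurable_EFinP; apply: measurable_funX; exact: measurable_funB.
  - by apply/measurable_EFinP; apply: measurable_funX; exact: measurable_funB.
  - by apply: filterS cE => w -> _.
have [l0 n0] : (0 < l%:R :> R) /\ (0 < n%:R :> R) by rewrite !ltr0n; split; lia.
have NR : 0 < N%:R :> R by rewrite ltr0n.
rewrite abse_EFin lee_fin ger0_norm; last by apply: Ex_ge0 => w; exact: sqr_ge0.
have e0 : 0 <= error_const X h q C0 m g0.
  have pos : 0 < l%:R^-1 + (overlap k l)%:R / N%:R :> R by rewrite ltr_pwDl ?invr_gt0 ?divr_ge0.
  rewrite -(pmulr_lge0 _ pos); apply: le_trans EE.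
  by apply: Ex_ge0 => w; exact: sqr_ge0.
move: (error_const X h q C0 m g0) EE e0 => e EE e0.
apply: le_trans EE _; rewrite (mulrC 2) -[leRHS]mulrA.
apply: ler_wpM2l => //; rewrite ger0_norm; last by rewrite addr_ge0 ?invr_ge0 ?divr_ge0 ?ltW.
have H : (overlap k l)%:R / N%:R <= 2 * (l%:R / n%:R) :> R.
  rewrite ler_pdivrMr// mulrA mulrAC ler_pdivlMr// -!natrM ler_nat mulnC.
  exact: (overlap_ratio k l2).
have : 0 <= l%:R^-1 :> R by rewrite invr_ge0 ltW.
by move: (l%:R^-1) (l%:R / n%:R) H => x y; lra.
Qed.

End OneSample.
End SchemeError.
Section Setting.
Context (R : realType) (d d' : measure_display)
  (Omega : measurableType d) (V : measurableType d') (P : probability Omega R)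
  (X : nat -> {RV P >-> V}) (h : V -> V -> R) (delta M : R).

Hypothesis h_meas : measurable_fun setT (fun z : V * V => h z.1 z.2).

Lemma mom_marginal_product :
  (\int[distribution P (X 1%N)]_x \int[distribution P (X 1%N)]_y
     (`|h x y| `^ (12 + delta))%:E <= M%:E)%E ->
  mom (marginal X \x marginal X)%E (fun z => h z.1 z.2) (12 + delta) M.
Proof.
move=> HM; apply: mom_integral => //; apply: le_trans HM.
rewrite le_eqVlt; apply/orP; left; apply/eqP.
have mhp : measurable_fun setT (fun z : V * V => (`|h z.1 z.2| `^ (12 + delta))%:E).
  by apply/measurable_EFinP; exact: measurable_abs_powR.
rewrite fubini_tonelli1// => z; rewrite lee_fin; exact: powR_ge0.
Qed.

Lemma mom_joint_shift r : stationary P X -> (forall x y, h x y = h y x) ->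
  (forall j, (1 <= j)%N ->
     ('E_P[fun w => (`|h (X 1%N w) (X (1 + j)%N w)| `^ r)%R] <= M%:E)%E) ->
  forall i j, (0 < i)%N -> (0 < j)%N -> i != j ->
    mom P (fun w => h (X i w) (X j w)) r M.
Proof.
move=> X_stationary h_sym HM; have lt i j : (0 < i)%N -> (i < j)%N -> mom P (fun w => h (X i w) (X j w)) r M.
  move=> i0 ij; have sl := same_law_sym (same_law_pair X_stationary i0 ij); have [mU _ _] := sl.
  apply: (same_law_mom sl (f := fun z : V * V => h z.1 z.2)) => //.
  apply: mom_integral; first exact: (measurableT_comp h_meas mU).
  by have := HM (j - i)%N; rewrite subn_gt0 unlock; exact.
move=> i j i0 j0; case: (ltngtP i j) => // ij _; first exact: lt.
have := lt _ _ j0 ij; congr mom; apply/funext => w; exact: h_sym.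
Qed.

End Setting.

(** The exponent $3(6+\delta')/\delta'=3+18/\delta'$ exceeds $3+18/\delta$. *)
Lemma mixing_rate_bound (R : realType) (d d' : measure_display)
  (Omega : measurableType d) (V : measurableType d') (P : probability Omega R)
  (X : nat -> {RV P >-> V}) (delta delta' : R) : 0 < delta' < delta ->
  is_O_infty (beta_coef P X) (fun n => n%:R `^ (- (3 * (6 + delta') / delta'))) ->
  exists (C0 : R) (g0 : nat), 0 <= C0 /\
    forall g, (g0 <= g)%N -> (0 < g)%N ->
      (beta_coef P X g <= (C0 * g%:R `^ (- (3 + 18 / delta)))%:E)%E.
Proof.
move=> /andP[d0 dd] [C [g0 _ HC]]; exists `|C|, g0; split => // g gg0 g1.
apply: le_trans (lee_abs _) _; apply: le_trans (HC g gg0) _; rewrite lee_fin.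
apply: (@le_trans _ _ (`|C| * `|g%:R `^ (- (3 * (6 + delta') / delta'))|)).
  by rewrite ler_wpM2r// ler_norm.
rewrite ler_wpM2l// ger0_norm ?powR_ge0//; apply: ler_powR; first by rewrite ler1n.
rewrite lerN2 (_ : 3 * (6 + delta') / delta' = 3 + 18 / delta'); last by field; rewrite gt_eqF.
have d1 : 0 < delta by exact: lt_trans dd.
by rewrite lerD2l ler_wpM2l// lef_pV2 ?posrE// ltW.
Qed.

Theorem theorem2p3 (R : realType) (d : measure_display)
  (Omega : measurableType d) (P : probability Omega R)
  (S : normedModType R) (S_separable : separable S)
  (X : nat -> {RV P >-> borel S})
  (X_stationary : stationary P X)
  (X_regular : absolutely_regular P X)
  (h : S -> S -> R)
  (h_sym : forall x y, h x y = h y x)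
  (h_meas : measurable_fun setT (fun p : borel S * borel S => h p.1 p.2))
  (h_nondeg : ~ degenerate P (X 1%N) h)
  (l : nat -> nat)
  (l_range : forall n, (2 <= n)%N -> (2 <= l n <= n)%N)
  (l_infty : l n @[n --> \oo] --> \oo)
  (T : block_scheme -> nat -> nat -> {RV P >-> nat})
  (T_resampling : forall k n, (2 <= n)%N ->
     resampling P X (num_blocks k n (l n)) (T k n))
  (delta M : R) (delta_gt0 : 0 < delta)
  (moment_prod :
     (\int[distribution P (X 1%N)]_x \int[distribution P (X 1%N)]_y
        (`|h x y| `^ (12 + delta))%:E <= M%:E)%E)
  (moment_joint : forall j, (1 <= j)%N ->
     ('E_P[fun w => (`|h (X 1%N w) (X (1 + j)%N w)| `^ (4 + 2 / 3 * delta))%R]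
        <= M%:E)%E)
  (mixing_rate : exists delta' : R, 0 < delta' < delta /\
     is_O_infty (beta_coef P X)
          (fun n => n%:R `^ (- (3 * (6 + delta') / delta')))) :
  forall k : block_scheme,
    is_O_infty
      (fun n =>
         \int[P]_w
           ((cvar P (sigma_of [set i | (1 <= i <= n)%N] X)
                (fun w' => Num.sqrt (n %/ l n * l n)%:R
                           * boot_U k X h n (l n) (T k n) w') w)%:E
            - 'V_P[fun w' => Num.sqrt n%:R * U_stat X h n w']%R) ^+ 2)%E
      (fun n => (l n)%:R^-1 + (l n)%:R / n%:R).
Proof.
move=> k.
have [delta' [dd rate]] := mixing_rate.
have [C0 [g0 [C00 {}rate]]] := mixing_rate_bound dd rate.
(* q = 1 + delta / 6 makes 4q the exponent of the joint moments, and then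
   (q - 1) s = 3 forces s = 18 / delta. *)
have p4 : 4 + 2 / 3 * delta = 4 * (1 + delta / 6) by field.
have prodM := mom_marginal_product h_meas moment_prod.
have M0 := mom_ge0 prodM.
have KS : @kernel_setting _ _ Omega (borel S) R P X h (1 + delta / 6) (18 / delta) C0 (1 + M) g0.
  split => //.
  - by rewrite ltrDl divr_gt0.
  - by field; rewrite gt_eqF.
  - move=> i j i0 j0 ij; rewrite -p4; apply: (mom_le (m := M)); first by rewrite lerDr.
    exact: (mom_joint_shift h_meas X_stationary h_sym moment_joint i0 j0 ij).
  - by apply: (mom_weaken _ prodM); apply/andP; split; lra.
exists (2 * error_const X h (1 + delta / 6) C0 (1 + M) g0).
exists 2%N => // n /= n2.
exact: (scheme_error KS (l_range n n2) (T_resampling k n n2)).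
Qed.
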